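(* Let $\mathcal H$ be a separable real Hilbert space. Let $(M_n,\mathcal F_n)_{n\ge0}$ be a martingale in $\mathcal H$ with $M_0=0$ and increments $X_n=M_n-M_{n-1}$ satisfying $\mathbb E[X_n\mid\mathcal F_{n-1}]=0$ and $\|X_n\|\le1$ a.s. for all $n\ge1$. Write $V_n=\sum_{i=1}^n\mathbb E[X_i\otimes X_i\mid\mathcal F_{i-1}]$. Then for every $\rho>0$ and $y\ge0$, \[ \mathbb P\Bigl[\exists n\ge1:\ \rho\, h\Bigl(\frac{\|(V_n+\rho I)^{-1/2}M_n\|}{\sqrt\rho}\Bigr)>y+\ell_\rho(V_n)\Bigr]\le e^{-y}. \]
   Context: $h(u)=(1+u)\log(1+u)-u$ for $u\ge0$. For $\rho>0$ and $V$ a positive (self-adjoint, positive semidefinite) trace-class operator, $\ell_\rho(V)=\frac12\log\det(I+\rho^{-1}V)$, with $\det$ the Fredholm determinant (for self-adjoint trace-class $A$, $\det(I+A)=\prod_j(1+\lambda_j(A))$ over the nonzero eigenvalues with multiplicity). For $x,y\in\mathcal H$, $x\otimes y$ is the rank-one operator $(x\otimes y)u=\langle x,u\rangle y$, and $\mathbb E[X\otimes X\mid\mathcal G]$ is the conditional Bochner expectation in the trace-class operators, characterized by $\langle u,\mathbb E[X\otimes X\mid\mathcal G]v\rangle=\mathbb E[\langle u,X\rangle\langle X,v\rangle\mid\mathcal G]$. *)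

(* Defs.v *)
From HB Require Import structures.
From mathcomp Require Export all_boot all_order all_algebra.
From mathcomp Require Export all_classical all_reals all_analysis.

Set Implicit Arguments.
Unset Strict Implicit.
Unset Printing Implicit Defensive.

Export Order.TTheory GRing.Theory Num.Theory.
Export numFieldNormedType.Exports.
Global Open Scope classical_set_scope.
Global Open Scope ring_scope.

Definition hfun (R : realType) (u : R) : R := (1 + u) * ln (1 + u) - u.

(* A real Hilbert space is a complete normed module H with an inner product ip
   inducing its norm. *)
Definition induces_norm (R : realType) (H : completeNormedModType R)
    (ip : {dot H for idfun}) : Prop :=
  forall x : H, ip x x = `|x| ^+ 2.

Definition separable_space (T : topologicalType) : Prop :=
  exists2 D : set T, countable D & dense D.

Section Operators.
Context (R : realType) (H : completeNormedModType R) (ip : {dot H for idfun}).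
Implicit Types (V S A B : H -> H).

Definition rank_one (x y : H) : H -> H := fun u => ip x u *: y.

Definition positive_op V : Prop :=
  [/\ linear V, continuous V, forall x y, ip (V x) y = ip x (V y)
    & forall x, 0 <= ip x (V x)].

(* The index set is a subset of H, so that finite-dimensional spaces are not
   excluded. *)
Definition orthonormal_basis (E : set H) : Prop :=
  [/\ forall e, E e -> ip e e = 1,
      forall e f, E e -> E f -> e <> f -> ip e f = 0
    & forall x, (forall e, E e -> ip e x = 0) -> x = 0].

Definition op_trace (E : set H) V : \bar R := (\esum_(e in E) (ip e (V e))%:E)%E.

Definition positive_trace_class V : Prop :=
  positive_op V /\
  forall E, orthonormal_basis E -> (op_trace E V < +oo)%E.

Definition linearly_independent (k : nat) (f : 'I_k -> H) : Prop :=
  forall c : 'I_k -> R, \sum_(i < k) c i *: f i = 0 -> forall i, c i = 0.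

(* Every mu <> 0 occurs in the sequence lam exactly dim ker (A - mu) times,
   compared through "dim >= k" for all k; the terms not used for a nonzero
   eigenvalue are 0. *)
Definition eigenvalue_enumeration A (lam : nat -> R) : Prop :=
  forall (mu : R) (k : nat), mu != 0 ->
    (exists2 f : 'I_k -> H, linearly_independent f
                          & forall i, A (f i) = mu *: f i)
    <-> (exists2 j : 'I_k -> nat, injective j & forall i, lam (j i) = mu).

Definition eigenvalues A : nat -> R := get [set lam | eigenvalue_enumeration A lam].

(* det (I + A), for A self-adjoint and trace class; the padding zeros of the
   enumeration contribute factors 1. *)
Definition fredholm_det A : R :=
  limn (fun n => \prod_(j < n) (1 + eigenvalues A j)).

Definition ell (rho : R) V : R :=
  2^-1 * ln (fredholm_det (fun x => rho^-1 *: V x)).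

Definition op_inv A : H -> H :=
  xget (fun=> 0) [set S | forall x, S (A x) = x /\ A (S x) = x].

Definition op_sqrt S : H -> H :=
  xget (fun=> 0) [set B | positive_op B /\ forall x, B (B x) = S x].

Definition op_inv_sqrt A : H -> H := op_sqrt (op_inv A).

End Operators.

Section ConditionalExpectation.
Context (d : measure_display) (T : measurableType d) (R : realType).
Context (P : probability T R).

Definition filtration (F : nat -> set (set T)) : Prop :=
  [/\ forall n, sigma_algebra setT (F n),
      forall n, F n `<=` measurable
    & forall m n, (m <= n)%N -> F m `<=` F n].

(* In the three notions below, G is a sub-sigma-algebra and the second function
   is a version of the conditional expectation of the first one given G. *)

Definition real_cexp (G : set (set T)) (f g : T -> R) : Prop :=
  [/\ P.-integrable setT (EFin \o f),
      P.-integrable setT (EFin \o g),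
      forall B : set R, measurable B -> G (g @^-1` B)
    & forall A, G A ->
        (\int[P]_(w in A) (f w)%:E = \int[P]_(w in A) (g w)%:E)%E].

Context (H : completeNormedModType R) (ip : {dot H for idfun}).

(* Since G is a sigma-algebra, this is Borel measurability, which is strong
   measurability when H is separable. *)
Definition hilbert_measurable (G : set (set T)) (X : T -> H) : Prop :=
  forall U : set H, open U -> G (X @^-1` U).

Definition bochner_integrable (X : T -> H) : Prop :=
  hilbert_measurable measurable X /\
  P.-integrable setT (EFin \o (fun w => `|X w|)).

(* <u, E[X | G]> = E[<u, X> | G] for all u: Bochner integrals over the sets of G
   are determined by their inner products with the vectors u. *)
Definition hilbert_cexp (G : set (set T)) (X Y : T -> H) : Prop :=
  [/\ bochner_integrable X, bochner_integrable Y, hilbert_measurable G Y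
    & forall u : H, real_cexp G (fun w => ip u (X w)) (fun w => ip u (Y w))].

(* <u, E[Z | G] v> = E[<u, Z v> | G] for all u and v, for Z with values in the
   positive trace-class operators. *)
Definition operator_cexp (G : set (set T)) (Z C : T -> H -> H) : Prop :=
  {ae P, forall w, positive_trace_class ip (C w)} /\
  forall u v : H, real_cexp G (fun w => ip u (Z w v)) (fun w => ip u (C w v)).

Definition martingale (F : nat -> set (set T)) (M : nat -> T -> H) : Prop :=
  [/\ forall n, hilbert_measurable (F n) (M n),
      forall n, bochner_integrable (M n)
    & forall n, hilbert_cexp (F n) (M n.+1) (M n)].

End ConditionalExpectation.

(* Meant for n >= 1. *)
Definition increment (T : Type) (V : zmodType) (M : nat -> T -> V) (n : nat) :
  T -> V := fun w => M n w - M n.-1 w.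

(* Main.v *)
Require Import Defs.
From mathcomp Require Import ring lra measurable_realfun.

Set Implicit Arguments.
Unset Strict Implicit.
Unset Printing Implicit Defensive.

(** In finite dimension, [expR (rho * h (|(V_n + rho)^(-1/2) M_n| / sqrt rho) - ell_rho (V_n))]
    is a supermartingale starting at 1.  Write [A = V_n + rho], [A' = A + E[X (x) X | F_n]],
    [q = <M_n, A'^-1 M_n>] and [r = sqrt (q / rho)].  A scalar inequality bounds
    [expR (rho * h (|A'^(-1/2) (M_n + X)| / sqrt rho) - rho * h r)] by
    [1 + (ln (1 + r) / r) Z + W / 2 + (ln (1 + r) / (2 r)) Z^2], where [Z = <A'^-1 M_n, X>] and
    [W = <X, A'^-1 X>].  The conditional mean of this bound is compensated by the increment of
    [rho * h] when [A] is replaced by [A'] and by that of [ln det] (Hadamard), so Ville's maximal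
    inequality applies.  In general the coordinates of [M_n] and [V_n] in the first [N] vectors of
    an orthonormal basis form such a finite-dimensional process; as [N] grows, the quadratic forms
    and the determinants converge to their Hilbert space counterparts, and Fatou's lemma for sets
    transfers the inequality. *)

(** * A scalar inequality *)

(** Put [t = Z / r], [w = rho * W] and [d = 1 / rho] in the scalar inequality and take logarithms.
    With [r], [t], [w] frozen, the two sides are functions of [d] that agree at [d = 0], so it
    suffices to compare slopes; explicit bounds on the logarithm then leave polynomial inequalities.
    The step is estimated at [A'] rather than at [A] because [A'] is already known at time [n]: the
    bound is a quadratic polynomial in [X] with known coefficients, and its conditional mean
    involves only [E[X | F_n] = 0] and [C = E[X (x) X | F_n]]. Its quadratic terms become
    [tr (A'^-1 C) / 2] and a multiple of [<b, C b>] with [b = A'^-1 M_n]; the concavity of [ln det]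
    pays for the first, the convexity of [h] for the second. In the limit the obstacle is that
    [fredholm_det] and [op_inv_sqrt] are chosen objects. A spectral decomposition, built by
    repeatedly splitting off a top eigenvector, supplies witnesses, and the numbers that matter are
    shown to be the same for every choice. *)

Section Poly.
Variable R : realType.
Implicit Types s t p Y : R.

(** In powers of [a = s - 1] the difference has nonnegative coefficients, because
    [t (1 - t) <= 1 / 4]. *)
Lemma poly_bound_large s t : 1 <= s -> 0 <= t <= 1 ->
  4 * (t * (1 - t)) * (s + 2 * t) ^+ 2 <= s * (2 + 3 * s * t + s ^+ 2).
Proof.
move=> s1 /andP[t0 t1].
pose a := s - 1; have -> : s = 1 + a by rewrite /a; ring.
have a0 : 0 <= a by rewrite /a; lra.
pose T := t * (1 - t).
have T0 : 0 <= T by rewrite mulr_ge0// subr_ge0.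
have T1 : 4 * T <= 1 by rewrite /T; have := sqr_ge0 (2 * t - 1); lra.
(* Subtracting [(20 t^2 - 8)^2 / 25 + (8 t - 5)^2 / 80] leaves a positive constant. *)
have c0 : 0 <= 3 - t - 12 * t ^+ 2 + 16 * t ^+ 4.
  have := sqr_ge0 (20 * t ^+ 2 - 8); have := sqr_ge0 (8 * t - 5); lra.
rewrite -subr_ge0.
have -> : (1 + a) * (2 + 3 * (1 + a) * t + (1 + a) ^+ 2) -
  4 * (t * (1 - t)) * (1 + a + 2 * t) ^+ 2 =
  (3 - t - 12 * t ^+ 2 + 16 * t ^+ 4) + (5 + 6 * t - T * (8 + 16 * t)) * a
  + (3 + 3 * t - 4 * T) * a ^+ 2 + a ^+ 3 by rewrite /T; ring.
have h1 : 0 <= T * t by exact: mulr_ge0.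
have h2 : 4 * T * t <= t by rewrite -[leRHS]mul1r; apply: ler_wpM2r.
have h3 : 0 <= 5 + 6 * t - T * (8 + 16 * t) by lra.
have h4 : 0 <= 3 + 3 * t - 4 * T by lra.
apply: addr_ge0; last exact: exprn_ge0.
apply: addr_ge0; last by apply: mulr_ge0 => //; exact: exprn_ge0.
by apply: addr_ge0 => //; exact: mulr_ge0.
Qed.

(** In powers of [s] all coefficients of the difference are nonnegative. The squares in the proof
    sit at the extremal points [t = 2/3], [1/2] and [4/5] of [t^2 (1 - t)], [4 - 27 t^2 + 36 t^3]
    and [t^4 (1 - t)]. *)
Lemma poly_bound_cubic s t : 0 <= s -> 0 <= t <= 1 ->
  6 * (t * (1 - t)) * (s + 2 * t) ^+ 3 <= (2 + 3 * s * t + s ^+ 2) ^+ 2.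
Proof.
move=> s0 /andP[t0 t1].
have t1' : 0 <= 1 - t by rewrite subr_ge0.
have u : 27 * (t ^+ 2 * (1 - t)) <= 4.
  have : 0 <= (3 * t - 2) ^+ 2 * (3 * t + 1).
    by apply: mulr_ge0; [exact: sqr_ge0 | lra].
  lra.
have c2 : 0 <= 4 - 27 * t ^+ 2 + 36 * t ^+ 3.
  have : 0 <= (2 * t - 1) ^+ 2 * (4 * t + 1).
    by apply: mulr_ge0; [exact: sqr_ge0 | lra].
  lra.
have c0 : 12 * (t ^+ 4 * (1 - t)) <= 1.
  have : 0 <= (5 * t - 4) ^+ 2 * (125 * t ^+ 3 + 75 * t ^+ 2 + 40 * t + 16).
    have ? := exprn_ge0 3 t0; have ? := exprn_ge0 2 t0.
    by apply: mulr_ge0; [exact: sqr_ge0 | lra].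
  lra.
rewrite -subr_ge0.
have -> : (2 + 3 * s * t + s ^+ 2) ^+ 2 - 6 * (t * (1 - t)) * (s + 2 * t) ^+ 3
  = (4 - 48 * (t ^+ 4 * (1 - t))) + 12 * t * (1 - 6 * (t ^+ 2 * (1 - t))) * s
  + (4 - 27 * t ^+ 2 + 36 * t ^+ 3) * s ^+ 2 + 6 * t ^+ 2 * s ^+ 3 + s ^+ 4 by ring.
have h1 : 0 <= 4 - 48 * (t ^+ 4 * (1 - t)) by lra.
have h2 : 0 <= 12 * t * (1 - 6 * (t ^+ 2 * (1 - t))) * s.
  by apply: mulr_ge0 => //; apply: mulr_ge0; lra.
have h3 : 0 <= (4 - 27 * t ^+ 2 + 36 * t ^+ 3) * s ^+ 2.
  by apply: mulr_ge0 => //; exact: sqr_ge0.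
have h4 : 0 <= 6 * t ^+ 2 * s ^+ 3.
  by apply: mulr_ge0; [apply: mulr_ge0 => //; exact: sqr_ge0 | exact: exprn_ge0].
have h5 : 0 <= s ^+ 4 by exact: exprn_ge0.
by do !apply: addr_ge0 => //.
Qed.

(** The coefficients [c2] and [c3] of [s^2] and [s^3] may be negative, so summation by parts is
    used: on [0 <= s <= 1] it is enough that [c0], [c1], [c0 + c1 + c2] and [c0 + c1 + c2 + c3] are
    nonnegative. *)
Lemma poly_bound_small s t : 0 <= s <= 1 -> 0 <= t <= 1 ->
  72 * (1 - t) ^+ 2 * (s + 2 * t) ^+ 3 <= 11 * (2 + 3 * s * t + s ^+ 2) ^+ 2.
Proof.
move=> /andP[s0 s1] /andP[t0 t1].
pose u := (1 - t) ^+ 2.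
have u0 : 0 <= u by exact: sqr_ge0.
pose c0 := 44 - 576 * (u * t ^+ 3).
pose c1 := 12 * t * (11 - 72 * (t * u)).
pose c2 := 11 * (9 * t ^+ 2 + 4) - 432 * (t * u).
pose c3 := 66 * t - 72 * u.
have tu : 27 * (t * u) <= 4.
  have : 0 <= (3 * t - 1) ^+ 2 * (4 - 3 * t).
    by apply: mulr_ge0; [exact: sqr_ge0 | lra].
  rewrite /u; lra.
have tu0 : 0 <= t * u by exact: mulr_ge0.
have t31 : t ^+ 2 <= 1 by exact: exprn_ile1.
have t20 : 0 <= t ^+ 2 by exact: sqr_ge0.
have tu3 : 27 * (u * t ^+ 3) <= 4.
  have -> : 27 * (u * t ^+ 3) = 27 * (t * u) * t ^+ 2 by ring.
  apply: le_trans tu; rewrite -[leRHS]mulr1; apply: ler_wpM2l => //; lra.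
have tu3b : 576 * (u * t ^+ 3) <= 20.
  have h3 : t ^+ 3 <= t ^+ 2 by rewrite exprSr ler_piMr.
  have h2 : t ^+ 2 <= t by rewrite expr2 ler_piMr.
  have : 0 <= (5 * t - 3) ^+ 2 * (- 125 * t ^+ 3 + 100 * t ^+ 2 + 40 * t + 12).
    by apply: mulr_ge0; [exact: sqr_ge0 | lra].
  rewrite /u; lra.
have c00 : 0 <= c0 by rewrite /c0; lra.
have c10 : 0 <= c1 by rewrite /c1; apply: mulr_ge0; lra.
have c012 : c0 + c1 + c2 = 88 + 132 * t + 99 * t ^+ 2 - 576 * (u * t ^+ 3)
    - 864 * (t * u) * t - 432 * (t * u) by rewrite /c0 /c1 /c2; ring.
have h2 : 27 * (t * u * t) <= 4 * t.
  rewrite -subr_ge0 (_ : _ - _ = t * (4 - 27 * (t * u))); last by ring.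
  by apply: mulr_ge0 => //; lra.
have C : 0 <= c0 + c1 + c2.
  by rewrite c012; lra.
have t1' : 0 <= 1 - t by rewrite subr_ge0.
have C3 : 0 <= c0 + c1 + c2 + c3.
  have h1 : 0 <= 288 * t ^+ 3 * (1 - t) * (1 + 2 * t).
    apply: mulr_ge0; last by apply: addr_ge0 => //; exact: mulr_ge0.
    by do 2!apply: mulr_ge0 => //; exact: exprn_ge0.
  have h3 : 0 <= (25 * t - 6) ^+ 2 * (25 * t + 12) by apply: mulr_ge0; [exact: sqr_ge0|lra].
  have h4 := sqr_ge0 (7 * t - 2).
  rewrite c012 /c3 /u; lra.
rewrite -subr_ge0.
have -> : 11 * (2 + 3 * s * t + s ^+ 2) ^+ 2 - 72 * (1 - t) ^+ 2 * (s + 2 * t) ^+ 3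
 = c0 * (1 - s) * (1 + s) + c1 * s * (1 - s)
   + s ^+ 2 * ((1 - s) * (c0 + c1 + c2) + s * (c0 + c1 + c2 + c3)) + 11 * s ^+ 4.
  by rewrite /c0 /c1 /c2 /c3 /u; ring.
have s1' : 0 <= 1 - s by rewrite subr_ge0.
have s2' : 0 <= 1 + s by exact: addr_ge0.
have k1 : 0 <= c0 * (1 - s) * (1 + s) by apply: mulr_ge0 => //; exact: mulr_ge0.
have k2 : 0 <= c1 * s * (1 - s) by apply: mulr_ge0 => //; exact: mulr_ge0.
have k3 : 0 <= s ^+ 2 * ((1 - s) * (c0 + c1 + c2) + s * (c0 + c1 + c2 + c3)).
  by apply: mulr_ge0; [exact: sqr_ge0 | apply: addr_ge0; exact: mulr_ge0].
have k4 : 0 <= 11 * s ^+ 4 by apply: mulr_ge0 => //; exact: exprn_ge0.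
exact: (addr_ge0 (addr_ge0 (addr_ge0 k1 k2) k3) k4).
Qed.

End Poly.

Section Poly.
Variable R : realType.
Implicit Types s t p Y : R.

(** The arithmetic-geometric mean inequality without square roots; it splits cross terms in [s t]
    into an [s^2] part and a [t^2] part. *)
Lemma amgm_le (a b c : R) : 0 <= a -> 0 <= b -> 0 <= c -> c ^+ 2 <= 4 * a * b -> c <= a + b.
Proof.
move=> a0 b0 c0 h; rewrite -(@ler_pXn2r _ 2) ?nnegrE ?addr_ge0//.
by apply: le_trans h _; have := sqr_ge0 (a - b); lra.
Qed.

(* In [rescaled_bound], [s = d / r], [p = r / (2 + r)] and [Y = 1 - r / v]. *)
Lemma rescaled_bound_small s t p Y : s + 2 * t <= 1 -> 0 < s -> 0 <= t <= 1 -> 0 <= p < 1 -> 0 <= Y <= 1 ->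
  Y * (2 + 3 * s * t + s ^+ 2) <= s * (s + 2 * t) ->
  t * (1 - t) * ((1 - p) * Y ^+ 2 + 2 * p * Y) <=
  (1 + p) * (s ^+ 2 / (4 * (1 - p + p * (s + 2 * t))) + p * t ^+ 2 / (2 * (3 - p ^+ 2))).
Proof.
move=> z1 s0 /andP[t0 t1] /andP[p0 p1] /andP[Y0 Y1] hY.
set z := s + 2 * t in z1 hY *; set D := _ + _ + _ in hY.
set Q := 1 - p + p * z.
have z0 : 0 < z by rewrite /z; lra.
have D2 : 2 <= D by rewrite /D; have := sqr_ge0 s; have := mulr_ge0 (ltW s0) t0; lra.
have pp : 0 <= 1 + p by lra.
have pm : 0 <= 1 - p by lra.
have T0 : 0 <= t * (1 - t) by apply: mulr_ge0; lra.
have T1 : 4 * (t * (1 - t)) <= 1 by have := sqr_ge0 (2 * t - 1); lra.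
have p2 : p ^+ 2 <= p by rewrite expr2 ler_piMr// ltW.
have p20 : 0 <= p ^+ 2 by exact: sqr_ge0.
have pz0 : 0 <= p * z by apply: mulr_ge0 => //; exact: ltW.
have Q0 : 0 < Q by rewrite /Q; lra.
have Ysz : Y <= s * z / D by rewrite ler_pdivlMr //; lra.
have sz0 : 0 <= s * z by apply: mulr_ge0 => //; exact: ltW.
have Ysz2 : 2 * Y <= s * z by apply: le_trans hY; rewrite mulrC; apply: ler_wpM2l.
have i1 : p * t ^+ 2 / 6 <= p * t ^+ 2 / (2 * (3 - p ^+ 2)).
  apply: ler_wpM2l; first by apply: mulr_ge0 => //; exact: sqr_ge0.
  by rewrite lef_pV2 ?posrE; lra.
have t20 : 0 <= t ^+ 2 by exact: sqr_ge0.
have s20 : 0 <= s ^+ 2 by exact: sqr_ge0.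
have Q1 : Q <= 1 by rewrite /Q; have : p * z <= p by [rewrite ler_piMr]; lra.
have i2 : s ^+ 2 / 4 <= s ^+ 2 / (4 * Q).
  by apply: ler_wpM2l => //; rewrite lef_pV2 ?posrE; lra.
have Ys : 2 * Y <= s by apply: le_trans Ysz2 _; rewrite ler_piMr// ltW.
have Y2 : 4 * Y ^+ 2 <= s ^+ 2.
  have : (2 * Y) ^+ 2 <= s ^+ 2 by rewrite ler_pXn2r// nnegrE; lra.
  by rewrite exprMn; lra.
(* For [z <= 1] little is lost by enlarging the denominators through [Q <= 1] and [3 - p^2 <= 3]. *)
apply: (@le_trans _ _ ((1 + p) * (s ^+ 2 / 4 + p * t ^+ 2 / 6))); last first.
  by apply: ler_wpM2l; [exact: pp | exact: lerD].
have k1 : t * (1 - t) * ((1 - p) * Y ^+ 2) <= (1 - p) * s ^+ 2 / 16.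
  have : (4 * (t * (1 - t))) * ((1 - p) * (4 * Y ^+ 2)) <= 1 * ((1 - p) * s ^+ 2).
    apply: ler_pM => //.
    - by apply: mulr_ge0.
    - by apply: (mulr_ge0 pm); apply: mulr_ge0 => //; exact: sqr_ge0.
    - exact: ler_wpM2l pm _ _ Y2.
  lra.
have k2 : t * (1 - t) * (2 * p * Y) <= p * (t * (1 - t)) * s * (s + 2 * t).
  have -> : t * (1 - t) * (2 * p * Y) = t * (1 - t) * p * (2 * Y) by ring.
  have -> : p * (t * (1 - t)) * s * (s + 2 * t) = t * (1 - t) * p * (s * z) by rewrite /z; ring.
  by apply: ler_wpM2l => //; apply: mulr_ge0.
have k3 : 4 * (p * (t * (1 - t)) * s ^+ 2) <= p * s ^+ 2.
  have -> : 4 * (p * (t * (1 - t)) * s ^+ 2) = 4 * (t * (1 - t)) * (p * s ^+ 2) by ring.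
  by rewrite -[leRHS]mul1r; apply: ler_wpM2r => //; apply: mulr_ge0.
(* [(3 + p) / 16] is what remains of the coefficient [(1 + p) / 4] of [s^2] once [k1] has used
   [(1 - p) / 16] and [k3] has used [p / 4]. *)
have k4 : p * (2 * (t * (1 - t))) * s * t <= (3 + p) * s ^+ 2 / 16 + (1 + p) * p * t ^+ 2 / 6.
  apply: amgm_le.
  - by apply: mulr_ge0 => //; apply: mulr_ge0 => //; lra.
  - by apply: mulr_ge0 => //; apply: mulr_ge0 => //; apply: mulr_ge0 => //; lra.
  - by do !apply: mulr_ge0 => //; lra.
  have -> : (p * (2 * (t * (1 - t))) * s * t) ^+ 2 =
     (2 * (t * (1 - t))) ^+ 2 * (p ^+ 2 * (s ^+ 2 * t ^+ 2)) by ring.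
  have -> : 4 * ((3 + p) * s ^+ 2 / 16) * ((1 + p) * p * t ^+ 2 / 6) =
      4^-1 * ((3 + p) * (1 + p) * p / 6 * (s ^+ 2 * t ^+ 2)) by field.
  apply: ler_pM => //.
  - by do !apply: mulr_ge0 => //; lra.
  - by do !apply: mulr_ge0 => //; lra.
  - have : (4 * (t * (1 - t))) ^+ 2 <= 1 by apply: exprn_ile1 => //; lra.
    by rewrite !exprMn; lra.
  apply: ler_wpM2r; first exact: mulr_ge0.
  have : 0 <= p * (3 - 2 * p + p ^+ 2) by apply: mulr_ge0; lra.
  by lra.
rewrite /z in k2 k3 k4 *; lra.
Qed.

End Poly.

Section Poly.
Variable R : realType.
Implicit Types s t p Y : R.

(** For [z > 1] the bound [Q <= z] removes [p] from the first denominator. If [s >= 1], then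
    [Y^2 <= Y] and [poly_bound_large] suffice. Otherwise [poly_bound_cubic] bounds the [Y^2] term by
    the share [(1 - p) / (6 z)] of [s^2], and the linear term is split by [amgm_le] using the rest
    [(1 + 5 p) / (12 z)] and [poly_bound_small]. *)
Lemma rescaled_bound_large s t p Y : 1 < s + 2 * t -> 0 < s -> 0 <= t <= 1 -> 0 <= p < 1 -> 0 <= Y <= 1 ->
  Y * (2 + 3 * s * t + s ^+ 2) <= s * (s + 2 * t) ->
  t * (1 - t) * ((1 - p) * Y ^+ 2 + 2 * p * Y) <=
  (1 + p) * (s ^+ 2 / (4 * (1 - p + p * (s + 2 * t))) + p * t ^+ 2 / (2 * (3 - p ^+ 2))).
Proof.
move=> z1 s0 /andP[t0 t1] /andP[p0 p1] /andP[Y0 Y1] hY.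
set z := s + 2 * t in z1 hY *; set D := _ + _ + _ in hY.
set Q := 1 - p + p * z.
have z0 : 0 < z by rewrite /z; lra.
have D2 : 2 <= D by rewrite /D; have := sqr_ge0 s; have := mulr_ge0 (ltW s0) t0; lra.
have pp : 0 <= 1 + p by lra.
have pm : 0 <= 1 - p by lra.
have T0 : 0 <= t * (1 - t) by apply: mulr_ge0; lra.
have T1 : 4 * (t * (1 - t)) <= 1 by have := sqr_ge0 (2 * t - 1); lra.
have p2 : p ^+ 2 <= p by rewrite expr2 ler_piMr// ltW.
have p20 : 0 <= p ^+ 2 by exact: sqr_ge0.
have pz0 : 0 <= p * z by apply: mulr_ge0 => //; exact: ltW.
have Q0 : 0 < Q by rewrite /Q; lra.
have Ysz : Y <= s * z / D by rewrite ler_pdivlMr //; lra.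
have sz0 : 0 <= s * z by apply: mulr_ge0 => //; exact: ltW.
have Ysz2 : 2 * Y <= s * z by apply: le_trans hY; rewrite mulrC; apply: ler_wpM2l.
have i1 : p * t ^+ 2 / 6 <= p * t ^+ 2 / (2 * (3 - p ^+ 2)).
  apply: ler_wpM2l; first by apply: mulr_ge0 => //; exact: sqr_ge0.
  by rewrite lef_pV2 ?posrE; lra.
have t20 : 0 <= t ^+ 2 by exact: sqr_ge0.
have s20 : 0 <= s ^+ 2 by exact: sqr_ge0.
have Qz : Q <= z.
  rewrite -subr_ge0 (_ : z - Q = (1 - p) * (z - 1)); last by rewrite /Q; ring.
  by apply: mulr_ge0; lra.
have i2 : s ^+ 2 / (4 * z) <= s ^+ 2 / (4 * Q).
  by apply: ler_wpM2l => //; rewrite lef_pV2 ?posrE; lra.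
apply: (@le_trans _ _ ((1 + p) * (s ^+ 2 / (4 * z) + p * t ^+ 2 / (2 * (3 - p ^+ 2))))); last first.
  by apply: ler_wpM2l; [exact: pp | exact: lerD].
have D0 : 0 < D by lra.
have Dz : D = 2 + 3 * s * t + s ^+ 2 by [].
have [s1|s1] := leP 1 s.
  have k := poly_bound_large s1 (introT andP (conj t0 t1)).
  have k' : t * (1 - t) * Y <= s ^+ 2 / (4 * z).
    apply: (@le_trans _ _ (t * (1 - t) * (s * z / D))); first exact: ler_wpM2l.
    rewrite ler_pdivlMr; last lra.
    have -> : t * (1 - t) * (s * z / D) * (4 * z) = s * (4 * (t * (1 - t)) * z ^+ 2) / D by ring.
    rewrite ler_pdivrMr //; have -> : s ^+ 2 * D = s * (s * D) by ring.
    apply: ler_wpM2l; first exact: ltW.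
    exact: k.
  have k2 : Y ^+ 2 <= Y by rewrite expr2 ler_piMr.
  have k3 : t * (1 - t) * ((1 - p) * Y ^+ 2 + 2 * p * Y) <= (1 + p) * (t * (1 - t) * Y).
    have -> : (1 + p) * (t * (1 - t) * Y) = t * (1 - t) * ((1 - p) * Y + 2 * p * Y) by ring.
    by apply: (ler_wpM2l T0); apply: lerD => //; exact: (ler_wpM2l pm).
  apply: le_trans k3 _; apply: (ler_wpM2l pp).
  apply: le_trans k' _; rewrite lerDl; apply: mulr_ge0; first exact: mulr_ge0.
  by rewrite invr_ge0; lra.
have k2 := poly_bound_cubic (ltW s0) (introT andP (conj t0 t1)).
have k3 := @poly_bound_small _ s t (introT andP (conj (ltW s0) (ltW s1))) (introT andP (conj t0 t1)).
rewrite -/z -/D in k2 k3.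
have D20 : 0 < D ^+ 2 by exact: exprn_gt0.
have Y2 : Y ^+ 2 <= (s * z) ^+ 2 / D ^+ 2.
  by rewrite -expr_div_n ler_pXn2r// nnegrE divr_ge0// ltW.
have j1 : t * (1 - t) * ((1 - p) * Y ^+ 2) <= (1 - p) * (s ^+ 2 / (6 * z)).
  have -> : t * (1 - t) * ((1 - p) * Y ^+ 2) = (1 - p) * (t * (1 - t) * Y ^+ 2) by ring.
  apply: ler_wpM2l => //.
  apply: (@le_trans _ _ (t * (1 - t) * ((s * z) ^+ 2 / D ^+ 2))); first exact: ler_wpM2l.
  rewrite ler_pdivlMr; last lra.
  have -> : t * (1 - t) * ((s * z) ^+ 2 / D ^+ 2) * (6 * z) = s ^+ 2 * (6 * (t * (1 - t)) * z ^+ 3 / D ^+ 2) by ring.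
  by rewrite -[leRHS]mulr1; apply: ler_wpM2l => //; rewrite ler_pdivrMr ?mul1r.
have p3 : 0 < 3 - p ^+ 2 by lra.
have j2 : t * (1 - t) * (2 * p * Y) <=
    s ^+ 2 * ((1 + 5 * p) / (12 * z)) + t ^+ 2 * ((1 + p) * p / (2 * (3 - p ^+ 2))).
  apply: (@le_trans _ _ (t * (1 - t) * (2 * p * (s * z / D)))).
    by apply: ler_wpM2l => //; apply: ler_wpM2l => //; apply: mulr_ge0.
  apply: amgm_le.
  - by apply: mulr_ge0 => //; apply: divr_ge0; lra.
  - by apply: mulr_ge0 => //; apply: divr_ge0; [apply: mulr_ge0|]; lra.
  - by apply: mulr_ge0 => //; apply: mulr_ge0; [lra|apply: divr_ge0; lra].
  have -> : 4 * (s ^+ 2 * ((1 + 5 * p) / (12 * z))) * (t ^+ 2 * ((1 + p) * p / (2 * (3 - p ^+ 2))))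
     = (s * t) ^+ 2 * p * ((1 + 5 * p) * (1 + p) / (6 * z * (3 - p ^+ 2))).
    by field; lra.
  have -> : (t * (1 - t) * (2 * p * (s * z / D))) ^+ 2
     = (s * t) ^+ 2 * p * (4 * p * (1 - t) ^+ 2 * z ^+ 2 / D ^+ 2) by field; lra.
  apply: ler_wpM2l; first by apply: mulr_ge0 => //; exact: sqr_ge0.
  rewrite ler_pdivrMr// [leRHS]mulrAC ler_pdivlMr; last by apply: mulr_gt0 => //; apply: mulr_gt0.
  (* This is [11 p^3 + 15 p^2 - 15 p + 3 >= 0], with its minimum over [p >= 0] near [4 / 11]. The
     factors [3] here and [11] in [poly_bound_small] give the [33] below. *)
  have m1 : 11 * p * (3 - p ^+ 2) <= 3 * ((1 + 5 * p) * (1 + p)).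
    have : 0 <= (11 * p - 4) ^+ 2 * (11 * p + 8) by apply: mulr_ge0; [exact: sqr_ge0 | lra].
    have := sqr_ge0 (11 * p - 4); lra.
  have m2 : (11 * p * (3 - p ^+ 2)) * (72 * (1 - t) ^+ 2 * z ^+ 3) <=
      (3 * ((1 + 5 * p) * (1 + p))) * (11 * D ^+ 2).
    apply: ler_pM => //.
    - by apply: mulr_ge0; lra.
    - apply: mulr_ge0; [apply: mulr_ge0 => //; exact: sqr_ge0|].
      by apply: exprn_ge0; exact: ltW.
  have -> : 4 * p * (1 - t) ^+ 2 * z ^+ 2 * (6 * z * (3 - p ^+ 2)) =
     (33)^-1 * ((11 * p * (3 - p ^+ 2)) * (72 * (1 - t) ^+ 2 * z ^+ 3)) by field.
  have -> : (1 + 5 * p) * (1 + p) * D ^+ 2 = 33^-1 * ((3 * ((1 + 5 * p) * (1 + p))) * (11 * D ^+ 2)) by field.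
  exact: ler_wpM2l.
have -> : (1 + p) * (s ^+ 2 / (4 * z) + p * t ^+ 2 / (2 * (3 - p ^+ 2))) =
  (1 - p) * (s ^+ 2 / (6 * z)) + (s ^+ 2 * ((1 + 5 * p) / (12 * z)) + t ^+ 2 * ((1 + p) * p / (2 * (3 - p ^+ 2)))).
  by field; lra.
rewrite mulrDr; exact: lerD.
Qed.

End Poly.

Section RescaledBound.
Variable R : realType.
Implicit Types r t d v : R.

(** Both sides are [r^2 / (2 (1 + r))] times those of the rescaled inequality, where [v] enters only
    through [Y]; all that is kept of the equation for [v] is the linear constraint [hY] on [Y]. *)
Lemma rescaled_bound r t d v : 0 < r -> 0 < d -> 0 <= t <= 1 -> 0 < v ->
  v ^+ 2 = r ^+ 2 + 2 * r * t * d + d ^+ 2 ->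
  t * (1 - t) * r ^+ 2 * (v - r) * (v - r / (1 + r)) / (v ^+ 2 * (2 + r)) <=
  d ^+ 2 / (8 * (1 + d / 2 + r * t)) + r ^+ 3 / (12 + 12 * r + 2 * r ^+ 2) * t ^+ 2 / 2.
Proof.
move=> r0 d0 t01 v0 hv; have /andP[t0 t1] := t01.
have r0' := ltW r0; have d0' := ltW d0; have v0' := ltW v0.
pose s := d / r; pose p := r / (2 + r); pose Y := (v - r) / v.
have s0 : 0 < s by exact: divr_gt0.
have r2 : 0 < 2 + r by lra.
have rt0 : 0 <= r * t by apply: mulr_ge0 => //; exact: ltW.
have rtd0 : 0 <= r * t * d by apply: mulr_ge0 => //; exact: ltW.
have p0 : 0 <= p by apply: divr_ge0; lra.
have p1 : p < 1 by rewrite ltr_pdivrMr//; lra.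
have vr : r <= v.
  by rewrite -(@ler_pXn2r _ 2) ?nnegrE// hv; have := sqr_ge0 d; lra.
have Y0 : 0 <= Y by apply: divr_ge0; lra.
have Y1 : Y <= 1 by rewrite ler_pdivrMr//; lra.
have vrt : r + t * d <= v.
  have td0 : 0 <= t * d by apply: mulr_ge0 => //; exact: ltW.
  rewrite -(@ler_pXn2r _ 2) ?nnegrE//; last exact: addr_ge0.
  rewrite hv.
  have : 0 <= (1 - t ^+ 2) * d ^+ 2.
    apply: mulr_ge0; last exact: sqr_ge0.
    by rewrite subr_ge0; apply: exprn_ile1.
  lra.
(* [v + r >= 2 r + t d] turns the factorization [(v - r) (v + r) = d (d + 2 r t)] into an upper
   bound on [v - r]. *)
have hd : (v - r) * (2 * r + t * d) <= d * (d + 2 * r * t).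
  have -> : d * (d + 2 * r * t) = (v - r) * (v + r).
    have -> : (v - r) * (v + r) = v ^+ 2 - r ^+ 2 by ring.
    by rewrite hv; ring.
  by apply: ler_wpM2l; lra.
have hY : Y * (2 + 3 * s * t + s ^+ 2) <= s * (s + 2 * t).
  have -> : Y * (2 + 3 * s * t + s ^+ 2) =
     ((v - r) * (2 * r + t * d) * r + (v - r) * (d * (d + 2 * r * t))) / (v * r ^+ 2).
    by rewrite /Y /s; field; rewrite !gt_eqF.
  have -> : s * (s + 2 * t) = (d * (d + 2 * r * t)) / r ^+ 2.
    by rewrite /s; field; rewrite gt_eqF.
  have -> : d * (d + 2 * r * t) / r ^+ 2 = v * (d * (d + 2 * r * t)) / (v * r ^+ 2).
    by field; rewrite !gt_eqF.
  apply: ler_wpM2r.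
    by rewrite invr_ge0; apply: mulr_ge0; [exact: ltW | exact: sqr_ge0].
  have : (v - r) * (2 * r + t * d) * r <= d * (d + 2 * r * t) * r.
    by apply: ler_wpM2r => //; exact: ltW.
  lra.
have k : t * (1 - t) * ((1 - p) * Y ^+ 2 + 2 * p * Y) <=
  (1 + p) * (s ^+ 2 / (4 * (1 - p + p * (s + 2 * t))) + p * t ^+ 2 / (2 * (3 - p ^+ 2))).
  have [z1|z1] := leP (s + 2 * t) 1.
    by apply: rescaled_bound_small => //; apply/andP.
  by apply: rescaled_bound_large => //; apply/andP.
have q0 : 0 < 1 + d / 2 + r * t by lra.
have q1 : 0 < 12 + 12 * r + 2 * r ^+ 2 by have := sqr_ge0 r; lra.
have r1 : 0 < 1 + r by lra.
have e1 : t * (1 - t) * r ^+ 2 * (v - r) * (v - r / (1 + r)) / (v ^+ 2 * (2 + r))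
  = r ^+ 2 / (2 * (1 + r)) * (t * (1 - t) * ((1 - p) * Y ^+ 2 + 2 * p * Y)).
  by rewrite /p /Y; field; rewrite !gt_eqF.
have e2 : 1 - p + p * (s + 2 * t) = 2 * (1 + d / 2 + r * t) / (2 + r).
  by rewrite /p /s; field; rewrite !gt_eqF.
have e3 : 3 - p ^+ 2 = (12 + 12 * r + 2 * r ^+ 2) / (2 + r) ^+ 2.
  by rewrite /p; field; rewrite !gt_eqF.
have e4 : d ^+ 2 / (8 * (1 + d / 2 + r * t)) + r ^+ 3 / (12 + 12 * r + 2 * r ^+ 2) * t ^+ 2 / 2
  = r ^+ 2 / (2 * (1 + r)) * ((1 + p) * (s ^+ 2 / (4 * (1 - p + p * (s + 2 * t))) + p * t ^+ 2 / (2 * (3 - p ^+ 2)))).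
  rewrite e2 e3; move: q0 q1; set q := 1 + d / 2 + r * t; set q' := 12 + _ + _ => q0 q1.
  by rewrite /p /s; field; rewrite !gt_eqF.
rewrite e1 e4; apply: ler_wpM2l => //.
by apply: divr_ge0; [exact: sqr_ge0 | lra].
Qed.

End RescaledBound.

(** * Elementary bounds on the exponential and the logarithm *)

Section ExpLog.
Variable R : realType.
Implicit Types a b c l r v x : R.

(** Differentiability is asked only in the open interval: it will be applied to a function
    containing a square root that may vanish at an end point. *)
Lemma le_of_derive_ge0 (f df : R -> R) (a b : R) : a <= b ->
  (forall x, a < x < b -> is_derive x 1 f (df x)) ->
  (forall x, a < x < b -> 0 <= df x) ->
  {within `[a, b], continuous f} -> f a <= f b.
Proof.
rewrite le_eqVlt => /orP[/eqP -> //|ab] fd d0 fc.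
have fd' : forall x, x \in `]a, b[%R -> is_derive x 1 f (df x).
  by move=> x; rewrite in_itv/=; exact: fd.
have [c cab e] := MVT ab fd' fc.
rewrite -subr_ge0 e mulr_ge0 ?subr_ge0 ?(ltW ab)//.
by apply: d0; move: cab; rewrite in_itv.
Qed.

Lemma le_of_derive_ge0_cont (f df : R -> R) (a b : R) : a <= b ->
  (forall x, a <= x <= b -> is_derive x 1 f (df x)) ->
  (forall x, a < x < b -> 0 <= df x) -> f a <= f b.
Proof.
move=> ab fd d0; apply: (le_of_derive_ge0 ab _ d0).
  by move=> x /andP[? ?]; apply: fd; rewrite !ltW.
apply: derivable_within_continuous => x; rewrite in_itv/= => /fd h.
exact: ex_derive.
Qed.

Lemma drv_id x : is_derive x 1 (fun y : R => y) 1.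
Proof. exact: is_derive_id. Qed.

Lemma drvB (f g : R -> R) a b x : is_derive x 1 f a -> is_derive x 1 g b ->
  is_derive x 1 (fun y => f y - g y) (a - b).
Proof. by move=> ? ?; exact: is_deriveB. Qed.

Lemma drvM (f g : R -> R) a b x : is_derive x 1 f a -> is_derive x 1 g b ->
  is_derive x 1 (fun y => f y * g y) (a * g x + f x * b).
Proof.
move=> df dg; have := is_deriveM df dg.
by rewrite /GRing.scale/= addrC [g x * _]mulrC.
Qed.

Lemma drv_comp (f g : R -> R) a b x : is_derive x 1 g a -> is_derive (g x) 1 f b ->
  is_derive x 1 (fun y => f (g y)) (b * a).
Proof. by move=> ? ?; exact: is_derive1_comp. Qed.

Lemma drv_ln (f : R -> R) a x : 0 < f x -> is_derive x 1 f a ->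
  is_derive x 1 (fun y => ln (f y)) ((f x)^-1 * a).
Proof. by move=> ? ?; apply: drv_comp; exact: is_derive1_ln. Qed.

Lemma drv_inv (f : R -> R) a x : f x != 0 -> is_derive x 1 f a ->
  is_derive x 1 (fun y => (f y)^-1) (- (f x) ^- 2 * a).
Proof. by move=> ? ?; exact: is_deriveV. Qed.

(** Convexity of the exponential between [0] and [l], for [l] of either sign. *)
Lemma expR_chord c l : 0 <= c <= 1 -> expR (c * l) <= 1 + c * (expR l - 1).
Proof.
move=> /andP[c0 c1].
pose f x := 1 + c * (expR x - 1) - expR (c * x).
have fd x : is_derive x 1 f (c * expR x - c * expR (c * x)).
  rewrite /f; apply: is_derive_eq.
  by rewrite /GRing.scale/=; ring.
have f0 : f 0 = 0 by rewrite /f mulr0 expR0 subrr mulr0 addr0 subrr.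
rewrite -subr_ge0 -/(f l).
have [l0|l0] := leP 0 l.
  rewrite -f0; apply: (le_of_derive_ge0_cont l0 (fun x _ => fd x)).
  move=> x /andP[x0 _]; rewrite -mulrBr mulr_ge0// subr_ge0 ler_expR.
  by rewrite ler_piMl// ltW.
have : 0 - f l <= 0 - f 0.
  apply: (@le_of_derive_ge0_cont (fun x => 0 - f x) (fun x => 0 - (c * expR x - c * expR (c * x)))).
    exact: ltW.
  move=> x /andP[_ x0]; rewrite sub0r oppr_ge0 -mulrBr mulr_ge0_le0// subr_le0 ler_expR.
  by rewrite ler_niMl// ltW.
by rewrite f0 !sub0r oppr0 oppr_le0.
Qed.

(** The derivative in [l] of the difference is [c] times [1 + c (e^l - 1) - e^(c l)]. For [c >= 0]
    the second factor is nonnegative by convexity; for [c < 0] it is nonpositive by [e^u >= 1 + u]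
    at [u = l] and [u = c l]. *)
Lemma bennett c l : -1 <= c <= 1 -> 0 <= l ->
  expR (c * l) <= 1 + c * l + (expR l - 1 - l) * c ^+ 2.
Proof.
move=> /andP[c0 c1] l0.
pose f x := 1 + c * x + (expR x - 1 - x) * c ^+ 2 - expR (c * x).
have fd x : is_derive x 1 f (c + (expR x - 1) * c ^+ 2 - c * expR (c * x)).
  rewrite /f; apply: is_derive_eq.
  by rewrite /GRing.scale/=; ring.
have f0 : f 0 = 0.
  by rewrite /f !mulr0 expR0 subrr subr0 mul0r !addr0 subrr.
rewrite -subr_ge0 -/(f l) -f0; apply: (le_of_derive_ge0_cont l0 (fun x _ => fd x)).
move=> x /andP[x0 _].
have [cp|cn] := leP 0 c.
  have k : expR (c * x) <= 1 + c * (expR x - 1) by apply: expR_chord; apply/andP.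
  have : 0 <= c * (1 + c * (expR x - 1) - expR (c * x)) by rewrite mulr_ge0// subr_ge0.
  lra.
have k1 := expR_ge1Dx x; have k2 := expR_ge1Dx (c * x).
have h1 : 0 <= c ^+ 2 * (expR x - 1 - x) by apply: mulr_ge0; [exact: sqr_ge0 | lra].
have h2 : 0 <= - c * (expR (c * x) - 1 - c * x) by apply: mulr_ge0; lra.
lra.
Qed.

(** The left side is the [2/2] Padé approximant of [ln (1 + r)] at [0]. The difference of the
    derivatives has numerator [r^4]. *)
Lemma ln_pade r : 0 <= r -> (6 * r + 3 * r ^+ 2) / (6 + 6 * r + r ^+ 2) <= ln (1 + r).
Proof.
move=> r0.
pose f x := ln (1 + x) - (6 * x + 3 * (x * x)) * (6 + 6 * x + x * x)^-1.
suff : f 0 <= f r.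
  by rewrite /f addr0 ln1 !mulr0 addr0 mul0r subr0 subr_ge0.
have q0 (x : R) : 0 <= x -> 0 < 6 + 6 * x + x * x.
  by move=> x0; have := mulr_ge0 x0 x0; lra.
apply: (@le_of_derive_ge0_cont f (fun x => (1 + x)^-1 - (36 + 36 * x + 12 * x ^+ 2) / (6 + 6 * x + x * x) ^+ 2)) => //.
  move=> x /andP[x0 _].
  have q1 := q0 _ x0; have q2 : 6 + 6 * x + x * x != 0 by rewrite gt_eqF.
  have h1 : is_derive x 1 (fun x => ln (1 + x)) ((1 + x)^-1 * (0 + 1)).
    by apply: drv_ln; lra.
  have h2 : is_derive x 1 (fun x => 6 * x + 3 * (x * x)) (6 + 6 * x).
    by apply: is_derive_eq; rewrite /GRing.scale/=; ring.
  have h3 : is_derive x 1 (fun x => 6 + 6 * x + x * x) (6 + 2 * x).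
    by apply: is_derive_eq; rewrite /GRing.scale/=; ring.
  have h4 := @drv_inv (fun x => 6 + 6 * x + x * x) _ x q2 h3.
  have := drvB h1 (drvM h2 h4).
  congr (is_derive _ _ _ _).
  by field; rewrite q2 gt_eqF//; lra.
move=> x /andP[x0 _].
have q1 := q0 _ (ltW x0).
have x1 : 0 < 1 + x by lra.
rewrite subr_ge0 ler_pdivrMr ?exprn_gt0// [leRHS]mulrC ler_pdivlMr//.
have := exprn_ge0 4 (ltW x0); lra.
Qed.

(** Measures the slack in [r - ln (1 + r) <= r ln (1 + r) / 2], the inequality that turns
    [bennett_ln] into [bennett_ln_quad]; [gap_slope_pos] lives on this slack. *)
Lemma ln_gap r : 0 <= r ->
  r ^+ 3 / (12 + 12 * r + 2 * r ^+ 2) <= ln (1 + r) * (r + 2) / 2 - r.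
Proof.
move=> r0.
have q1 : 0 < 6 + 6 * r + r ^+ 2 by have := sqr_ge0 r; lra.
have h := ln_pade r0.
have -> : r ^+ 3 / (12 + 12 * r + 2 * r ^+ 2) =
    (6 * r + 3 * r ^+ 2) / (6 + 6 * r + r ^+ 2) * ((r + 2) / 2) - r.
  by field; rewrite !gt_eqF//; lra.
rewrite lerD2r -[leRHS]mulrA; apply: ler_wpM2r => //; apply: divr_ge0; lra.
Qed.

End ExpLog.

Section LogBounds.
Variable R : realType.
Implicit Types r t d v w x : R.

Lemma ln1D_ge0 r : 0 <= r -> 0 <= ln (1 + r).
Proof. by move=> r0; apply: ln_ge0; lra. Qed.

Lemma ln1D_le r : 0 <= r -> ln (1 + r) <= r.
Proof. by move=> r0; apply: le_ln1Dx; lra. Qed.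

Lemma expR_ln1D r : 0 <= r -> expR (ln (1 + r)) = 1 + r.
Proof. by move=> r0; rewrite lnK// posrE; lra. Qed.

Lemma ln_gap_ge0 r : 0 <= r -> 0 <= ln (1 + r) * (r + 2) / 2 - r.
Proof.
move=> r0; apply: le_trans (ln_gap r0).
by apply: divr_ge0; [exact: exprn_ge0 | have := sqr_ge0 r; lra].
Qed.

(** In exponential form this is [(1 + r)^(v / r) <= 1 + v], the chord inequality at [c = v / r]. *)
Lemma ln1D_div_anti v r : 0 < v -> v <= r -> ln (1 + r) / r <= ln (1 + v) / v.
Proof.
move=> v0 vr; have r0 : 0 < r by lra.
have h := expR_chord (ln (1 + r)) (c := v / r).
rewrite expR_ln1D ?(ltW r0)// in h.
rewrite ler_pdivlMr// -ler_expR expR_ln1D ?(ltW v0)//.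
have -> : ln (1 + r) / r * v = v / r * ln (1 + r) by ring.
apply: le_trans (h _) _.
  by rewrite divr_ge0 ?ler_pdivrMr//= ?mul1r// ltW.
by rewrite [1 + r]addrC addrK divfK// gt_eqF.
Qed.

Lemma expR_ge_quad x : 0 <= x -> 1 + x + x ^+ 2 / 2 <= expR x.
Proof.
move=> x0; pose f (y : R) := expR y - 1 - y - (y * y) / 2.
have fd (y : R) : is_derive y 1 f (expR y - 1 - y).
  by rewrite /f; apply: is_derive_eq; rewrite /GRing.scale/=; field.
have : f 0 <= f x.
  apply: (le_of_derive_ge0_cont x0 (fun y _ => fd y)) => y /andP[y0 _].
  by have := expR_ge1Dx y; lra.
by rewrite /f expR0; lra.
Qed.

(** Exponentiated, it is [1 + u + u^2 / 2 <= e^u] at [u = x / N]; it frees the right side of the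
    slope inequality from logarithms. *)
Lemma ln_quad N x : 0 < N -> 0 <= x -> ln (N + x + x ^+ 2 / (2 * N)) <= ln N + x / N.
Proof.
move=> N0 x0.
have xN : 0 <= x / N by apply: divr_ge0 => //; exact: ltW.
have x2 : 0 <= x ^+ 2 / (2 * N) by apply: divr_ge0; [exact: sqr_ge0 | lra].
rewrite -ler_expR expRD !lnK ?posrE//; last by lra.
have := expR_ge_quad xN; rewrite -(ler_pM2l N0); apply: le_trans.
by rewrite le_eqVlt; apply/orP; left; apply/eqP; field; rewrite gt_eqF.
Qed.

Lemma bennett_ln c r : -1 <= c <= 1 -> 0 <= r ->
  expR (c * ln (1 + r)) <= 1 + c * ln (1 + r) + (r - ln (1 + r)) * c ^+ 2.
Proof.
move=> c1 r0; have := bennett c1 (ln1D_ge0 r0).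
by rewrite expR_ln1D// [1 + r]addrC addrK.
Qed.

Lemma bennett_ln_quad c r : -1 <= c <= 1 -> 0 <= r ->
  expR (c * ln (1 + r)) <= 1 + ln (1 + r) * c + ln (1 + r) * r * c ^+ 2 / 2.
Proof.
move=> c1 r0; apply: le_trans (bennett_ln c1 r0) _.
have : 0 <= (ln (1 + r) * (r + 2) / 2 - r) * c ^+ 2.
  by apply: mulr_ge0; [exact: ln_gap_ge0 | exact: sqr_ge0].
lra.
Qed.

(* The case [w = 1], [0 <= t] of [gap_slope_ge0]; as [ln (1 + v) / v] decreases in [v], general [w]
   follows with [w * d] in place of [d]. *)
Lemma gap_slope_pos r t d v : 0 < r -> 0 < d -> 0 <= t <= 1 -> 0 < v ->
  v ^+ 2 = r ^+ 2 + 2 * r * t * d + d ^+ 2 ->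
  forall N, N = 1 + ln (1 + r) * t + ln (1 + r) * r * t ^+ 2 / 2 + d / 2 ->
  expR (ln (1 + v) / v * (r * t + d)) <= N + d / 2 + (d / 2) ^+ 2 / (2 * N).
Proof.
move=> r0 d0 t01 v0 hv N hN; have /andP[t0 t1] := t01.
have r0' := ltW r0; have d0' := ltW d0; have v0' := ltW v0.
set lam := ln (1 + r) in hN *; set l := ln (1 + v).
have lam0 : 0 <= lam by exact: ln1D_ge0.
have lamr : lam <= r by exact: ln1D_le.
set y := r * t + d; pose c := y / v.
have rt0 : 0 <= r * t by exact: mulr_ge0.
have rtd0 : 0 <= r * t * d by exact: mulr_ge0.
have t20 : 0 <= t ^+ 2 by exact: sqr_ge0.
have d20 : 0 <= d ^+ 2 by exact: sqr_ge0.
have y0 : 0 <= y by rewrite /y; lra.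
have vr : r <= v by rewrite -(@ler_pXn2r _ 2) ?nnegrE// hv; lra.
have yv : y <= v.
  rewrite -(@ler_pXn2r _ 2) ?nnegrE// hv.
  have : 0 <= (1 - t ^+ 2) * r ^+ 2.
    by apply: mulr_ge0; [rewrite subr_ge0; apply: exprn_ile1 | exact: sqr_ge0].
  by rewrite /y; lra.
have c01 : 0 <= c <= 1 by rewrite divr_ge0//= ler_pdivrMr// mul1r.
have /andP[c0 c1] := c01.
have cv : c * v = y by rewrite divfK// gt_eqF.
(* Because [c v = y], this bound equals [1 + y - (v - l) c (1 - c)], so a lower bound on
   [(v - l) c (1 - c)] is what is needed. *)
have B : expR (c * l) <= 1 + c * l + (v - l) * c ^+ 2.
  by apply: bennett_ln => //; lra.
have -> : l / v * y = c * l by rewrite /c; ring.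
apply: le_trans B _.
have -> : 1 + c * l + (v - l) * c ^+ 2 = 1 + y - (v - l) * (c * (1 - c)).
  by rewrite -cv; ring.
have K0 := ln_gap r0'; have K00 := ln_gap_ge0 r0'.
rewrite -/lam in K0 K00.
(* The slack [k] is spent in two halves: one absorbs the last term of [rescaled_bound] through [h4],
   the other the passage from [U] to [N <= U + k] in [h3]. *)
pose k := (lam * (r + 2) / 2 - r) * t ^+ 2.
have k0 : 0 <= k by exact: mulr_ge0.
have r1 : 0 < 1 + r by lra.
have r2 : 0 < 2 + r by lra.
have l_tan : l <= lam + (v - r) / (1 + r).
  have -> : l = lam + ln (1 + (v - r) / (1 + r)).
    rewrite -lnM ?posrE//; last by have : 0 <= (v - r) / (1 + r) by [apply: divr_ge0; lra]; lra.
    by congr ln; field; rewrite gt_eqF.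
  by rewrite lerD2l; apply: ln1D_le; apply: divr_ge0; lra.
pose G := r - lam + (v - r) * r / (1 + r).
have GL : G <= v - l.
  have -> : v - l = G + (lam + (v - r) / (1 + r) - l) by rewrite /G; field; rewrite gt_eqF.
  by rewrite lerDl subr_ge0.
have G0 : 0 <= G.
  apply: addr_ge0; first by rewrite subr_ge0.
  by apply: divr_ge0; [apply: mulr_ge0|]; lra.
have v20 : 0 < v ^+ 2 by exact: exprn_gt0.
(* Amounts to [v^2 - r^2 (1 - t) <= y v]; the squares of the two sides differ by
   [r^2 (1 - t)^2 (v^2 - r^2)]. *)
have cc : r ^+ 2 * (t * (1 - t)) / v ^+ 2 <= c * (1 - c).
  have -> : c * (1 - c) = (y * v - y ^+ 2) / v ^+ 2 by rewrite /c; field; rewrite gt_eqF.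
  apply: ler_wpM2r; first by rewrite invr_ge0 ltW.
  rewrite lerBrDr.
  have -> : r ^+ 2 * (t * (1 - t)) + y ^+ 2 = v ^+ 2 - r ^+ 2 * (1 - t) by rewrite hv /y; ring.
  have [h|h] := leP (v ^+ 2 - r ^+ 2 * (1 - t)) 0; first by apply: le_trans h _; exact: mulr_ge0.
  rewrite -(@ler_pXn2r _ 2) ?nnegrE ?mulr_ge0 ?(ltW h)// -subr_ge0.
  have -> : (y * v) ^+ 2 - (v ^+ 2 - r ^+ 2 * (1 - t)) ^+ 2 =
     r ^+ 2 * (1 - t) ^+ 2 * (2 * (r * t * d) + d ^+ 2) by rewrite exprMn hv /y; ring.
  by apply: mulr_ge0; [apply: mulr_ge0; exact: sqr_ge0 | lra].
have T0 : 0 <= t * (1 - t) by apply: mulr_ge0 => //; lra.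
have Gc : G * (r ^+ 2 * (t * (1 - t)) / v ^+ 2) <= (v - l) * (c * (1 - c)).
  by apply: ler_pM => //; apply: divr_ge0 => //; apply: mulr_ge0 => //; exact: sqr_ge0.
have L2 : r - lam <= r ^+ 2 / (2 + r).
  by rewrite ler_pdivlMr//; lra.
(* On the left [r - lam] has a multiple of [v^2 - r^2 >= 0] as coefficient, so it may be replaced by
   its upper bound [r^2 / (2 + r)]. *)
have h1 : t * (1 - t) * (r - lam) - G * (r ^+ 2 * (t * (1 - t)) / v ^+ 2) <=
   t * (1 - t) * r ^+ 2 * (v - r) * (v - r / (1 + r)) / (v ^+ 2 * (2 + r)).
  have -> : t * (1 - t) * (r - lam) - G * (r ^+ 2 * (t * (1 - t)) / v ^+ 2) =
     t * (1 - t) / v ^+ 2 * ((r - lam) * (v ^+ 2 - r ^+ 2) - (v - r) * r ^+ 3 / (1 + r)).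
    by rewrite /G; field; rewrite !gt_eqF.
  have -> : t * (1 - t) * r ^+ 2 * (v - r) * (v - r / (1 + r)) / (v ^+ 2 * (2 + r)) =
     t * (1 - t) / v ^+ 2 * (r ^+ 2 / (2 + r) * (v ^+ 2 - r ^+ 2) - (v - r) * r ^+ 3 / (1 + r)).
    by field; rewrite !gt_eqF.
  apply: ler_wpM2l; first by apply: divr_ge0 => //; exact: ltW.
  rewrite lerD2r; apply: ler_wpM2r => //.
  by rewrite subr_ge0 ler_pXn2r// nnegrE.
have h2 := rescaled_bound r0 d0 t01 v0 hv.
pose U := 1 + d / 2 + r * t.
have U0 : 0 < U by rewrite /U; lra.
have dU : d / 2 <= U by rewrite /U addrAC lerDr addr_ge0// mulr_ge0// ltW.
have Lt0 : 0 <= (r - lam) * (t * (1 - t)) by apply: mulr_ge0 => //; rewrite subr_ge0.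
have NU : N <= U + k by rewrite hN /U /k; lra.
have N0 : 0 < N.
  have : 0 <= lam * r * t ^+ 2 by do !apply: mulr_ge0 => //.
  by have : 0 <= lam * t; [exact: mulr_ge0 | rewrite hN; lra].
have Uk0 : 0 < U + k by exact: lt_le_trans NU.
have h3 : d ^+ 2 / (8 * U) - k / 2 <= (d / 2) ^+ 2 / (2 * N).
  apply: (@le_trans _ _ ((d / 2) ^+ 2 / (2 * (U + k)))); last first.
    apply: ler_wpM2l; first exact: sqr_ge0.
    by rewrite lef_pV2 ?posrE ?mulr_gt0// ler_pM2l.
  rewrite ler_pdivlMr ?mulr_gt0//.
  have -> : (d ^+ 2 / (8 * U) - k / 2) * (2 * (U + k)) =
     (d / 2) ^+ 2 - k * (U + k - (d / 2) ^+ 2 / U) by field; rewrite gt_eqF.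
  rewrite gerBl; apply: mulr_ge0 => //; rewrite subr_ge0 ler_pdivrMr// expr2.
  by apply: ler_pM => //; [exact: divr_ge0 (ltW d0) _ | exact: divr_ge0 (ltW d0) _ |
    apply: le_trans dU _; rewrite lerDl].
have h4 : r ^+ 3 / (12 + 12 * r + 2 * r ^+ 2) * t ^+ 2 <= k by apply: ler_wpM2r.
rewrite -/U in h2.
have e : N + d / 2 = 1 + lam * t + lam * r * t ^+ 2 / 2 + d by rewrite hN; field.
have e2 : t * (1 - t) * (r - lam) - k = r * t - lam * t - lam * r * t ^+ 2 / 2.
  by rewrite /k; field.
by rewrite e /y; lra.
Qed.

End LogBounds.

Section GapSlope.
Variable R : realType.
Implicit Types r t d v w x : R.

(** The bound of [bennett_ln_quad] at [c = t]. For [t = Z / r] it reads [1 + (ln (1 + r) / r) Z +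
    (ln (1 + r) / (2 r)) Z^2]. *)
Definition gap_arg r t := 1 + ln (1 + r) * t + ln (1 + r) * r * t ^+ 2 / 2.

Lemma gap_arg_ge r t : 0 <= r -> t ^+ 2 <= 1 -> expR (ln (1 + r) * t) <= gap_arg r t.
Proof.
move=> r0 t2; rewrite mulrC; apply: bennett_ln_quad => //.
by rewrite -ler_norml -(@ler_pXn2r _ 2) ?nnegrE// expr1n real_normK ?num_real.
Qed.

Lemma gap_arg_gt0 r t : 0 <= r -> t ^+ 2 <= 1 -> 0 < gap_arg r t.
Proof. by move=> r0 t2; apply: lt_le_trans (gap_arg_ge r0 t2); exact: expR_gt0. Qed.

(** Three regimes for [y = r t + w d]. If [y <= 0], then [v <= r], the monotonicity of
    [ln (1 + v) / v] puts [r] in place of [v], and [bennett_ln_quad] at [y / r] suffices. If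
    [t < 0 < y], the chord bound [1 + y] is enough. If [t >= 0], the claim reduces to
    [gap_slope_pos], with [r = 0] treated directly. *)
Lemma gap_slope_ge0 r t w d v : 0 <= r -> 0 < d -> w <= 1 -> t ^+ 2 <= w -> 0 < v ->
  v ^+ 2 = r ^+ 2 + 2 * r * t * d + w * d ^+ 2 ->
  ln (1 + v) / v * (r * t + w * d) <=
  ln (gap_arg r t + w / 2 * d) + w / 2 * d / (gap_arg r t + w / 2 * d).
Proof.
move=> r0 d0 w1 tw v0 hv.
have d0' := ltW d0; have v0' := ltW v0.
have t2 : t ^+ 2 <= 1 by lra.
have t20 : 0 <= t ^+ 2 by exact: sqr_ge0.
have w0 : 0 <= w by lra.
have [tm1 t1] : -1 <= t /\ t <= 1.
  by apply/andP; rewrite -ler_norml -(@ler_pXn2r _ 2) ?nnegrE// expr1n real_normK ?num_real.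
have n0 := gap_arg_gt0 r0 t2.
set x := w / 2 * d; set y := r * t + w * d.
have yx : y = r * t + 2 * x by rewrite /x /y; field.
have x0 : 0 <= x by apply: mulr_ge0 => //; lra.
have N1 : 0 < gap_arg r t + x by lra.
apply: le_trans (ln_quad N1 x0).
have x2 : 0 <= x ^+ 2 / (2 * (gap_arg r t + x)) by apply: divr_ge0; [exact: sqr_ge0 | lra].
rewrite -ler_expR lnK ?posrE; last lra.
set lam := ln (1 + r).
have lam0 : 0 <= lam by exact: ln1D_ge0.
have lamr : lam <= r by exact: ln1D_le.
have eN : gap_arg r t = 1 + lam * t + lam * r * t ^+ 2 / 2 by [].
have yv : y ^+ 2 <= v ^+ 2.
  rewrite -subr_ge0 (_ : _ - _ = (1 - w) * v ^+ 2 + r ^+ 2 * (w - t ^+ 2)); last by rewrite hv /y; ring.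
  by apply: addr_ge0; apply: mulr_ge0; rewrite ?subr_ge0//; exact: sqr_ge0.
have [y_le0|y_gt0] := leP y 0.
  have rpos : 0 < r.
    rewrite lt0r r0 andbT; apply/eqP => r00.
    have x00 : x = 0 by move: y_le0; rewrite yx r00; lra.
    move: hv; rewrite r00; have : w * d ^+ 2 = 2 * x * d by rewrite /x; field.
    by move=> ->; rewrite x00 => h; have : 0 < v ^+ 2; [exact: exprn_gt0 | lra].
  have vr : v <= r.
    rewrite -(@ler_pXn2r _ 2) ?nnegrE// hv.
    have -> : r ^+ 2 + 2 * r * t * d + w * d ^+ 2 = r ^+ 2 + d * (y + y - w * d) by rewrite /y; ring.
    have : 0 <= d * (w * d - y - y).
      by apply: mulr_ge0 => //; have := mulr_ge0 w0 d0'; lra.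
    by lra.
  apply: (@le_trans _ _ (expR (y / r * lam))).
    rewrite ler_expR; have -> : y / r * lam = lam / r * y by ring.
    apply: ler_wnM2r => //; exact: ln1D_div_anti.
  have c1 : -1 <= y / r <= 1.
    rewrite ler_pdivlMr// ler_pdivrMr//; apply/andP; split; last lra.
    have : 0 <= r * (1 + t) by apply: mulr_ge0; lra.
    lra.
  apply: le_trans (bennett_ln_quad c1 r0) _; rewrite -/lam.
  have -> : 1 + lam * (y / r) + lam * r * (y / r) ^+ 2 / 2 =
     gap_arg r t + 2 * x * (lam / r * (1 + r * t + x)).
    by rewrite eN yx; field; rewrite gt_eqF.
  have h : lam / r * (1 + r * t + x) <= 1.
    have l1 : lam / r <= 1 by rewrite ler_pdivrMr// mul1r.
    have l0 : 0 <= lam / r by exact: divr_ge0.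
    have : 0 <= lam / r * (- (r * t + x)).
      apply: mulr_ge0 => //; rewrite yx in y_le0; lra.
    lra.
  have : 0 <= x * (1 - lam / r * (1 + r * t + x)) by apply: mulr_ge0 => //; rewrite subr_ge0.
  lra.
have yv1 : y <= v by rewrite -(@ler_pXn2r _ 2) ?nnegrE// ltW.
have [t0|t0] := ltP t 0.
  have -> : ln (1 + v) / v * y = y / v * ln (1 + v) by ring.
  apply: le_trans (expR_chord _ _) _; first by rewrite divr_ge0 ?(ltW y_gt0)//= ler_pdivrMr// mul1r.
  rewrite expR_ln1D// [1 + v]addrC addrK divfK ?gt_eqF//.
  have : 0 <= (r - lam) * - t by apply: mulr_ge0; lra.
  have : 0 <= lam * r * t ^+ 2 by apply: mulr_ge0 => //; exact: mulr_ge0.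
  rewrite eN yx; lra.
have wpos : 0 < w.
  rewrite lt0r w0 andbT; apply/eqP => w00; rewrite w00 in tw.
  have t00 : t = 0 by apply/eqP; rewrite -sqrf_eq0 eq_le t20 andbT.
  by move: y_gt0; rewrite /y w00 t00 mulr0 mul0r addr0 ltxx.
have rt0 : 0 <= r * t by exact: mulr_ge0.
have [d1 hd1] : exists d1, d1 = w * d by exists (w * d).
have d10 : 0 < d1 by rewrite hd1; exact: mulr_gt0.
have d1d : d1 <= d by rewrite hd1 ler_piMl.
have d1x : d1 / 2 = x by rewrite hd1 /x; field.
pose v1 := Num.sqrt (r ^+ 2 + 2 * r * t * d1 + d1 ^+ 2).
have d120 : 0 < d1 ^+ 2 by exact: exprn_gt0.
have r20 : 0 <= r ^+ 2 by exact: sqr_ge0.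
have rtd1 : 0 <= r * t * d1 by apply: mulr_ge0 => //; exact: ltW.
have q0 : 0 < r ^+ 2 + 2 * r * t * d1 + d1 ^+ 2 by lra.
have v12 : v1 ^+ 2 = r ^+ 2 + 2 * r * t * d1 + d1 ^+ 2 by rewrite sqr_sqrtr// ltW.
have v10 : 0 < v1 by rewrite sqrtr_gt0.
have v1v : v1 <= v.
  rewrite -(@ler_pXn2r _ 2) ?nnegrE ?(ltW v10)// v12 hv.
  have k1 : r * t * d1 <= r * t * d by apply: ler_wpM2l.
  have k2 : d1 ^+ 2 <= w * d ^+ 2.
    have -> : d1 ^+ 2 = d1 * d1 by ring.
    have -> : w * d ^+ 2 = d1 * d by rewrite hd1; ring.
    by apply: ler_wpM2l => //; exact: ltW.
  lra.
apply: (@le_trans _ _ (expR (ln (1 + v1) / v1 * y))).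
  rewrite ler_expR; apply: ler_wpM2r; [exact: ltW | exact: ln1D_div_anti].
have [r00|rpos] := eqVneq r 0.
  have y1 : y = v1.
    have yd : y = d1 by rewrite /y r00 hd1; ring.
    by rewrite yd /v1 r00 expr0n/= mulr0 !mul0r !add0r sqrtr_sqr ger0_norm// ltW.
  have -> : ln (1 + v1) / v1 * y = ln (1 + v1) by rewrite y1 divfK// gt_eqF.
  have e1 : gap_arg r t = 1 by rewrite eN /lam r00 addr0 ln1 !mul0r !addr0.
  rewrite expR_ln1D ?(ltW v10)// -y1 e1 yx; rewrite r00 mul0r add0r; rewrite e1 in x2; lra.
have rp : 0 < r by rewrite lt0r rpos.
have t01 : 0 <= t <= 1 by rewrite t0.
have := @gap_slope_pos R r t d1 v1 rp d10 t01 v10 v12 (gap_arg r t + x).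
rewrite d1x => h; rewrite /y -hd1; apply: h.
by rewrite eN.
Qed.

End GapSlope.

Section HfunIncrement.
Variable R : realType.
Implicit Types r t d v w x : R.

Lemma drv_continuous (f : R -> R) (a x : R) : is_derive x 1 f a -> {for x, continuous f}.
Proof. by move=> h; apply/differentiable_continuous/derivable1_diffP. Qed.

Lemma drv_hfun r : 0 <= r -> is_derive r 1 (@hfun R) (ln (1 + r)).
Proof.
move=> r0.
have h1 : is_derive r 1 (fun x : R => 1 + x) 1.
  by apply: is_derive_eq; rewrite /GRing.scale/=; ring.
have h2 : is_derive r 1 (fun x : R => ln (1 + x)) ((1 + r)^-1 * 1).
  by apply: drv_ln => //; lra.
have h3 := drvB (drvM h1 h2) (drv_id r).
have -> : ln (1 + r) = 1 * ln (1 + r) + (1 + r) * ((1 + r)^-1 * 1) - 1.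
  by field; rewrite gt_eqF//; lra.
exact: h3.
Qed.

Lemma continuous_hfun r : 0 <= r -> {for r, continuous (@hfun R)}.
Proof.
move=> r0; have h := drv_hfun r0.
exact: drv_continuous h.
Qed.

Lemma hfun_tangent r v : 0 <= r -> r <= v -> hfun r + ln (1 + r) * (v - r) <= hfun v.
Proof.
move=> r0 rv.
pose f x := hfun x - ln (1 + r) * x.
suff : f r <= f v by rewrite /f; lra.
apply: (@le_of_derive_ge0_cont _ f (fun x => ln (1 + x) - ln (1 + r))) => //.
  move=> x /andP[rx _].
  have h1 : is_derive x 1 (fun x : R => ln (1 + r) * x) (ln (1 + r)).
    by apply: is_derive_eq; rewrite /GRing.scale/=; ring.
  exact: drvB (drv_hfun (le_trans r0 rx)) h1.
move=> x /andP[rx _]; rewrite subr_ge0 ler_ln ?posrE; lra.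
Qed.

(** With [t = Z / r], [w = rho * W] and [d = 1 / rho] this is [(q + 2 Z + W) / rho], the square of
    the argument of [hfun] after the step. *)
Definition shifted_sq r t w d := r ^+ 2 + 2 * r * t * d + w * d ^+ 2.

Lemma shifted_sq_ge0 r t w d : t ^+ 2 <= w -> 0 <= shifted_sq r t w d.
Proof.
move=> tw.
have -> : shifted_sq r t w d = (r + t * d) ^+ 2 + (w - t ^+ 2) * d ^+ 2 by rewrite /shifted_sq; ring.
by apply: addr_ge0; [exact: sqr_ge0 | apply: mulr_ge0; rewrite ?subr_ge0// sqr_ge0].
Qed.

(* The derivative of [gap r t w] is the difference of the two sides of [gap_slope_ge0]. *)
Definition gap r t w d := d * ln (gap_arg r t + w / 2 * d) - hfun (Num.sqrt (shifted_sq r t w d)).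

Lemma drv_shifted_sq r t w d : is_derive d 1 (shifted_sq r t w) (2 * (r * t + w * d)).
Proof.
have : is_derive d 1 (fun d => r ^+ 2 + 2 * r * t * d + w * (d * d)) (2 * (r * t + w * d)).
  by apply: is_derive_eq; rewrite /GRing.scale/=; ring.
by congr is_derive; apply/funext => x; rewrite /shifted_sq expr2.
Qed.

Lemma gap_mono r t w (a b : R) : 0 <= r -> w <= 1 -> t ^+ 2 <= w -> 0 <= a <= b ->
  (forall x, a < x < b -> 0 < shifted_sq r t w x) -> gap r t w a <= gap r t w b.
Proof.
move=> r0 w1 tw /andP[a0 ab] qpos.
have t2 : t ^+ 2 <= 1 by lra.
have w0 : 0 <= w by have := sqr_ge0 t; lra.
have n0 := gap_arg_gt0 r0 t2.
have np x : 0 <= x -> 0 < gap_arg r t + w / 2 * x.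
  by move=> x0; have : 0 <= w / 2 * x; [apply: mulr_ge0 => //; lra | lra].
pose df x := (ln (gap_arg r t + w / 2 * x) + w / 2 * x / (gap_arg r t + w / 2 * x)) -
   ln (1 + Num.sqrt (shifted_sq r t w x)) / Num.sqrt (shifted_sq r t w x) * (r * t + w * x).
have dlin x : is_derive x 1 (fun x => gap_arg r t + w / 2 * x) (w / 2).
  by apply: is_derive_eq; rewrite /GRing.scale/=; ring.
have dln x : 0 <= x -> is_derive x 1 (fun x => x * ln (gap_arg r t + w / 2 * x))
    (1 * ln (gap_arg r t + w / 2 * x) + x * ((gap_arg r t + w / 2 * x)^-1 * (w / 2))).
  move=> x0; have h := @drv_ln _ (fun x => gap_arg r t + w / 2 * x) _ x (np _ x0) (dlin x).
  exact: (drvM (drv_id x) h).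
apply: (@le_of_derive_ge0 _ (gap r t w) df) => //.
- move=> x axb; have q0 := qpos _ axb; move: axb => /andP[ax xb].
  have x0 : 0 <= x by lra.
  have s0 : 0 < Num.sqrt (shifted_sq r t w x) by rewrite sqrtr_gt0.
  have h1 := drv_comp (drv_shifted_sq r t w x) (is_derive1_sqrt q0).
  have h2 := @drv_comp _ (@hfun R) (fun x => Num.sqrt (shifted_sq r t w x)) _ _ x h1 (drv_hfun (ltW s0)).
  have h3 := drvB (dln x x0) h2.
  have -> : df x = 1 * ln (gap_arg r t + w / 2 * x) + x * ((gap_arg r t + w / 2 * x)^-1 * (w / 2)) -
     ln (1 + Num.sqrt (shifted_sq r t w x)) * ((2 * Num.sqrt (shifted_sq r t w x))^-1 * (2 * (r * t + w * x))).
    rewrite /df; move: (np _ x0) s0; set NN := gap_arg r t + _; set SS := Num.sqrt _ => NN0 SS0.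
    by field; rewrite !gt_eqF.
  exact: h3.
- move=> x axb; have q0 := qpos _ axb; move: axb => /andP[ax xb].
  rewrite subr_ge0; apply: gap_slope_ge0 => //; first lra.
    by rewrite sqrtr_gt0.
  by rewrite sqr_sqrtr// ltW.
apply: continuous_in_subspaceT => x; rewrite inE/= in_itv/= => /andP[ax xb].
have x0 : 0 <= x by lra.
rewrite /gap; apply: cvgB.
  exact: (drv_continuous (dln x x0)).
have h1 := drv_continuous (drv_shifted_sq r t w x).
apply: (@continuous_comp _ _ _ (fun x => Num.sqrt (shifted_sq r t w x)) (@hfun R)).
  by apply: (@continuous_comp _ _ _ (shifted_sq r t w) (@Num.sqrt R)) => //; exact: sqrt_continuous.
exact: continuous_hfun.
Qed.

(** Compares [gap] at [d] with its value [- hfun r] at [0]. The square root is not differentiable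
    where [shifted_sq] vanishes; a zero [x] inside the interval forces [w = t^2] and [r + t x = 0],
    so that [shifted_sq] is a perfect square with this single zero, and the monotonicity on both
    sides of [x] is joined there. *)
Lemma hfun_sqrt_increment_scaled r t w d : 0 <= r -> w <= 1 -> t ^+ 2 <= w -> 0 <= d ->
  hfun (Num.sqrt (shifted_sq r t w d)) - hfun r <= d * ln (gap_arg r t + w / 2 * d).
Proof.
move=> r0 w1 tw d0.
have g0 : gap r t w 0 = - hfun r.
  by rewrite /gap /shifted_sq mul0r sub0r mulr0 addr0 expr0n/= mulr0 addr0 sqrtr_sqr ger0_norm.
suff : gap r t w 0 <= gap r t w d by rewrite g0 /gap; lra.
have t20 := sqr_ge0 t; have w0 : 0 <= w by lra.
have [/eqP|rt0] := eqVneq (r + w) 0.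
  rewrite paddr_eq0// => /andP[/eqP r00 /eqP w00].
  have q0 : shifted_sq r t w d = 0 by rewrite /shifted_sq r00 w00 !(mulr0, mul0r, addr0) expr0n.
  have n0 : gap_arg r t + w / 2 * d = 1 by rewrite /gap_arg r00 w00 addr0 ln1 !(mul0r, addr0).
  by rewrite g0 /gap q0 n0 ln1 mulr0 sub0r sqrtr0 r00.
have [[x /andP[/andP[x0 xd] qx0]]|h] := pselect (exists x, (0 < x < d) && (shifted_sq r t w x == 0)); last first.
  apply: gap_mono; rewrite ?lexx//= => x /andP[x0 xd].
  by rewrite lt0r shifted_sq_ge0// andbT; apply/eqP => q0; apply: h; exists x; rewrite x0 xd q0 eqxx.
have qe y : shifted_sq r t w y = (r + t * y) ^+ 2 + (w - t ^+ 2) * y ^+ 2 by rewrite /shifted_sq; ring.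
move: qx0; rewrite qe paddr_eq0 ?sqr_ge0//; last first.
  by apply: mulr_ge0; [rewrite subr_ge0 | exact: sqr_ge0].
move=> /andP[]; rewrite sqrf_eq0 mulf_eq0 sqrf_eq0 (gt_eqF x0) orbF subr_eq0.
move=> /eqP rx /eqP wt.
have tn0 : t != 0.
  apply: contra rt0 => /eqP t0; rewrite wt t0 expr0n/= addr0.
  by move: rx; rewrite t0 mul0r addr0 => ->.
have qpos y : y != x -> 0 < shifted_sq r t w y.
  move=> yx; rewrite qe wt subrr mul0r addr0.
  have -> : r + t * y = t * (y - x) by rewrite -[LHS]subr0 -rx; ring.
  by rewrite lt0r sqr_ge0 sqrf_eq0 mulf_neq0// subr_eq0.
apply: (@le_trans _ _ (gap r t w x)); apply: gap_mono => //.
- by rewrite lexx ltW.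
- by move=> y /andP[_ yx]; apply: qpos; rewrite lt_eqF.
- by rewrite !ltW.
- by move=> y /andP[yx _]; apply: qpos; rewrite gt_eqF.
Qed.

Lemma hfun_sqrt_increment (rho q1 Z W r : R) : 0 < rho -> 0 <= q1 -> 0 <= W -> W <= rho^-1 ->
  Z ^+ 2 <= q1 * W ->
  r = Num.sqrt (q1 / rho) ->
  expR (rho * hfun (Num.sqrt ((q1 + 2 * Z + W) / rho)) - rho * hfun r) <=
  1 + ln (1 + r) / r * Z + W / 2 + ln (1 + r) / r / 2 * Z ^+ 2.
Proof.
move=> rho0 q10 W0 Wrho ZW hr.
have rho0' := ltW rho0; have rhon : rho != 0 by rewrite gt_eqF.
have r0 : 0 <= r by rewrite hr; exact: sqrtr_ge0.
have r2 : r ^+ 2 = q1 / rho by rewrite hr sqr_sqrtr// divr_ge0.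
have q1r : q1 = rho * r ^+ 2 by rewrite r2 mulrC divfK.
pose w := rho * W; pose t := Z / r.
have w1 : w <= 1 by rewrite /w -ler_pdivlMl// mulr1.
have w0 : 0 <= w by exact: mulr_ge0.
have tr : t * r = Z.
  (* If [r = 0], the hypothesis [ZW] forces [Z = 0], in agreement with the value [0] of a division
     by zero. *)
  have [r00|rn] := eqVneq r 0; last by rewrite /t divfK.
  rewrite r00 mulr0; apply/eqP; rewrite eq_sym -sqrf_eq0 eq_le sqr_ge0 andbT.
  by apply: le_trans ZW _; rewrite q1r r00 expr0n/= mulr0 mul0r.
have tw : t ^+ 2 <= w.
  have [r00|rn] := eqVneq r 0; first by rewrite /t r00 invr0 mulr0 expr0n.
  have r20 : 0 < r ^+ 2 by rewrite exprn_gt0// lt0r rn.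
  rewrite -(ler_pM2r r20) -exprMn tr /w; apply: le_trans ZW _.
  by rewrite q1r le_eqVlt; apply/orP; left; apply/eqP; ring.
have d0 : 0 <= rho^-1 by rewrite invr_ge0.
have := hfun_sqrt_increment_scaled r0 w1 tw d0.
have -> : shifted_sq r t w rho^-1 = (q1 + 2 * Z + W) / rho.
  have -> : shifted_sq r t w rho^-1 = r ^+ 2 + 2 * (t * r) / rho + w / rho ^+ 2 by rewrite /shifted_sq; field.
  by rewrite r2 tr /w; field.
have t2 : t ^+ 2 <= 1 by lra.
have n0 := gap_arg_gt0 r0 t2.
have Np : 0 < gap_arg r t + w / 2 * rho^-1.
  by have : 0 <= w / 2 * rho^-1; [apply: mulr_ge0 => //; apply: divr_ge0 | lra].
rewrite ler_pdivlMl// mulrBr => h; rewrite -ler_expR lnK ?posrE// in h.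
apply: le_trans h _.
rewrite le_eqVlt; apply/orP; left; apply/eqP.
have -> : w / 2 / rho = W / 2 by rewrite /w; field.
rewrite /gap_arg; have [r00|rn] := eqVneq r 0.
  by rewrite -tr r00 addr0 ln1 !(mulr0, mul0r, addr0).
have e : t = Z / r by [].
by rewrite e; field.
Qed.

End HfunIncrement.

Section Tangent.
Variable R : realType.

(** With [x = D / q1] the hypothesis gives [q0 / q1 >= 1 / (1 - x) >= (1 + x / 2)^2], so the
    argument of [hfun] is at least [r (1 + x / 2)], and the tangent of [hfun] at [r] yields the
    bound. *)
Lemma hfun_gain (rho q0 q1 D r : R) : 0 < rho -> 0 <= q0 -> 0 <= q1 -> 0 <= D ->
  q1 ^+ 2 <= q0 * (q1 - D) -> r = Num.sqrt (q1 / rho) ->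
  ln (1 + r) / r / 2 * D <= rho * hfun (Num.sqrt (q0 / rho)) - rho * hfun r.
Proof.
move=> rho0 q00 q10 D0 h hr.
have r0 : 0 <= r by rewrite hr; exact: sqrtr_ge0.
have rho0' := ltW rho0; have rhon : rho != 0 by rewrite gt_eqF.
set v := Num.sqrt (q0 / rho).
have v0 : 0 <= v by exact: sqrtr_ge0.
have r2 : r ^+ 2 = q1 / rho by rewrite hr sqr_sqrtr// divr_ge0.
have [r00|rn] := eqVneq r 0.
  rewrite r00 invr0 mulr0 !mul0r -mulrBr; apply: mulr_ge0 => //.
  by have := hfun_tangent (lexx 0) v0; rewrite addr0 ln1 mul0r addr0 subr_ge0.
have rp : 0 < r by rewrite lt0r rn.
have q1r : q1 = rho * r ^+ 2 by rewrite r2 mulrC divfK.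
have q1p : 0 < q1 by rewrite q1r mulr_gt0// exprn_gt0.
have q1n : q1 != 0 by rewrite gt_eqF.
have hD : 0 < q1 - D.
  rewrite ltNge; apply/negP => hD.
  have : q0 * (q1 - D) <= 0 by exact: mulr_ge0_le0.
  by apply/negP; rewrite -ltNge; apply: lt_le_trans h; exact: exprn_gt0.
pose x := D / q1.
have Dx : D = x * q1 by rewrite /x divfK.
have x0 : 0 <= x by exact: divr_ge0.
have x1 : x < 1 by rewrite /x ltr_pdivrMr//; lra.
have hv : r * (1 + x / 2) <= v.
  have p1 : 0 <= r * (1 + x / 2) by apply: mulr_ge0 => //; lra.
  rewrite -(@ler_pXn2r _ 2) ?nnegrE// exprMn r2 sqr_sqrtr ?divr_ge0//.
  rewrite mulrAC; apply: ler_wpM2r; first by rewrite invr_ge0.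
  rewrite -(ler_pM2r hD); apply: le_trans h.
  have -> : q1 * (1 + x / 2) ^+ 2 * (q1 - D) = q1 ^+ 2 * (1 - (3 / 4 * x ^+ 2 + x ^+ 3 / 4)).
    by rewrite Dx; field.
  rewrite -[leRHS]mulr1; apply: ler_wpM2l; first exact: sqr_ge0.
  by have := sqr_ge0 x; have := exprn_ge0 3 x0; lra.
have lam0 : 0 <= ln (1 + r) by exact: ln1D_ge0.
have rv : r <= v by apply: le_trans hv; have : 0 <= r * x by [exact: mulr_ge0]; lra.
have ht := hfun_tangent r0 rv.
have hl : ln (1 + r) * (r * x / 2) <= ln (1 + r) * (v - r).
  by apply: ler_wpM2l => //; lra.
have -> : ln (1 + r) / r / 2 * D = rho * (ln (1 + r) * (r * x / 2)).
  by rewrite Dx q1r; field.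
rewrite -mulrBr; apply: ler_wpM2l => //.
by move: ht hl; set a := ln _ * (v - r); lra.
Qed.

End Tangent.

(** * Positive definite matrices *)

Section PositiveForms.
Variable R : realType.

Definition form n (A : 'M[R]_n) (u v : 'cV[R]_n) : R := (u^T *m A *m v) 0 0.

Definition psd n (A : 'M[R]_n) := A^T = A /\ forall u, 0 <= form A u u.
Definition posdef n (A : 'M[R]_n) := A^T = A /\ forall u, u != 0 -> 0 < form A u u.

Lemma formE n (A : 'M[R]_n) u v : form A u v = \sum_i \sum_j u i 0 * A i j * v j 0.
Proof.
rewrite /form mxE exchange_big/=; apply: eq_bigr => j _.
rewrite mxE mulr_suml; apply: eq_bigr => i _.
by rewrite mxE.
Qed.

Lemma formDl n (A : 'M[R]_n) u1 u2 v : form A (u1 + u2) v = form A u1 v + form A u2 v.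
Proof. by rewrite /form linearD/= !mulmxDl mxE. Qed.

Lemma formDr n (A : 'M[R]_n) u v1 v2 : form A u (v1 + v2) = form A u v1 + form A u v2.
Proof. by rewrite /form mulmxDr mxE. Qed.

Lemma formZl n (A : 'M[R]_n) a u v : form A (a *: u) v = a * form A u v.
Proof. by rewrite /form linearZ/= -!scalemxAl mxE. Qed.

Lemma formZr n (A : 'M[R]_n) a u v : form A u (a *: v) = a * form A u v.
Proof. by rewrite /form -!scalemxAr mxE. Qed.

Lemma formC n (A : 'M[R]_n) u v : A^T = A -> form A u v = form A v u.
Proof.
move=> sA; rewrite /form -[in LHS](trmxK (u^T *m A *m v)) mxE.
by rewrite !trmx_mul trmxK sA mulmxA.
Qed.

Lemma formM n p (A : 'M[R]_n) (L : 'M[R]_(p, n)) u v :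
  form (L *m A *m L^T) u v = form A (L^T *m u) (L^T *m v).
Proof. by rewrite /form trmx_mul trmxK !mulmxA. Qed.

Lemma form_mxD n (A B : 'M[R]_n) u v : form (A + B) u v = form A u v + form B u v.
Proof. by rewrite /form mulmxDr mulmxDl mxE. Qed.

Lemma form_mxZ n a (A : 'M[R]_n) u v : form (a *: A) u v = a * form A u v.
Proof. by rewrite /form -scalemxAr -scalemxAl mxE. Qed.

Lemma form1 n u v : form (1%:M : 'M[R]_n) u v = \sum_i u i 0 * v i 0.
Proof.
rewrite /form mulmx1 mxE; apply: eq_bigr => i _; by rewrite mxE.
Qed.

Lemma form_delta n (A : 'M[R]_n) i j : form A (delta_mx i 0) (delta_mx j 0) = A i j.
Proof.
rewrite formE (bigD1 i)//= (bigD1 j)//= !mxE !eqxx mul1r mulr1 !big1 ?addr0//.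
  move=> k ki; rewrite big1// => l _; rewrite mxE (negbTE ki) /= !mul0r//.
by move=> k kj; rewrite !mxE (negbTE kj) mulr0.
Qed.

Lemma psd_CS n (A : 'M[R]_n) u v : psd A -> form A u v ^+ 2 <= form A u u * form A v v.
Proof.
move=> [sA pA].
have h a b : 0 <= a ^+ 2 * form A u u + 2 * a * b * form A u v + b ^+ 2 * form A v v.
  have := pA (a *: u + b *: v).
  rewrite !formDl !formDr !formZl !formZr (formC v u sA).
  by congr (_ <= _); ring.
have [v0|vn] := eqVneq (form A v v) 0.
  have [->|un] := eqVneq (form A u v) 0.
    by rewrite expr0n/= mulr_ge0.
  have := h 1 (- (form A u u + 1) / (2 * form A u v)).
  rewrite v0 mulr0 addr0.
  have -> : 1 ^+ 2 * form A u u + 2 * 1 * (- (form A u u + 1) / (2 * form A u v)) * form A u v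
    = -1 by field.
  by rewrite oppr_ge0 ler10.
have vp : 0 < form A v v by rewrite lt0r vn pA.
have := h (form A v v) (- form A u v).
have -> : form A v v ^+ 2 * form A u u + 2 * form A v v * - form A u v * form A u v +
  (- form A u v) ^+ 2 * form A v v = form A v v * (form A u u * form A v v - form A u v ^+ 2) by ring.
by rewrite pmulr_rge0// subr_ge0.
Qed.

Lemma posdef_psd n (A : 'M[R]_n) : posdef A -> psd A.
Proof.
move=> [sA pA]; split=> // u; have [->|un] := eqVneq u 0; last exact: ltW (pA _ un).
by rewrite /form mulmx0 mxE.
Qed.

Lemma posdef_conj n (A L : 'M[R]_n) : L \in unitmx -> posdef A -> posdef (L *m A *m L^T).
Proof.
move=> uL [sA pA]; split; first by rewrite !trmx_mul trmxK sA mulmxA.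
move=> u un; rewrite formM; apply: pA; apply: contra un => /eqP h.
by rewrite -[u](mulKmx (_ : L^T \in unitmx)) ?unitmx_tr// h mulmx0.
Qed.

Section Block.
Variables (n : nat) (A : 'M[R]_(1 + n)).
Hypothesis pA : posdef A.

Let a := A 0 0.
Let v : 'cV[R]_n := dlsubmx A.
Let B : 'M[R]_n := drsubmx A.
(** [S] is the Schur complement of the corner [a]; [L1] is the elimination matrix of determinant 1
    that takes [A] to the block diagonal of [a] and [S]. *)
Let S := B - a^-1 *: (v *m v^T).
Let L1 : 'M[R]_(1 + n) := block_mx 1%:M 0 (- a^-1 *: v) 1%:M.

Let A_block : A = block_mx a%:M v^T v B.
Proof.
rewrite -[LHS]submxK; congr block_mx.
  by apply/matrixP => i j; rewrite !ord1 !mxE /= mulr1n; congr (A _ _); exact: val_inj.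
have [sA _] := pA.
by rewrite /v trmx_dlsub sA.
Qed.

Let a0 : 0 < a.
Proof.
have [_ h] := pA; rewrite /a -form_delta; apply: h.
by apply/eqP => /matrixP/(_ 0 0); rewrite !mxE eqxx => /eqP; rewrite oner_eq0.
Qed.

Let L1A : L1 *m A *m L1^T = block_mx a%:M 0 0 S.
Proof.
rewrite A_block /L1 tr_block_mx !mulmx_block !trmx1 !trmx0.
rewrite !(mul0mx, mulmx0, mul1mx, mulmx1, addr0, add0r).
have av : - a^-1 *: v *m a%:M = - v.
  by rewrite -scalemxAl mul_mx_scalar scalerA mulNr mulVf ?gt_eqF// scaleN1r.
have e : a%:M *m (- a^-1 *: v)^T = - v^T.
  by rewrite mul_scalar_mx linearZ/= scalerA mulrN mulfV ?gt_eqF// scaleN1r.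
rewrite av !addNr mul0mx add0r e addNr.
by congr block_mx; rewrite -scalemxAl scaleNr addrC.
Qed.

Let detL1 : \det L1 = 1.
Proof. by rewrite /L1 det_lblock !det1 mulr1. Qed.

Let unitL1 : L1 \in unitmx.
Proof. by rewrite unitmxE detL1 unitr1. Qed.

Let pS : posdef S.
Proof.
have := posdef_conj unitL1 pA; rewrite L1A => -[sb pb]; split.
  by move: sb; rewrite tr_block_mx => /eq_block_mx[].
move=> u un; have := pb (col_mx (0 : 'cV[R]_1) u).
have -> : form (block_mx (a%:M : 'M[R]_1) 0 0 S) (col_mx (0 : 'cV[R]_1) u) (col_mx (0 : 'cV[R]_1) u) = form S u u.
  rewrite /form tr_col_mx mul_row_block !(mulmx0, mul0mx, addr0, add0r, trmx0).
  by rewrite mul_row_col mulmx0 add0r.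
apply; apply: contra un => /eqP/(congr1 dsubmx); rewrite col_mxKd => ->.
by rewrite linear0.
Qed.

Lemma schur_posdef : posdef (drsubmx A - (A 0 0)^-1 *: (dlsubmx A *m (dlsubmx A)^T)).
Proof. exact: pS. Qed.

Lemma posdef_diag0_gt0 : 0 < A 0 0.
Proof. exact: a0. Qed.

Lemma det_schur : \det A =
  A 0 0 * \det (drsubmx A - (A 0 0)^-1 *: (dlsubmx A *m (dlsubmx A)^T)).
Proof.
have := congr1 determinant L1A; rewrite !det_mulmx det_tr detL1 mul1r mulr1 => ->.
by rewrite det_ublock det_scalar1.
Qed.

Lemma schur_factor (L2 : 'M[R]_n) : L2 \in unitmx -> L2 *m S *m L2^T = 1%:M ->
  exists2 L, L \in unitmx & L *m A *m L^T = 1%:M.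
Proof.
move=> u2 e2; pose s := (Num.sqrt a)^-1.
have s0 : 0 < s by rewrite invr_gt0 sqrtr_gt0.
pose D : 'M[R]_(1 + n) := block_mx s%:M 0 0 L2.
exists (D *m L1).
  rewrite unitmx_mul unitL1 andbT unitmxE /D det_ublock unitrM -(unitmxE L2) u2 andbT.
  by rewrite det_scalar1 unitfE gt_eqF.
rewrite trmx_mul mulmxA -(mulmxA D) -(mulmxA D) L1A /D tr_block_mx !trmx0 !mulmx_block.
rewrite !(mul0mx, mulmx0, addr0, add0r) e2 tr_scalar_mx -!scalar_mxM.
rewrite (_ : s * a * s = 1); first by rewrite -scalar_mx_block.
have -> : s * a * s = a / (Num.sqrt a) ^+ 2 by rewrite /s; field; rewrite gt_eqF// sqrtr_gt0.
by rewrite sqr_sqrtr ?ltW// divff// gt_eqF.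
Qed.

End Block.

(** An inverse Cholesky factor, by induction through the Schur complement. It serves where a
    diagonalization would otherwise be used, to reduce a positive definite matrix to the
    identity. *)
Lemma posdef_factor n (A : 'M[R]_n) : posdef A ->
  exists2 L, L \in unitmx & L *m A *m L^T = 1%:M.
Proof.
elim: n A => [|n IH] A pA.
  exists 1%:M; first exact: unitmx1.
  by apply/matrixP => -[].
have [L2 u2 e2] := IH _ (schur_posdef (pA : posdef (A : 'M[R]_(1 + n)))).
exact: (schur_factor pA u2 e2).
Qed.

Lemma posdef_diag_gt0 n (A : 'M[R]_n) i : posdef A -> 0 < A i i.
Proof.
move=> [_ h]; rewrite -form_delta; apply: h.
by apply/eqP => /matrixP/(_ i 0); rewrite !mxE !eqxx => /eqP; rewrite oner_eq0.
Qed.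

(** Passing to the Schur complement can only lower the diagonal entries, so the induction goes
    through. *)
Lemma hadamard n (A : 'M[R]_n) : posdef A -> 0 < \det A /\ \det A <= \prod_i A i i.
Proof.
elim: n A => [|n IH] A pA.
  by rewrite det_mx00 big_ord0 ltr01 lexx.
have pA' : posdef (A : 'M[R]_(1 + n)) by [].
have pS := schur_posdef pA'; have [d0 dS] := IH _ pS.
have a0 := posdef_diag0_gt0 pA'.
rewrite (det_schur pA') big_ord_recl; split; first exact: mulr_gt0.
apply: ler_wpM2l; first exact: ltW.
apply: le_trans dS _; apply: ler_prod => i _.
rewrite (ltW (posdef_diag_gt0 i pS))/= !mxE big_ord1 !mxE.
have -> : rshift 1 i = lift ord0 i by apply: val_inj.
rewrite gerBl mulr_ge0// ?invr_ge0 ?(ltW a0)//.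
by rewrite -expr2 sqr_ge0.
Qed.

Lemma posdef_unitmx n (A : 'M[R]_n) : posdef A -> A \in unitmx.
Proof. by move=> /hadamard[d0 _]; rewrite unitmxE unitfE gt_eqF. Qed.

Lemma posdef_invmx n (A : 'M[R]_n) : posdef A -> posdef (invmx A).
Proof.
move=> pA; have uA := posdef_unitmx pA.
have [sA _] := pA.
have -> : invmx A = invmx A *m A *m (invmx A)^T.
  by rewrite trmx_inv sA mulVmx// mul1mx.
by apply: posdef_conj; rewrite ?unitmx_inv.
Qed.

Lemma psdD n (A B : 'M[R]_n) : psd A -> psd B -> psd (A + B).
Proof.
move=> [sA pA] [sB pB]; split; first by rewrite linearD/= sA sB.
by move=> u; rewrite form_mxD addr_ge0.
Qed.

Lemma posdefD n (A B : 'M[R]_n) : posdef A -> psd B -> posdef (A + B).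
Proof.
move=> [sA pA] [sB pB]; split; first by rewrite linearD/= sA sB.
by move=> u un; rewrite form_mxD ltr_pwDl// pA.
Qed.

Lemma psdZ n a (A : 'M[R]_n) : 0 <= a -> psd A -> psd (a *: A).
Proof.
move=> a0 [sA pA]; split; first by rewrite linearZ/= sA.
by move=> u; rewrite form_mxZ mulr_ge0.
Qed.

Lemma form1_ge n (u : 'cV[R]_n) : form 1%:M u u = \sum_i u i 0 ^+ 2.
Proof. by rewrite form1; apply: eq_bigr => i _; rewrite expr2. Qed.

Lemma posdef1 n : posdef (1%:M : 'M[R]_n).
Proof.
split; first exact: trmx1.
move=> u un; rewrite form1_ge lt0r sumr_ge0 ?andbT; last by move=> i _; exact: sqr_ge0.
apply: contra un => /eqP h; apply/eqP/matrixP => i j; rewrite ord1 mxE.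
have /psumr_eq0P := h => /(_ (fun i _ => sqr_ge0 _) i isT) /eqP.
by rewrite sqrf_eq0 => /eqP.
Qed.

Lemma ln_prod_le n (f : 'I_n -> R) : (forall i, 0 < f i) -> ln (\prod_i f i) <= \sum_i (f i - 1).
Proof.
move=> f0; rewrite -ler_expR lnK ?posrE ?prodr_gt0// expR_sum.
apply: ler_prod => i _; rewrite (ltW (f0 i))/=.
by have := expR_ge1Dx (f i - 1); rewrite addrC subrK.
Qed.

(* Concavity of [ln \det]: its derivative at [B] in the direction [C] is [tr (B^-1 C)]. *)
Lemma ln_det_tangent n (A B : 'M[R]_n) : posdef A -> posdef B ->
  \tr (invmx B *m (B - A)) <= ln (\det B) - ln (\det A).
Proof.
move=> pA pB; have [L uL e] := posdef_factor pB.
have uB := posdef_unitmx pB.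
have iB : invmx B = L^T *m L.
  have h : L^T *m L *m B = 1%:M.
    apply: (can_inj (mulmxK (_ : L^T \in unitmx))); first by rewrite unitmx_tr.
    by rewrite mul1mx -!mulmxA (mulmxA L) e mulmx1.
  by rewrite -[RHS](mulmxK uB) h mul1mx.
have pP := posdef_conj uL pA; set P := L *m A *m L^T in pP.
have [dP hP] := hadamard pP; have [dA _] := hadamard pA; have [dB _] := hadamard pB.
have trP : \tr (invmx B *m A) = \tr P by rewrite iB -mulmxA mxtrace_mulC.
have detP : \det P = \det L * \det A * \det L by rewrite !det_mulmx det_tr.
have dL : \det P = \det A / \det B.
  have := congr1 determinant e; rewrite !det_mulmx det_tr det1 => h.
  apply: (mulIf (lt0r_neq0 dB)); rewrite divfK ?lt0r_neq0//.
  by rewrite -[RHS]mul1r -h; ring.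
have := ln_prod_le (fun i => posdef_diag_gt0 i pP).
have : ln (\det P) <= ln (\prod_i P i i) by rewrite ler_ln ?posrE// (lt_le_trans dP).
rewrite dL ln_div ?posrE// mulmxBr mulVmx// linearB/= mxtrace1 trP /mxtrace sumrB.
rewrite sumr_const card_ord; lra.
Qed.

End PositiveForms.

(** * The one-step inequality *)

Section Step.
Variables (R : realType) (rho : R).
Hypothesis rho0 : 0 < rho.
Variable n : nat.
Implicit Types (G C : 'M[R]_n) (m x : 'cV[R]_n).

(** Normalized by [1 / rho] so that its determinant is the one in [ell]. Thus [(G + rho)^-1] is
    [rho^-1 *: invmx (regmx G)], [reg_quad G m] is [<m, (G + rho)^-1 m>], and [resolvent_vec G m] is
    [(G + rho)^-1 m]. *)
Definition regmx G : 'M[R]_n := 1%:M + rho^-1 *: G.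
Definition reg_quad G m : R := rho^-1 * form (invmx (regmx G)) m m.
Definition potential G m : R :=
  expR (rho * hfun (Num.sqrt (reg_quad G m / rho)) - 2^-1 * ln (\det (regmx G))).
Definition resolvent_vec G m : 'cV[R]_n := rho^-1 *: (invmx (regmx G) *m m).
Definition reg_radius G m : R := Num.sqrt (reg_quad G m / rho).
Definition reg_slope G m : R := ln (1 + reg_radius G m) / reg_radius G m.
(** The coefficient of [x_i x_j] in [W / 2 + (ln (1 + r) / (2 r)) Z^2]. *)
Definition quad_coef G m i j : R :=
  2^-1 * rho^-1 * invmx (regmx G) i j + reg_slope G m / 2 * (resolvent_vec G m i 0 * resolvent_vec G m j 0).

Let rhoV0 : 0 <= rho^-1. Proof. by rewrite invr_ge0 ltW. Qed.
Let rhon : rho != 0. Proof. by rewrite gt_eqF. Qed.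

Lemma regmx_posdef G : psd G -> posdef (regmx G).
Proof. by move=> pG; apply: posdefD; [exact: posdef1 | exact: psdZ]. Qed.

Lemma form_inv_self (B : 'M[R]_n) m u : posdef B ->
  form B (invmx B *m m) u = form 1%:M m u.
Proof.
move=> pB; have uB := posdef_unitmx pB; have [sB _] := pB.
by rewrite /form trmx_mul trmx_inv sB mulmx1 -!mulmxA (mulmxA (invmx B)) mulVmx// mul1mx.
Qed.

Lemma form_inv_inv (B : 'M[R]_n) m u : posdef B ->
  form B (invmx B *m m) (invmx B *m u) = form (invmx B) m u.
Proof. by move=> pB; rewrite form_inv_self// /form mulmx1 mulmxA. Qed.

(** With [u = B^-1 x] and [B >= 1], one has [f = <x, u> = <u, B u> >= |u|^2], and Cauchy-Schwarz
    gives [f^2 <= |x|^2 f]. This yields [W <= 1 / rho]. *)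
Lemma form_inv_le1 G x : psd G -> form (invmx (regmx G)) x x <= form 1%:M x x.
Proof.
move=> pG; have pB := regmx_posdef pG; set B := regmx G in pB *.
set u := invmx B *m x; set f := form _ _ _.
have fE : f = form 1%:M x u by rewrite /f /u /form mulmx1 mulmxA.
have fE2 : f = form B u u by rewrite /f -form_inv_inv.
have f0 : 0 <= f by have [_ h] := posdef_psd pB; rewrite fE2.
have cs : f ^+ 2 <= form 1%:M x x * form 1%:M u u.
  by rewrite fE; apply: psd_CS; apply: posdef_psd; exact: posdef1.
have uf : form 1%:M u u <= f.
  rewrite fE2 /B /regmx form_mxD form_mxZ lerDl mulr_ge0//.
  by have [_ h] := pG.
have x0 : 0 <= form 1%:M x x.
  by have [_ h] := posdef_psd (@posdef1 R n); exact: h.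
have [->//|fn] := eqVneq f 0.
have fp : 0 < f by rewrite lt0r fn.
rewrite -(ler_pM2r fp) -expr2; apply: le_trans cs _.
exact: ler_wpM2l.
Qed.

(** Here [G] is the matrix after the step, so only the vector moves. The factor on the right is a
    polynomial in [x] whose coefficients depend on [G] and [m] alone. *)
Lemma potential_step_le G m x : psd G -> \sum_i x i 0 ^+ 2 <= 1 ->
  potential G (m + x) <= potential G m * (1 + \sum_i reg_slope G m * resolvent_vec G m i 0 * x i 0
     + \sum_i \sum_j quad_coef G m i j * (x i 0 * x j 0)).
Proof.
move=> pG x1; have pB := regmx_posdef pG; have pBi := posdef_invmx pB.
have [sBi _] := pBi; have qBi := posdef_psd pBi; have [_ Bi0] := qBi.
set Z := \sum_i resolvent_vec G m i 0 * x i 0.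
set W := rho^-1 * form (invmx (regmx G)) x x.
have ZE : Z = rho^-1 * form (invmx (regmx G)) m x.
  rewrite (formC _ _ sBi) /Z /resolvent_vec formE mulr_sumr; apply: eq_bigr => i _.
  rewrite !mxE -mulrA; congr (_ * _); rewrite mulr_suml; apply: eq_bigr => j _; ring.
have qE : reg_quad G (m + x) = reg_quad G m + 2 * Z + W.
  rewrite /reg_quad /W ZE formDl !formDr (formC x m sBi); ring.
have q0 : 0 <= reg_quad G m by rewrite /reg_quad mulr_ge0.
have W0 : 0 <= W by rewrite /W mulr_ge0.
have W1 : W <= rho^-1.
  rewrite /W -[leRHS]mulr1; apply: ler_wpM2l => //.
  by apply: le_trans (form_inv_le1 _ pG) _; rewrite form1_ge.
have ZW : Z ^+ 2 <= reg_quad G m * W.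
  rewrite ZE /reg_quad /W exprMn.
  have -> : rho^-1 * form (invmx (regmx G)) m m * (rho^-1 * form (invmx (regmx G)) x x) =
     rho^-1 ^+ 2 * (form (invmx (regmx G)) m m * form (invmx (regmx G)) x x) by ring.
  by apply: ler_wpM2l; [exact: sqr_ge0 | exact: psd_CS].
have := hfun_sqrt_increment rho0 q0 W0 W1 ZW (erefl (reg_radius G m)).
rewrite -/(reg_slope G m) => h.
have -> : potential G (m + x) = potential G m *
   expR (rho * hfun (Num.sqrt ((reg_quad G m + 2 * Z + W) / rho)) - rho * hfun (reg_radius G m)).
  rewrite /potential -expRD qE; congr expR; rewrite /reg_radius; ring.
apply: ler_wpM2l; first exact: expR_ge0.
apply: le_trans h _.
rewrite le_eqVlt; apply/orP; left; apply/eqP; rewrite -!addrA; congr (_ + _).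
congr (_ + _).
  by rewrite /Z mulr_sumr; apply: eq_bigr => i _; rewrite mulrA.
rewrite /quad_coef.
have -> : W = \sum_i \sum_j rho^-1 * invmx (regmx G) i j * (x i 0 * x j 0).
  rewrite /W formE mulr_sumr; apply: eq_bigr => i _; rewrite mulr_sumr.
  by apply: eq_bigr => j _; ring.
have -> : Z ^+ 2 = \sum_i \sum_j (resolvent_vec G m i 0 * resolvent_vec G m j 0) * (x i 0 * x j 0).
  rewrite expr2 /Z mulr_suml; apply: eq_bigr => i _; rewrite mulr_sumr.
  by apply: eq_bigr => j _; ring.
rewrite mulr_suml mulr_sumr -big_split/=; apply: eq_bigr => i _.
rewrite mulr_suml mulr_sumr -big_split/=; apply: eq_bigr => j _.
by ring.
Qed.

(** By [1 + Q <= e^Q] the claim becomes additive in the exponent: the trace part of [Q] is paid by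
    [ln_det_tangent], the part with [D = <b, C b>] by [hfun_gain]. *)
Lemma potential_step_gain G C m : psd G -> psd C ->
  potential (G + C) m * (1 + \sum_i \sum_j quad_coef (G + C) m i j * C i j) <= potential G m.
Proof.
move=> pG pC; have pG' := psdD pG pC; have [sC pC0] := pC.
have pB := regmx_posdef pG; have pB' := regmx_posdef pG'.
have pBi' := posdef_invmx pB'; have [sBi' _] := pBi'; have [_ Bi'0] := posdef_psd pBi'.
have [_ Bi0] := posdef_psd (posdef_invmx pB).
set b := resolvent_vec (G + C) m; set D := form C b b.
have D0 : 0 <= D by exact: pC0.
have q10 : 0 <= reg_quad (G + C) m by rewrite /reg_quad mulr_ge0.
have q00 : 0 <= reg_quad G m by rewrite /reg_quad mulr_ge0.
have regD : regmx (G + C) = regmx G + rho^-1 *: C by rewrite /regmx scalerDr addrA.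
have fBb : form (regmx G) b b = rho^-1 * (reg_quad (G + C) m - D).
  have : form (regmx (G + C)) b b = rho^-1 * reg_quad (G + C) m.
    by rewrite /b /resolvent_vec formZl formZr form_inv_inv.
  rewrite {1}regD form_mxD form_mxZ -/D => h.
  by rewrite mulrBr -h addrK.
(* Cauchy-Schwarz for the form of [regmx G], applied to [(regmx G)^-1 m] and [b]. *)
have hq : reg_quad (G + C) m ^+ 2 <= reg_quad G m * (reg_quad (G + C) m - D).
  have e1 : reg_quad (G + C) m = form (regmx G) (invmx (regmx G) *m m) b.
    rewrite form_inv_self// /b /resolvent_vec formZr /reg_quad; congr (_ * _).
    by rewrite /form mulmx1 mulmxA.
  rewrite {1}e1; apply: le_trans (psd_CS _ _ (posdef_psd pB)) _.
  rewrite form_inv_inv// fBb /reg_quad le_eqVlt; apply/orP; left; apply/eqP; ring.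
have gain := hfun_gain rho0 q00 q10 D0 hq (erefl (reg_radius (G + C) m)).
rewrite -/(reg_slope (G + C) m) in gain.
have tang := ln_det_tangent pB pB'.
have trE : \tr (invmx (regmx (G + C)) *m (regmx (G + C) - regmx G)) =
   rho^-1 * \sum_i \sum_j invmx (regmx (G + C)) i j * C i j.
  have -> : regmx (G + C) - regmx G = rho^-1 *: C by rewrite regD addrC addKr.
  rewrite -scalemxAr linearZ/=; congr (_ * _).
  rewrite /mxtrace; apply: eq_bigr => i _; rewrite mxE; apply: eq_bigr => j _.
  by congr (_ * _); rewrite -{1}sC mxE.
rewrite trE in tang.
have quadE : \sum_i \sum_j quad_coef (G + C) m i j * C i j =
   2^-1 * (rho^-1 * \sum_i \sum_j invmx (regmx (G + C)) i j * C i j) + reg_slope (G + C) m / 2 * D.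
  rewrite /D formE 3!mulr_sumr -big_split/=; apply: eq_bigr => i _.
  rewrite 3!mulr_sumr -big_split/=; apply: eq_bigr => j _.
  by rewrite /quad_coef -/b; ring.
set Q := \sum_i _ in quadE *.
apply: (@le_trans _ _ (potential (G + C) m * expR Q)).
  by apply: ler_wpM2l; [exact: expR_ge0 | exact: expR_ge1Dx].
rewrite /potential -expRD ler_expR quadE.
move: gain tang; rewrite /reg_radius; lra.
Qed.

End Step.

(** * Conditional expectation and the maximal inequality *)

Section Staircase.
Variable R : realType.

(* For [x = f w], a uniform approximation of [f] by combinations of indicators of superlevel sets. *)
Lemma staircase (e x : R) (M : nat) : 0 < e -> 0 <= x -> x <= M%:R * e ->
  0 <= x - \sum_(k < M) e * (k.+1%:R * e <= x)%R%:R <= e.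
Proof.
move=> e0; elim: M x => [|M IH] x x0 xM.
  by rewrite big_ord0 subr0 x0/=; apply: le_trans xM _; rewrite mul0r ltW.
rewrite big_ord_recr/=.
have [xm|xm] := leP x (M%:R * e).
  have -> : (M.+1%:R * e <= x) = false.
    by apply/negbTE; rewrite -ltNge; apply: le_lt_trans xm _; rewrite ltr_pM2r// ltr_nat.
  by rewrite mulr0 addr0; exact: IH.
have -> : \sum_(k < M) e * (k.+1%:R * e <= x)%R%:R = M%:R * e.
  transitivity (\sum_(k < M) e); last by rewrite sumr_const card_ord mulr_natl.
  apply: eq_bigr => k _.
  have -> : (k.+1%:R * e <= x) by apply: le_trans (ltW xm); rewrite ler_pM2r// ler_nat.
  by rewrite mulr1.
move: xM; rewrite -natr1 mulrDl mul1r => xM.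
case: (leP (M%:R * e + e) x) => h; rewrite ?mulr1 ?mulr0; apply/andP; split; lra.
Qed.

End Staircase.

Section Centered.
Context d (T : measurableType d) (R : realType) (P : probability T R).

(** Encodes [E[f | G] = 0] through integrals over the sets of [G]. *)
Definition centered (G : set (set T)) (f : T -> R) :=
  P.-integrable setT (EFin \o f) /\
  forall A, G A -> (\int[P]_(w in A) (f w)%:E = 0)%E.

(** The domain is retyped by the sigma-algebra generated by [G], so that general closure properties
    of measurable functions apply to a sub-sigma-algebra. *)
Definition gmeas (G : set (set T)) (f : T -> R) :=
  measurable_fun [set: g_sigma_algebraType G] (f : g_sigma_algebraType G -> R).

Variable G : set (set T).
Hypothesis sG : sigma_algebra setT G.
Hypothesis GT : G `<=` measurable.

Lemma measurableGE (A : set T) :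
  (@measurable _ (g_sigma_algebraType G) A) = G A.
Proof. by rewrite (measurable_g_measurableTypeE sG). Qed.

Lemma gmeasP f : gmeas G f <-> forall B : set R, measurable B -> G (f @^-1` B).
Proof.
split=> h.
  by move=> B mB; have := h measurableT _ mB; rewrite setTI measurableGE.
by move=> _ B mB; rewrite setTI measurableGE; exact: h.
Qed.

Lemma gmeas_measurable f : gmeas G f -> measurable_fun [set: T] f.
Proof. by move/gmeasP => h _ B mB; rewrite setTI; apply: GT; exact: h. Qed.

Lemma centered_cexp f g : real_cexp P G f g -> centered G (fun w => f w - g w).
Proof.
move=> [If Ig mg e]; split.
  exact: (integrableB measurableT If Ig).
move=> A GA; have mA := GT GA.
have If' := integrableS measurableT mA (@subsetT _ _) If.
have Ig' := integrableS measurableT mA (@subsetT _ _) Ig.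
under eq_integral do rewrite EFinB.
rewrite integralB// e// subee//.
exact: integrable_fin_num Ig'.
Qed.

Lemma centered_restr f A B : centered G f -> G A -> G B ->
  (\int[P]_(w in A) ((\1_B w * f w)%:E) = 0)%E.
Proof.
move=> [_ h] GA GB.
rewrite -(h (B `&` A)); last first.
  by rewrite -!measurableGE in GA GB *; exact: measurableI.
rewrite [RHS]integral_mkcondl; apply: eq_integral => x _.
rewrite /restrict/= /patch indicE; case: ifPn => _; first by rewrite mul1r.
by rewrite mul0r.
Qed.

(** Within [e], [f] is uniformly a combination [s] of indicators of sets of [G], against which [g]
    integrates to 0; the error is at most [e] times the integral of [|g|]. *)
Lemma pull_out_nneg (f g : T -> R) A (K : R) : gmeas G f -> centered G g -> G A ->
  (forall w, A w -> 0 <= f w <= K) ->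
  (\int[P]_(w in A) ((f w * g w)%:E) = 0)%E.
Proof.
move=> mf cg GA fK; have [Ig hg] := cg.
have mA := GT GA.
have Ig' := integrableS measurableT mA (@subsetT _ _) Ig.
have mf' : measurable_fun A f by apply: measurable_funTS; exact: gmeas_measurable.
have mg : measurable_fun A g by exact/measurable_EFinP/(measurable_int _ Ig').
pose c := (\int[P]_(w in A) `|(g w)%:E|)%E.
have c_fin : c \is a fin_num.
  by apply: integrable_fin_num => //; exact: integrable_abse.
have c0 : (0 <= c)%E by exact: integral_ge0.
apply/eqP; rewrite -abse_eq0 eq_le abse_ge0 andbT.
suff H (e : R) : 0 < e -> (`|\int[P]_(w in A) ((f w * g w)%:E)| <= e%:E * c)%E.
  apply/lee_addgt0Pr => e e0; rewrite add0e.
  have c1 : 0 < fine c + 1 by apply: ltr_wpDl => //; exact: fine_ge0.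
  have k : 0 < e / (fine c + 1) by exact: divr_gt0.
  apply: le_trans (H _ k) _; rewrite -(fineK c_fin) -EFinM lee_fin.
  rewrite mulrAC ler_pdivrMr//.
  by apply: ler_wpM2l; [exact: ltW | rewrite lerDl].
move=> e0.
have [M hM] : exists M : nat, K <= M%:R * e.
  exists (Num.truncn (`|K| / e)).+1.
  rewrite -ler_pdivrMr//; apply: le_trans (ltW (truncnS_gt _)).
  by apply: ler_wpM2r; [rewrite invr_ge0 ltW | exact: ler_norm].
pose B (k : 'I_M) := [set w | k.+1%:R * e <= f w].
have GB k : G (B k).
  have /gmeasP := mf => /(_ `[k.+1%:R * e, +oo[%classic (measurable_itv _)).
  by congr G; apply/seteqP; split => w /=; rewrite in_itv/= andbT.
pose s w := \sum_(k < M) e * (\1_(B k) w : R).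
have sE w : A w -> 0 <= f w - s w <= e.
  move=> Aw; have /andP[f0 f1] := fK _ Aw.
  rewrite (_ : s w = \sum_(k < M) e * (k.+1%:R * e <= f w)%R%:R).
    exact: staircase e0 f0 (le_trans f1 hM).
  apply: eq_bigr => k _; rewrite indicE; congr (_ * _); congr ((nat_of_bool _)%:R).
  by apply/idP/idP => [/set_mem//|h]; exact/mem_set.
have m1 k : measurable_fun A (\1_(B k) : T -> R).
  by apply: measurable_funTS; apply: measurable_indic; exact: GT.
have ms : measurable_fun A s.
  by apply: measurable_sum => k; exact: measurable_funM.
have Iind k : P.-integrable A (fun w => (e * (\1_(B k) w * g w))%:E).
  apply: (eq_integrable mA (fun w => (e * \1_(B k) w)%:E * (g w)%:E)%E).
    by move=> w _; rewrite -EFinM mulrA.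
  apply: (integrableMr mA (h := fun w => e * \1_(B k) w) (g := EFin \o g)) => //.
    exact: measurable_funM.
  exists e; split; first exact: num_real.
  move=> x ex w _ /=; rewrite normrM (gtr0_norm e0) indicE.
  apply: le_trans (ltW ex); rewrite -[leRHS]mulr1; apply: ler_wpM2l; first exact: ltW.
  by case: (_ \in _); rewrite ?normr1 ?normr0.
have Idf : P.-integrable A (fun w => ((f w - s w) * g w)%:E).
  apply: (eq_integrable mA (fun w => (f w - s w)%:E * (g w)%:E)%E).
    by move=> w _; rewrite -EFinM.
  apply: (integrableMr mA (h := fun w => f w - s w) (g := EFin \o g)) => //.
    exact: measurable_funB.
  exists e; split; first exact: num_real.
  move=> x ex w Aw /=; apply: le_trans (ltW ex).
  by have /andP[h1 h2] := sE _ Aw; rewrite ger0_norm.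
have -> : (\int[P]_(w in A) ((f w * g w)%:E) = \int[P]_(w in A) ((f w - s w) * g w)%:E)%E.
  transitivity (\int[P]_(w in A) (((f w - s w) * g w)%:E + \sum_(k < M) (e * (\1_(B k) w * g w))%:E))%E.
    apply: eq_integral => w _; rewrite sumEFin -EFinD; congr EFin.
    rewrite mulrBl -[LHS](subrK (s w * g w)); congr (_ + _).
    by rewrite /s mulr_suml; apply: eq_bigr => k _; rewrite mulrA.
  rewrite integralD//; last by apply: integrable_sum => // k _; exact: Iind.
  rewrite integral_sum// big1 ?adde0// => k _.
  under eq_integral do rewrite EFinM.
  rewrite integralZl//.
    by rewrite (centered_restr cg GA (GB k)) mule0.
  apply: (eq_integrable mA (fun w => (\1_(B k) w)%:E * (g w)%:E)%E).
    by move=> w _; rewrite -EFinM.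
  apply: (integrableMr mA (h := \1_(B k)) (g := EFin \o g)) => //.
  exists 1; split; first exact: num_real.
  move=> x ex w _ /=; apply: le_trans (ltW ex); rewrite indicE.
  by case: (_ \in _); rewrite ?normr1 ?normr0.
apply: le_trans (le_abse_integral P mA (measurable_int _ Idf)) _.
have mag : measurable_fun A (fun w => `|(g w)%:E|%E).
  by apply: measurableT_comp => //; exact/measurable_EFinP.
rewrite /c -ge0_integralZl//; last by rewrite lee_fin ltW.
apply: ge0_le_integral => //.
- by apply: measurableT_comp => //; exact: (measurable_int _ Idf).
- by apply: emeasurable_funM => //; exact: measurable_cst.
move=> w Aw; rewrite /= lee_fin normrM; apply: ler_wpM2r => //.
by have /andP[h1 h2] := sE _ Aw; rewrite ger0_norm.
Qed.

End Centered.

Section PullOut.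
Context d (T : measurableType d) (R : realType) (P : probability T R).
Variable G : set (set T).
Hypothesis sG : sigma_algebra setT G.
Hypothesis GT : G `<=` measurable.

Lemma bounded_mul_integrable (f g : T -> R) A (K : R) : measurable A ->
  measurable_fun A f -> P.-integrable setT (EFin \o g) ->
  (forall w, A w -> `|f w| <= K) -> P.-integrable A (fun w => (f w * g w)%:E).
Proof.
move=> mA mf Ig fK.
have Ig' := integrableS measurableT mA (@subsetT _ _) Ig.
apply: (eq_integrable mA (fun w => (f w)%:E * (g w)%:E)%E).
  by move=> w _; rewrite -EFinM.
apply: (integrableMr mA (h := f) (g := EFin \o g)) => //.
exists K; split; first exact: num_real.
by move=> x Kx w Aw /=; apply: le_trans (ltW Kx); exact: fK.
Qed.

Lemma pull_out (f g : T -> R) A (K : R) : gmeas G f -> centered P G g -> G A ->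
  (forall w, A w -> `|f w| <= K) ->
  (\int[P]_(w in A) ((f w * g w)%:E) = 0)%E.
Proof.
move=> mf cg GA fK; have [Ig hg] := cg.
have mA := GT GA.
have mfT := gmeas_measurable sG GT mf.
have mf' : measurable_fun A f by exact: measurable_funTS.
have mfK : gmeas G (fun w => f w + K).
  by apply: measurable_funD; [exact: mf | exact: measurable_cst].
have h : forall w, A w -> 0 <= f w + K <= K + K.
  move=> w Aw; have := fK _ Aw; rewrite ler_norml => /andP[h1 h2].
  by apply/andP; split; lra.
have := pull_out_nneg sG GT mfK cg GA h.
have -> : (\int[P]_(w in A) ((f w + K) * g w)%:E =
   \int[P]_(w in A) ((f w * g w)%:E + (K * g w)%:E))%E.
  by apply: eq_integral => w _; rewrite -EFinD mulrDl.
rewrite integralD//; last 2 first.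
- exact: bounded_mul_integrable fK.
- by apply: (@bounded_mul_integrable (fun=> K) g A `|K|) => //.
have -> : (\int[P]_(w in A) (K * g w)%:E = 0)%E.
  under eq_integral do rewrite EFinM.
  rewrite integralZl//; last exact: integrableS Ig.
  by rewrite hg// mule0.
by rewrite adde0.
Qed.

(** The coefficients [f i] may be unbounded and [S] may fail to be integrable. On the sets [AK k] of
    [G] everything known is bounded by [k], the centered terms integrate to 0, and monotone
    convergence in [k] recovers [A]. *)
Lemma conditional_step (I : finType) (f dl : I -> T -> R) (S S' : T -> R) A :
  (forall i, gmeas G (f i)) -> (forall i, centered P G (dl i)) ->
  gmeas G S -> (forall w, 0 <= S w) ->
  measurable_fun setT S' -> (forall w, 0 <= S' w) ->
  {ae P, forall w, S' w <= S w + \sum_i f i w * dl i w} ->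
  G A -> (\int[P]_(w in A) (S' w)%:E <= \int[P]_(w in A) (S w)%:E)%E.
Proof.
move=> mf cd mS S0 mS' S'0 ae GA.
pose bnd w := S w + \sum_i `|f i w|.
have mb : gmeas G bnd.
  apply: measurable_funD; first exact: mS.
  by apply: measurable_sum => i; apply: measurableT_comp => //; exact: mf.
have fb i w : `|f i w| <= bnd w.
  rewrite /bnd (bigD1 i)//= addrCA lerDl addr_ge0//.
  by apply: sumr_ge0 => j _; exact: normr_ge0.
have Sb w : S w <= bnd w by rewrite lerDl; apply: sumr_ge0.
pose AK (k : nat) := A `&` [set w | bnd w <= k%:R].
have GAK k : G (AK k).
  have h : G [set w | bnd w <= k%:R].
    have /(gmeasP sG) := mb => /(_ `]-oo, k%:R]%classic (measurable_itv _)).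
    by congr G; apply/seteqP; split => w /=; rewrite in_itv.
  by rewrite /AK -!(measurableGE sG) in h GA *; exact: measurableI.
have mAK k : measurable (AK k) by exact: GT.
have AKU : \bigcup_k AK k = A.
  apply/seteqP; split => [w [k _ []//]|w Aw].
  exists (Num.truncn (bnd w)).+1 => //; split => //=.
  exact/ltW/truncnS_gt.
have ndAK : nondecreasing_seq AK.
  move=> k l kl; apply/subsetPset => w [Aw /= h]; split => //=.
  by apply: le_trans h _; rewrite ler_nat.
have mST := gmeas_measurable sG GT mS.
have key k : (\int[P]_(w in AK k) (S' w)%:E <= \int[P]_(w in AK k) (S w)%:E)%E.
  have mSk : measurable_fun (AK k) S by exact: measurable_funTS.
  have IX i : P.-integrable (AK k) (fun w => (f i w * dl i w)%:E).
    have [Id _] := cd i.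
    apply: (@bounded_mul_integrable _ _ _ k%:R) => //.
      by apply: measurable_funTS; exact: (gmeas_measurable sG GT (mf i)).
    by move=> w [_ /= h]; apply: le_trans h; exact: fb.
  have ISum : P.-integrable (AK k) (fun w => \sum_i (f i w * dl i w)%:E)%E.
    by apply: integrable_sum => // i _; exact: IX.
  have IS : P.-integrable (AK k) (fun w => (S w)%:E).
    apply: (eq_integrable _ (fun w => (S w * 1)%:E)) => //.
      by move=> w _; rewrite mulr1.
    apply: (@bounded_mul_integrable S (fun=> 1) _ k%:R) => //.
      exact: finite_measure_integrable_cst.
    by move=> w [_ /= h]; rewrite ger0_norm//; apply: le_trans h; exact: Sb.
  pose X w := S w + \sum_i f i w * dl i w.
  have mX : measurable_fun (AK k) X.
    apply: measurable_funD => //; apply: measurable_sum => i.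
    exact/measurable_EFinP/(measurable_int _ (IX i)).
  have eX : (\int[P]_(w in AK k) (X w)%:E = \int[P]_(w in AK k) (S w)%:E)%E.
    transitivity (\int[P]_(w in AK k) ((S w)%:E + \sum_i (f i w * dl i w)%:E))%E.
      by apply: eq_integral => w _; rewrite sumEFin -EFinD.
    rewrite integralD// integral_sum// big1 ?adde0// => i _.
    apply: (@pull_out _ _ _ k%:R) => //.
    by move=> w [_ /= h]; apply: le_trans h; exact: fb.
  rewrite -eX.
  (* The majorant [X] is nonnegative only almost surely; the maximum with [0] makes it so
     everywhere. *)
  apply: (@le_trans _ _ (\int[P]_(w in AK k) (Num.max 0 (X w))%:E)%E).
    apply: ae_ge0_le_integral => //.
    - by move=> w _; rewrite lee_fin.
    - by apply/measurable_EFinP; exact: measurable_funTS.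
    - by move=> w _; rewrite lee_fin le_max lexx.
    - apply/measurable_EFinP; apply: measurable_maxr => //; exact: measurable_cst.
    by apply: filterS ae => w h _; rewrite lee_fin le_max h orbT.
  rewrite le_eqVlt; apply/orP; left; apply/eqP; apply: ae_eq_integral => //.
  - apply/measurable_EFinP; apply: measurable_maxr => //; exact: measurable_cst.
  - exact/measurable_EFinP.
  apply: filterS ae => w h _; congr EFin; apply/max_idPr.
  exact: le_trans (S'0 w) h.
have mS'E : measurable_fun setT (fun w => (S' w)%:E) by exact/measurable_EFinP.
have mSE : measurable_fun setT (fun w => (S w)%:E) by exact/measurable_EFinP.
have c1 := @ge0_nondecreasing_set_cvg_integral _ _ _ AK (fun w => (S' w)%:E) P ndAK mAK
   (fun k => measurable_funTS mS'E) (fun k w _ => S'0 w).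
have c2 := @ge0_nondecreasing_set_cvg_integral _ _ _ AK (fun w => (S w)%:E) P ndAK mAK
   (fun k => measurable_funTS mSE) (fun k w _ => S0 w).
rewrite AKU in c1 c2.
rewrite -(cvg_lim (@ereal_hausdorff R) c1) -(cvg_lim (@ereal_hausdorff R) c2).
apply: lee_lim; [apply: cvgP c1 | apply: cvgP c2 | exact: nearW].
Qed.

End PullOut.

Section Ville.
Context d (T : measurableType d) (R : realType) (P : probability T R).
Variables (F : nat -> set (set T)) (F_filt : filtration F).
Variables (S : nat -> T -> R) (c : R).
Hypothesis mS : forall n, gmeas (F n) (S n).
Hypothesis S0 : forall n w, 0 <= S n w.
Hypothesis superm : forall n A, F n A ->
  (\int[P]_(w in A) (S n.+1 w)%:E <= \int[P]_(w in A) (S n w)%:E)%E.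
Hypothesis init : (\int[P]_w (S 0%N w)%:E <= 1)%E.
Hypothesis c0 : 0 < c.

Let E n := [set w | c < S n w].
(** The event that the first passage above [c] comes after time [n]; it belongs to [F n]. *)
Fixpoint below n := if n is n'.+1 then below n' `&` ~` E n'.+1 else ~` E 0.

Let sF n : sigma_algebra setT (F n). Proof. by have [] := F_filt. Qed.
Let FT n : F n `<=` measurable. Proof. by have [] := F_filt. Qed.
Let Fnd m n : (m <= n)%N -> F m `<=` F n. Proof. by have [_ _] := F_filt; exact. Qed.

Let FE n : F n (E n).
Proof.
have /(gmeasP (sF n)) := @mS n => /(_ `]c, +oo[%classic (measurable_itv _)).
by congr (F n); apply/seteqP; split => w /=; rewrite in_itv/= andbT.
Qed.

Let FC n A : F n A -> F n (~` A).
Proof. by rewrite -!(measurableGE (sF n)); exact: measurableC. Qed.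

Let FI n A B : F n A -> F n B -> F n (A `&` B).
Proof. by rewrite -!(measurableGE (sF n)); exact: measurableI. Qed.

Let Fbelow n : F n (below n).
Proof.
elim: n => [|n IH] /=; first exact: FC.
by apply: FI; [exact: Fnd IH | exact: FC].
Qed.

Let mSE n : measurable_fun setT (fun w => (S n w)%:E).
Proof. by apply/measurable_EFinP; exact: (gmeas_measurable (sF n) (FT (n:=n)) (@mS n)). Qed.

Let mE n : measurable (E n). Proof. exact: (@FT n) (FE n). Qed.
Let mb n : measurable (below n). Proof. exact: (@FT n) (Fbelow n). Qed.

Let cheb n B : measurable B -> B `<=` E n ->
  (c%:E * P B <= \int[P]_(w in B) (S n w)%:E)%E.
Proof.
move=> mB BE; rewrite -integral_cst//; apply: ge0_le_integral => //.
- by move=> w _; rewrite lee_fin ltW.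
- exact: measurable_funTS.
by move=> w /BE /= h; rewrite lee_fin ltW.
Qed.

(** Optional stopping written as an induction: on [below n] the integral decreases by [superm], and
    the part that crosses at time [n.+1] is moved into the probability by Markov's inequality. *)
Let ville_ind n : (c%:E * P (~` below n) + \int[P]_(w in below n) (S n w)%:E <= 1)%E.
Proof.
elim: n => [|n IH] /=.
  apply: le_trans init; rewrite setCK.
  rewrite -[X in (_ <= \int[P]_(w in X) _)%E](setvU (E 0)) setUC ge0_integral_setU//.
  - by apply: leeD2r; exact: cheb.
  - exact: measurableC.
  - exact: measurable_funTS.
  - by move=> w _; rewrite lee_fin.
  - by apply/disj_setPS => w [].
apply: le_trans IH.
set B := below n; set En := E n.+1.
have mB : measurable B by exact: mb.
have mEn : measurable En by exact: mE.
have mBE : measurable (B `&` En) by exact: measurableI.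
have mBCE : measurable (B `&` ~` En) by apply: measurableI => //; exact: measurableC.
have -> : ~` (B `&` ~` En) = ~` B `|` (B `&` En).
  apply/seteqP; split => w /=.
    by have [?|?] := pselect (B w); have [?|?] := pselect (En w); tauto.
  tauto.
rewrite measureU//; last 2 first.
- exact: measurableC.
- by apply/seteqP; split => w //= -[] ? [].
rewrite ge0_muleDr// -addeA; apply: leeD2l.
apply: le_trans (superm (Fbelow n)); rewrite -/B.
have eB : B = (B `&` En) `|` (B `&` ~` En) by rewrite -setIUr setUv setIT.
rewrite [X in (_ <= \int[P]_(w in X) _)%E]eB [leRHS]ge0_integral_setU//.
- by apply: leeD2r; apply: cheb => // w [].
- exact: measurable_funTS.
- by move=> w _; rewrite lee_fin.
- by apply/disj_setPS => w [[_ ?] [_ ?]].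
Qed.

Let belowE n : ~` below n = \bigcup_(k in `I_n.+1) E k.
Proof.
elim: n => [|n IH] /=.
  by rewrite setCK bigcup_mkord big_ord1.
by rewrite setCI setCK IH !bigcup_mkord [in RHS]big_ord_recr.
Qed.

Lemma ville_inequality : (P (\bigcup_n E n) <= (c^-1)%:E)%E.
Proof.
have h n : (P (~` below n) <= (c^-1)%:E)%E.
  have : (c%:E * P (~` below n) <= 1)%E.
    apply: le_trans (ville_ind n); rewrite leeDl//.
    by apply: integral_ge0 => w _; rewrite lee_fin.
  have fin := fin_num_measure P _ (measurableC (mb n)).
  rewrite -(fineK fin) -EFinM !lee_fin => k.
  by rewrite -[leRHS]mulr1 ler_pdivlMl.
have -> : \bigcup_n E n = \bigcup_n ~` below n.
  apply/seteqP; split => [w [n _ En]|w [n _]].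
    by exists n => //; rewrite belowE; exists n => /=.
  by rewrite belowE => -[k _ Ek]; exists k.
have cv : P (~` below n) @[n --> \oo] --> P (\bigcup_n ~` below n).
  apply: nondecreasing_cvg_mu.
  - by move=> n; exact: measurableC.
  - by apply: bigcup_measurable => n _; exact: measurableC.
  - by apply/nondecreasing_seqP => n; apply/subsetPset; rewrite /= setCI; exact: subsetUl.
rewrite -(cvg_lim (@ereal_hausdorff R) cv).
by apply: lime_le; [exact: cvgP cv | exact: nearW].
Qed.

End Ville.

(** * Measurability of the potential and of the coefficients *)

Section Measurability.
Context d (T : measurableType d) (R : realType).

Lemma measurable_invr : measurable_fun [set: R] (@GRing.inv R).
Proof.
have -> : @GRing.inv R = fun x => if 0 < x then expR (- ln x) else
    if x < 0 then - expR (- ln (- x)) else 0.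
  apply/funext => x; case: (ltrgtP x 0) => [x0|x0|->]; last by rewrite invr0.
    by rewrite expRN lnK ?posrE ?oppr_gt0// invrN opprK.
  by rewrite expRN lnK.
have m1 : measurable_fun [set: R] (fun x : R => expR (- ln x)).
  apply: measurableT_comp; first exact: measurable_expR.
  by apply: measurable_funN; exact: measurable_ln.
apply: measurable_fun_ifT => //.
  by apply: measurable_fun_ltr => //; exact: measurable_cst.
apply: measurable_fun_ifT => //.
  by apply: measurable_fun_ltr => //; exact: measurable_cst.
have m2 : measurable_fun [set: R] (fun x : R => - x) by exact: measurable_funN.
by apply: measurable_funN; exact: (measurableT_comp m1 m2).
Qed.

Lemma measurable_sqrt_hfun : measurable_fun [set: R] (fun x : R => hfun (Num.sqrt x)).
Proof.
have ms : measurable_fun [set: R] (fun x : R => Num.sqrt x).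
  by apply: continuous_measurable_fun => x; exact: sqrt_continuous.
have m1 : measurable_fun [set: R] (fun x : R => 1 + Num.sqrt x).
  by apply: measurable_funD => //; exact: measurable_cst.
apply: measurable_funB => //; apply: measurable_funM => //.
by apply: measurableT_comp => //; exact: measurable_ln.
Qed.

Definition mx_measurable p q (A : T -> 'M[R]_(p, q)) :=
  forall i j, measurable_fun setT (fun w => A w i j).

Lemma mx_measurableM p q r (A : T -> 'M[R]_(p, q)) (B : T -> 'M[R]_(q, r)) :
  mx_measurable A -> mx_measurable B -> mx_measurable (fun w => A w *m B w).
Proof.
move=> mA mB i j.
have -> : (fun w => (A w *m B w) i j) = fun w => \sum_k A w i k * B w k j.
  by apply/funext => w; rewrite mxE.
by apply: measurable_sum => k; exact: measurable_funM.
Qed.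

Lemma mx_measurableT p q (A : T -> 'M[R]_(p, q)) :
  mx_measurable A -> mx_measurable (fun w => (A w)^T).
Proof.
move=> mA i j; have -> : (fun w => (A w)^T i j) = fun w => A w j i.
  by apply/funext => w; rewrite mxE.
exact: mA.
Qed.

Lemma measurable_det p (A : T -> 'M[R]_p) :
  mx_measurable A -> measurable_fun setT (fun w => \det (A w)).
Proof.
move=> mA; rewrite /determinant; apply: measurable_sum => s.
apply: measurable_funM; first exact: measurable_cst.
by apply: measurable_prod => i _; exact: mA.
Qed.

Lemma mx_measurable_inv p (A : T -> 'M[R]_p) :
  mx_measurable A -> mx_measurable (fun w => invmx (A w)).
Proof.
move=> mA i j.
(* [invmx] returns a singular matrix unchanged, hence the first branch; the second is the cofactor
   formula. *)
have -> : (fun w => invmx (A w) i j) = fun w => if \det (A w) == 0 then A w i j else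
   (\det (A w))^-1 * ((-1) ^+ (j + i) * \det (row' j (col' i (A w)))).
  apply/funext => w; rewrite /invmx unitmxE unitfE.
  by case: eqP => //= _; rewrite !mxE.
have md := measurable_det mA.
apply: measurable_fun_ifT => //.
- by apply: measurable_fun_eqr => //; exact: measurable_cst.
apply: measurable_funM; first exact: measurableT_comp measurable_invr md.
apply: measurable_funM; first exact: measurable_cst.
apply: measurable_det => k l.
have -> : (fun w => row' j (col' i (A w)) k l) = fun w => A w (lift j k) (lift i l).
  by apply/funext => w; rewrite !mxE.
exact: mA.
Qed.

Variables (rho : R) (n : nat) (G : T -> 'M[R]_n) (m : T -> 'cV[R]_n).
Hypothesis mG : mx_measurable G.
Hypothesis mm : mx_measurable m.

Lemma measurable_regmx : mx_measurable (fun w => regmx rho (G w)).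
Proof.
move=> i j; have -> : (fun w => regmx rho (G w) i j) =
   fun w => (i == j)%:R + rho^-1 * G w i j by apply/funext => w; rewrite !mxE.
apply: measurable_funD; first exact: measurable_cst.
by apply: measurable_funM; [exact: measurable_cst | exact: mG].
Qed.

Lemma measurable_reg_quad : measurable_fun setT (fun w => reg_quad rho (G w) (m w)).
Proof.
apply: measurable_funM; first exact: measurable_cst.
apply: mx_measurableM => //; apply: mx_measurableM; first exact: mx_measurableT.
by apply: mx_measurable_inv; exact: measurable_regmx.
Qed.

Lemma measurable_potential : measurable_fun setT (fun w => potential rho (G w) (m w)).
Proof.
apply: measurableT_comp; first exact: measurable_expR.
apply: measurable_funB.
  apply: measurable_funM; first exact: measurable_cst.
  have mq : measurable_fun setT (fun w => reg_quad rho (G w) (m w) / rho).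
    by apply: measurable_funM; [exact: measurable_reg_quad | exact: measurable_cst].
  exact: (measurableT_comp measurable_sqrt_hfun mq).
apply: measurable_funM; first exact: measurable_cst.
apply: measurableT_comp; first exact: measurable_ln.
by apply: measurable_det; exact: measurable_regmx.
Qed.

Lemma measurable_resolvent_vec i : measurable_fun setT (fun w => resolvent_vec rho (G w) (m w) i 0).
Proof.
have -> : (fun w => resolvent_vec rho (G w) (m w) i 0) =
   fun w => rho^-1 * (invmx (regmx rho (G w)) *m m w) i 0.
  by apply/funext => w; rewrite mxE.
apply: measurable_funM; first exact: measurable_cst.
by apply: mx_measurableM => //; apply: mx_measurable_inv; exact: measurable_regmx.
Qed.

Lemma measurable_reg_slope : measurable_fun setT (fun w => reg_slope rho (G w) (m w)).
Proof.
have mr : measurable_fun setT (fun w => reg_radius rho (G w) (m w)).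
  have mq : measurable_fun setT (fun w => reg_quad rho (G w) (m w) / rho).
    by apply: measurable_funM; [exact: measurable_reg_quad | exact: measurable_cst].
  have ms : measurable_fun [set: R] (@Num.sqrt R).
    by apply: continuous_measurable_fun => x; exact: sqrt_continuous.
  exact: (measurableT_comp ms mq).
apply: measurable_funM; last exact: measurableT_comp measurable_invr mr.
apply: measurableT_comp; first exact: measurable_ln.
by apply: measurable_funD => //; exact: measurable_cst.
Qed.

Lemma measurable_quad_coef i j : measurable_fun setT (fun w => quad_coef rho (G w) (m w) i j).
Proof.
apply: measurable_funD.
  apply: measurable_funM; first exact: measurable_cst.
  by apply: mx_measurable_inv; exact: measurable_regmx.
apply: measurable_funM.
  by apply: measurable_funM; [exact: measurable_reg_slope | exact: measurable_cst].
by apply: measurable_funM; exact: measurable_resolvent_vec.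
Qed.

End Measurability.

(** * The inequality in finite dimension *)

Section FiniteDim.
Context d (T : measurableType d) (R : realType) (P : probability T R).
Variables (F : nat -> set (set T)) (F_filt : filtration F).
Variables (rho : R) (rho0 : 0 < rho) (N : nat).
Variables (m : nat -> T -> 'cV[R]_N) (c : nat -> T -> 'M[R]_N).
Hypothesis mm : forall n i, gmeas (F n) (fun w => m n w i 0).
Hypothesis m0 : {ae P, forall w, m 0 w = 0}.
Hypothesis mc : forall n i j, gmeas (F n) (fun w => c n.+1 w i j).
Hypothesis x_cent : forall n i, centered P (F n) (fun w => (m n.+1 w - m n w) i 0).
Hypothesis xx_cent : forall n i j, centered P (F n)
  (fun w => (m n.+1 w - m n w) i 0 * (m n.+1 w - m n w) j 0 - c n.+1 w i j).
Hypothesis x_le1 : forall n, {ae P, forall w, \sum_i (m n.+1 w - m n w) i 0 ^+ 2 <= 1}.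
Hypothesis c_psd : forall n, {ae P, forall w, psd (c n.+1 w)}.

Definition qvar n w : 'M[R]_N := \sum_(k < n) c k.+1 w.

Let SS n w := potential rho (qvar n w) (m n w).

Let sF n : sigma_algebra setT (F n). Proof. by have [] := F_filt. Qed.
Let FT n : F n `<=` measurable. Proof. by have [] := F_filt. Qed.

Lemma gmeas_mono n k (f : T -> R) : (n <= k)%N -> gmeas (F n) f -> gmeas (F k) f.
Proof.
move=> nk /(gmeasP (@sF n)) h; apply/(gmeasP (@sF k)) => B mB.
by have [_ _ inc] := F_filt; apply: inc nk _ _; exact: h.
Qed.

(** Predictability: the matrix at time [n.+1] is already known at time [n], so it may enter
    coefficients that are pulled out of conditional means. *)
Let mq n i j : gmeas (F n) (fun w => qvar n.+1 w i j).
Proof.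
have -> : (fun w => qvar n.+1 w i j) = fun w => \sum_(k < n.+1) c k.+1 w i j.
  by apply/funext => w; rewrite summxE.
apply: (@measurable_sum _ (g_sigma_algebraType (F n)) R setT) => k.
by apply: (@gmeas_mono k n); [rewrite -ltnS | exact: mc].
Qed.

Let mq' n i j : gmeas (F n) (fun w => qvar n w i j).
Proof.
case: n => [|n]; last by apply: (@gmeas_mono n n.+1) => //; exact: mq.
have -> : (fun w => qvar 0 w i j) = fun=> 0.
  by apply/funext => w; rewrite /qvar big_ord0 mxE.
exact: measurable_cst.
Qed.

Let mmx n : @mx_measurable _ (g_sigma_algebraType (F n)) R _ _ (m n).
Proof. by move=> i j; rewrite ord1; exact: mm. Qed.

Let mS n : gmeas (F n) (SS n).
Proof.
apply: (@measurable_potential _ (g_sigma_algebraType (F n)) R rho N (qvar n) (m n)) => //.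
by move=> i j; exact: mq'.
Qed.

Lemma gmeas_potential n : gmeas (F n) (fun w => potential rho (qvar n w) (m n w)).
Proof. exact: mS. Qed.

Let psd0 : psd (0 : 'M[R]_N).
Proof. by split=> [|u]; [exact: trmx0 | rewrite /form mulmx0 mul0mx mxE]. Qed.

Let q_psd n : {ae P, forall w, psd (qvar n w)}.
Proof.
elim: n => [|n IH].
  by apply: nearW => w; rewrite /qvar big_ord0.
apply: filterS2 IH (c_psd n) => w h1 h2; rewrite /qvar big_ord_recr/=.
exact: psdD.
Qed.

Let superm n A : F n A ->
  (\int[P]_(w in A) (SS n.+1 w)%:E <= \int[P]_(w in A) (SS n w)%:E)%E.
Proof.
move=> FA.
(* The majorant is linear in the centered variables indexed by [I]: the coordinates of the
   increment, and their pairwise products minus the entries of [c n.+1]. *)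
pose I : finType := ('I_N + 'I_N * 'I_N)%type.
pose f (i : I) w : R := match i with
  | inl i => potential rho (qvar n.+1 w) (m n w) *
      (reg_slope rho (qvar n.+1 w) (m n w) * resolvent_vec rho (qvar n.+1 w) (m n w) i 0)
  | inr (i, j) => potential rho (qvar n.+1 w) (m n w) * quad_coef rho (qvar n.+1 w) (m n w) i j
  end.
pose dl (i : I) w : R := match i with
  | inl i => (m n.+1 w - m n w) i 0
  | inr (i, j) => (m n.+1 w - m n w) i 0 * (m n.+1 w - m n w) j 0 - c n.+1 w i j
  end.
have mqx : @mx_measurable _ (g_sigma_algebraType (F n)) R _ _ (qvar n.+1) by move=> i j; exact: mq.
have mSt := @measurable_potential _ (g_sigma_algebraType (F n)) R rho N _ _ mqx (mmx (n:=n)).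
apply: (@conditional_step _ _ _ P (F n) (@sF n) (@FT n) I f dl (SS n) (SS n.+1) A _ _ _ _ _ _ _ FA).
- move=> [i|[i j]] /=.
    apply: (@measurable_funM _ (g_sigma_algebraType (F n))) => //.
    apply: (@measurable_funM _ (g_sigma_algebraType (F n))).
      exact: (@measurable_reg_slope _ (g_sigma_algebraType (F n)) R rho N _ _ mqx (mmx (n:=n))).
    exact: (@measurable_resolvent_vec _ (g_sigma_algebraType (F n)) R rho N _ _ mqx (mmx (n:=n))).
  apply: (@measurable_funM _ (g_sigma_algebraType (F n))) => //.
  exact: (@measurable_quad_coef _ (g_sigma_algebraType (F n)) R rho N _ _ mqx (mmx (n:=n))).
- by move=> [i|[i j]]; [exact: x_cent | exact: xx_cent].
- exact: mS.
- by move=> w; exact: expR_ge0.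
- exact: (gmeas_measurable (@sF n.+1) (FT (n:=n.+1)) (@mS n.+1)).
- by move=> w; exact: expR_ge0.
apply: filterS3 (q_psd n) (c_psd n) (x_le1 n) => w pq pc x1.
have qS : qvar n.+1 w = qvar n w + c n.+1 w by rewrite /qvar big_ord_recr.
have pq' : psd (qvar n.+1 w) by rewrite qS; exact: psdD.
have ub := potential_step_le rho0 (m n w) pq' x1.
have gain := potential_step_gain rho0 (m n w) pq pc.
rewrite -qS in gain; rewrite addrC subrK in ub.
apply: le_trans ub _; rewrite -lerBlDr; apply: le_trans gain.
rewrite le_eqVlt; apply/orP; left; apply/eqP.
rewrite big_sumType/=.
have -> : \sum_(p : 'I_N * 'I_N) f (inr p) w * dl (inr p) w =
  \sum_i \sum_j f (inr (i, j)) w * dl (inr (i, j)) w.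
  by rewrite pair_big/=; apply: eq_bigr => -[].
set St := potential _ _ _.
rewrite !mulrDr !mulr1 !mulr_sumr.
rewrite /f /dl/=.
have -> : \sum_i \sum_j St * quad_coef rho (qvar n.+1 w) (m n w) i j *
   ((m n.+1 w - m n w) i 0 * (m n.+1 w - m n w) j 0 - c n.+1 w i j) =
   \sum_i St * (\sum_j quad_coef rho (qvar n.+1 w) (m n w) i j * ((m n.+1 w - m n w) i 0 * (m n.+1 w - m n w) j 0))
   - \sum_i St * (\sum_j quad_coef rho (qvar n.+1 w) (m n w) i j * c n.+1 w i j).
  rewrite -sumrB; apply: eq_bigr => i _; rewrite !mulr_sumr -sumrB.
  by apply: eq_bigr => j _; ring.
have -> : \sum_(i < N) St * (reg_slope rho (qvar n.+1 w) (m n w) * resolvent_vec rho (qvar n.+1 w) (m n w) i 0) *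
    (m n.+1 w - m n w) i 0 =
   \sum_i St * (reg_slope rho (qvar n.+1 w) (m n w) * resolvent_vec rho (qvar n.+1 w) (m n w) i 0 * (m n.+1 w - m n w) i 0).
  by apply: eq_bigr => i _; rewrite !mulrA.
ring.
Qed.

Lemma reg_quad0 : reg_quad rho (0 : 'M[R]_N) 0 = 0.
Proof. by rewrite /reg_quad /form mulmx0 mxE mulr0. Qed.

Let init : (\int[P]_w (SS 0 w)%:E <= 1)%E.
Proof.
have -> : (\int[P]_w (SS 0 w)%:E = \int[P]_w 1%E)%E.
  apply: ae_eq_integral => //.
  - by apply/measurable_EFinP; exact: (gmeas_measurable (@sF 0) (FT (n:=0)) (@mS 0)).
  apply: filterS m0 => w e _; congr EFin.
  rewrite /SS /qvar big_ord0 e /potential reg_quad0 mul0r sqrtr0 /hfun addr0 ln1 mulr0 subrr mulr0.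
  by rewrite /regmx scaler0 addr0 det1 ln1 mulr0 subrr expR0.
by rewrite integral_cst// mul1e; exact: probability_le1.
Qed.

Lemma finite_dim_ineq (a : R) : 0 < a ->
  (P (\bigcup_n [set w | (a < potential rho (qvar n w) (m n w))%R]) <= (a^-1)%:E)%E.
Proof.
move=> a0; apply: (ville_inequality F_filt (S := SS)) => //.
by move=> n w; exact: expR_ge0.
Qed.

End FiniteDim.

(** * Hilbert spaces and positive trace-class operators *)

Section Hilbert.
Variables (R : realType) (H : completeNormedModType R) (ip : {dot H for idfun}).
Hypothesis ip_norm : induces_norm ip.
Implicit Types (x y z : H) (a : R) (u v : nat -> H).

Lemma ipC x y : ip x y = ip y x.
Proof. by rewrite hermC/= expr0 mul1r. Qed.

Lemma ipDl x y z : ip (x + y) z = ip x z + ip y z.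
Proof. by rewrite linearDl. Qed.

Lemma ipZl a x z : ip (a *: x) z = a * ip x z.
Proof. by rewrite linearZl_LR. Qed.

Lemma ipDr x y z : ip z (x + y) = ip z x + ip z y.
Proof. by rewrite linearDr. Qed.

Lemma ipZr a x z : ip z (a *: x) = a * ip z x.
Proof. by rewrite linearZr_LR. Qed.

Lemma ip0l z : ip 0 z = 0. Proof. by rewrite -(scale0r (0 : H)) ipZl mul0r. Qed.
Lemma ip0r z : ip z 0 = 0. Proof. by rewrite ipC ip0l. Qed.
Lemma ipNl x z : ip (- x) z = - ip x z.
Proof. by rewrite -scaleN1r ipZl mulN1r. Qed.
Lemma ipNr x z : ip z (- x) = - ip z x.
Proof. by rewrite ipC ipNl ipC. Qed.
Lemma ipBl x y z : ip (x - y) z = ip x z - ip y z.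
Proof. by rewrite ipDl ipNl. Qed.
Lemma ipBr x y z : ip z (x - y) = ip z x - ip z y.
Proof. by rewrite ipDr ipNr. Qed.

Lemma ip_suml (I : Type) (s : seq I) (Q : pred I) (f : I -> H) z :
  ip (\sum_(i <- s | Q i) f i) z = \sum_(i <- s | Q i) ip (f i) z.
Proof.
apply: (big_morph (fun x => ip x z)); [by move=> x y; rewrite ipDl | exact: ip0l].
Qed.

Lemma ip_sumr (I : Type) (s : seq I) (Q : pred I) (f : I -> H) z :
  ip z (\sum_(i <- s | Q i) f i) = \sum_(i <- s | Q i) ip z (f i).
Proof. by rewrite ipC ip_suml; apply: eq_bigr => i _; exact: ipC. Qed.

Lemma ip_ge0 x : 0 <= ip x x.
Proof. by rewrite ip_norm sqr_ge0. Qed.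

Lemma ip_eq0 x : ip x x = 0 -> x = 0.
Proof. by rewrite ip_norm => /eqP; rewrite sqrf_eq0 normr_eq0 => /eqP. Qed.

Lemma bilinear_CS (q : H -> H -> R) :
  (forall x y z, q (x + y) z = q x z + q y z) -> (forall a x z, q (a *: x) z = a * q x z) ->
  (forall x y, q x y = q y x) -> (forall x, 0 <= q x x) ->
  forall x y, q x y ^+ 2 <= q x x * q y y.
Proof.
move=> qD qZ qC q0 x y.
have h a b : 0 <= a ^+ 2 * q x x + 2 * a * b * q x y + b ^+ 2 * q y y.
  have := q0 (a *: x + b *: y).
  rewrite qD !qZ ![q _ (_ + _)]qC !qD !qZ (qC y x).
  by congr (_ <= _); ring.
have [v0|vn] := eqVneq (q y y) 0.
  have [->|un] := eqVneq (q x y) 0.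
    by rewrite expr0n/= mulr_ge0.
  have := h 1 (- (q x x + 1) / (2 * q x y)).
  rewrite v0 mulr0 addr0.
  have -> : 1 ^+ 2 * q x x + 2 * 1 * (- (q x x + 1) / (2 * q x y)) * q x y
    = -1 by field.
  by rewrite oppr_ge0 ler10.
have vp : 0 < q y y by rewrite lt0r vn q0.
have := h (q y y) (- q x y).
have -> : q y y ^+ 2 * q x x + 2 * q y y * - q x y * q x y +
  (- q x y) ^+ 2 * q y y = q y y * (q x x * q y y - q x y ^+ 2) by ring.
by rewrite pmulr_rge0// subr_ge0.
Qed.

Lemma ip_CS x y : ip x y ^+ 2 <= ip x x * ip y y.
Proof.
apply: (bilinear_CS (q := fun x y => ip x y)); [exact: ipDl | exact: ipZl | exact: ipC | exact: ip_ge0].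
Qed.

Lemma ip_le_norm x y : `|ip x y| <= `|x| * `|y|.
Proof.
rewrite -(@ler_pXn2r _ 2) ?nnegrE ?mulr_ge0// real_normK ?num_real// exprMn -!ip_norm.
exact: ip_CS.
Qed.

Lemma cvg_ip (T : Type) (F : set_system T) {FF : Filter F} (f : T -> H) (l z : H) :
  f @ F --> l -> (fun t => ip z (f t)) @ F --> ip z l.
Proof.
move=> fl; apply/cvgrPdist_le => e e0.
have k0 : 0 < e / (`|z| + 1) by rewrite divr_gt0// ltr_wpDl.
move/cvgrPdist_le : fl => /(_ _ k0); apply: filterS => t h.
rewrite -ipBr; apply: le_trans (ip_le_norm _ _) _.
apply: (@le_trans _ _ (`|z| * (e / (`|z| + 1)))); first exact: ler_wpM2l.
rewrite mulrA ler_pdivrMr; last by rewrite ltr_wpDl.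
by rewrite mulrC ler_pM2l// lerDl.
Qed.

Lemma cvg_ip_lim u (l z : H) :
  u n @[n --> \oo] --> l -> (fun n => ip z (u n)) @ \oo --> ip z l.
Proof. exact: cvg_ip. Qed.

Lemma cvg_ip_norm u (l : H) :
  u n @[n --> \oo] --> l -> (fun n => ip (u n) (u n)) @ \oo --> ip l l.
Proof.
move=> ul; have h : `|u n| @[n --> \oo] --> `|l| by exact: cvg_norm.
have -> : (fun n => ip (u n) (u n)) = (fun n => `|u n| * `|u n|).
  by apply/funext => n; rewrite ip_norm expr2.
by rewrite ip_norm expr2; apply: cvgM; exact: h.
Qed.

Lemma ip_inj x y : (forall z, ip z x = ip z y) -> x = y.
Proof.
move=> h; apply/eqP; rewrite -subr_eq0; apply/eqP/ip_eq0.
by rewrite [LHS]ipBr h subrr.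
Qed.

(* The zero vectors make finite-dimensional spaces fit sequences indexed by [nat]. *)
Definition orthosys (e : nat -> H) :=
  (forall i j, i != j -> ip (e i) (e j) = 0) /\
  (forall i, ip (e i) (e i) = 1 \/ e i = 0).

Section Ortho.
Variable e : nat -> H.
Hypothesis oe : orthosys e.

Lemma orthosys_ip01 i : 0 <= ip (e i) (e i) <= 1.
Proof. by have [_ /(_ i)[->|->]] := oe; rewrite ?ip0l ?ler01 ?lexx. Qed.

Lemma orthosys_coef i z : ip (e i) (e i) * ip (e i) z = ip (e i) z.
Proof. by have [_ /(_ i)[->|->]] := oe; rewrite ?mul1r// !ip0l mulr0. Qed.

Lemma ip_orthosum (a : nat -> R) n m k : (k < n.+1)%N ->
  ip (e k) (\sum_(m <= i < n.+1) a i *: e i) = (m <= k)%:R * (a k * ip (e k) (e k)).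
Proof.
move=> kn; rewrite ip_sumr.
have [mk|mk] := leqP m k.
  rewrite mul1r (bigD1_seq k)/= ?iota_uniq ?mem_index_iota ?mk//.
  rewrite ipZr big1 ?addr0// => i ik; rewrite ipZr.
  by have [h _] := oe; rewrite h ?mulr0// eq_sym.
rewrite mul0r big_nat big1// => i /andP[mi _]; rewrite ipZr.
by have [h _] := oe; rewrite h ?mulr0// neq_ltn (leq_trans mk mi).
Qed.

Lemma norm_orthosum (a : nat -> R) m n :
  ip (\sum_(m <= i < n) a i *: e i) (\sum_(m <= i < n) a i *: e i) =
  \sum_(m <= i < n) a i ^+ 2 * ip (e i) (e i).
Proof.
case: n => [|n]; first by rewrite !big_geq// ip0l.
rewrite {1}ip_suml; apply: eq_big_nat => i /andP[mi ik].
rewrite ipZl ip_orthosum// mi mul1r expr2; ring.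
Qed.

Lemma bessel x n : \sum_(0 <= i < n) ip (e i) x ^+ 2 <= ip x x.
Proof.
pose p := \sum_(0 <= i < n) ip (e i) x *: e i.
have pp : ip p p = \sum_(0 <= i < n) ip (e i) x ^+ 2.
  rewrite norm_orthosum; apply: eq_bigr => i _.
  by rewrite expr2 -mulrA [_ * ip (e i) (e i)]mulrC orthosys_coef.
have px : ip p x = \sum_(0 <= i < n) ip (e i) x ^+ 2.
  by rewrite ip_suml; apply: eq_bigr => i _; rewrite ipZl expr2.
have := ip_ge0 (x - p); rewrite ipBl !ipBr pp [ip x p]ipC px subrr subr0.
by rewrite subr_ge0.
Qed.

(** By Pythagoras, the Cauchy criterion for the numerical series of [a i ^+ 2] is one for the
    vectors. *)
Lemma cvg_orthoseries (a : nat -> R) (K : R) :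
  (forall n, \sum_(0 <= i < n) a i ^+ 2 <= K) ->
  cvgn (series (fun i => a i *: e i)).
Proof.
move=> aK.
have ca : cvgn (series (fun i => a i ^+ 2)).
  apply: nondecreasing_is_cvgn.
    by apply/nondecreasing_seqP => n; rewrite /series/= big_nat_recr//= lerDl sqr_ge0.
  by exists K => _ [n _ <-]; exact: aK.
apply/cauchy_cvgP/cauchy_seriesP => eps eps0.
have e2 : 0 < eps ^+ 2 by exact: exprn_gt0.
move/cauchy_cvgP/cauchy_seriesP : ca => /(_ _ e2); apply: filterS => -[m n] /= h.
rewrite -(@ltr_pXn2r _ 2) ?nnegrE ?(ltW eps0)// -ip_norm norm_orthosum.
apply: le_lt_trans h; apply: le_trans (ler_norm _).
apply: ler_sum => i _; rewrite -[leRHS]mulr1; apply: ler_wpM2l; first exact: sqr_ge0.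
by have /andP[] := orthosys_ip01 i.
Qed.

Definition osum (a : nat -> R) : H := limn (series (fun i => a i *: e i)).

Lemma osum_cvg (a : nat -> R) K : (forall n, \sum_(0 <= i < n) a i ^+ 2 <= K) ->
  \sum_(0 <= i < n) a i *: e i @[n --> \oo] --> osum a.
Proof. by move/cvg_orthoseries. Qed.

Lemma ip_osum (a : nat -> R) K j : (forall n, \sum_(0 <= i < n) a i ^+ 2 <= K) ->
  ip (e j) (osum a) = a j * ip (e j) (e j).
Proof.
move=> aK; have h := cvg_ip_lim (z := e j) (osum_cvg aK).
have h2 : (fun n => ip (e j) (\sum_(0 <= i < n) a i *: e i)) @ \oo --> a j * ip (e j) (e j).
  apply: cvg_near_cst; exists j.+1 => // n /= jn.
  by case: n jn => // n jn; rewrite ip_orthosum// mul1r.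
exact: (cvg_unique _ h h2).
Qed.

Lemma osum_norm (a : nat -> R) K : (forall n, \sum_(0 <= i < n) a i ^+ 2 <= K) ->
  ip (osum a) (osum a) <= K.
Proof.
move=> aK; have h := cvg_ip_norm (osum_cvg aK).
rewrite -(cvg_lim _ h)//; apply: limr_le; first exact: cvgP h.
apply: nearW => n; rewrite norm_orthosum; apply: le_trans (aK n).
apply: ler_sum => i _; rewrite -[leRHS]mulr1; apply: ler_wpM2l; first exact: sqr_ge0.
by have /andP[] := orthosys_ip01 i.
Qed.

Definition complete_sys := forall x, (forall i, ip (e i) x = 0) -> x = 0.

Lemma basis_expansion x : complete_sys ->
  \sum_(0 <= i < n) ip (e i) x *: e i @[n --> \oo] --> x.
Proof.
move=> ce; have b := @bessel x; have h := osum_cvg b.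
suff e1 : osum (fun i => ip (e i) x) = x by rewrite e1 in h.
apply/eqP; rewrite -subr_eq0; apply/eqP/ce => i.
by rewrite ipBr (ip_osum _ b) mulrC orthosys_coef subrr.
Qed.

End Ortho.
End Hilbert.

Section GramSchmidt.
Variables (R : realType) (H : completeNormedModType R) (ip : {dot H for idfun}).
Hypothesis ip_norm : induces_norm ip.

(** If [x != 0] is orthogonal to a dense set, a point [y] of it with [|x - y| < |x|] gives the
    contradiction [|x|^2 = <x - y, x> < |x|^2]. Indices that enumerate no point receive the vector
    0, which imposes no condition. *)
Lemma separable_sequence : separable_space H ->
  exists d : nat -> H, forall x, (forall n, ip (d n) x = 0) -> x = 0.
Proof.
move=> [D /countable_injP[g gi] dD].
exists (fun n => xget 0 [set x | D x /\ g x = n]) => x hx.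
have hD y : D y -> ip y x = 0.
  move=> Dy; rewrite -(hx (g y)); congr (ip _ x).
  case: xgetP => [z _ [Dz gz]|/(_ y)]; last by case.
  by apply: gi => //; rewrite inE.
have [->//|x0] := eqVneq x 0.
have nx : 0 < `|x| by rewrite normr_gt0.
have [y [xy Dy]] : ball x `|x| `&` D !=set0.
  apply: dD; last exact: ball_open.
  by exists x; exact: ballxx.
move: xy; rewrite -ball_normE/= => xy.
have : ip x x <= `|x - y| * `|x|.
  apply: le_trans (ip_le_norm ip_norm (x - y) x).
  by rewrite ipBl (hD _ Dy) subr0 ler_norm.
rewrite ip_norm expr2 => h; exfalso; move: h; apply/negP; rewrite -ltNge.
by rewrite ltr_pM2r.
Qed.

(** Fixes 0, so a vector that depends linearly on its predecessors yields a zero vector, as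
    [orthosys] allows. *)
Definition normalize (v : H) : H := `|v|^-1 *: v.

Variable d : nat -> H.

(** Each vector depends on all earlier ones, so the recursion carries the table of the first [n]
    vectors, padded with zeros. *)
Fixpoint gs (n : nat) : nat -> H := if n is m.+1 then
  fun k => if k == m then normalize (d m - \sum_(0 <= i < m) ip (gs m i) (d m) *: gs m i) else gs m k
  else fun=> 0.

Definition gram_schmidt n := gs n.+1 n.
Local Notation e := gram_schmidt.

Lemma gsE m k : (k < m)%N -> gs m k = e k.
Proof.
elim: m => // m IH; rewrite ltnS leq_eqVlt => /orP[/eqP ->//|km] /=.
by rewrite ltn_eqF// IH.
Qed.

Let v n := d n - \sum_(0 <= i < n) ip (e i) (d n) *: e i.

Lemma gram_schmidtE n : e n = normalize (v n).
Proof.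
rewrite /gram_schmidt /= eqxx; congr (normalize (_ - _)).
by apply: eq_big_nat => i /andP[_ im]; rewrite gsE.
Qed.

Lemma gram_schmidt_unit i : ip (e i) (e i) = 1 \/ e i = 0.
Proof.
rewrite gram_schmidtE /normalize; have [->|v0] := eqVneq (v i) 0; first by right; rewrite scaler0.
left; rewrite ip_norm normrZ normfV normr_id mulVf ?expr1n//.
by rewrite normr_eq0.
Qed.

Lemma gram_schmidt_orthosys : orthosys ip e.
Proof.
split; last exact: gram_schmidt_unit.
suff h n i : (i < n)%N -> ip (e i) (e n) = 0.
  move=> i j; rewrite neq_ltn => /orP[/h//|/h]; by rewrite ipC.
elim/ltn_ind: n i => n IH i im.
rewrite (gram_schmidtE n) /normalize ipZr; apply/eqP; rewrite mulf_eq0; apply/orP; right.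
rewrite /v ipBr ip_sumr (bigD1_seq i)/= ?iota_uniq ?mem_index_iota//.
rewrite big_nat_cond big1; last first.
  move=> k /andP[/andP[_ kn] ki]; rewrite ipZr.
  move: ki; rewrite neq_ltn => /orP[ki|ik]; last by rewrite IH// mulr0.
  by rewrite [ip (e i) (e k)]ipC IH// mulr0.
rewrite addr0 ipZr subr_eq0; apply/eqP.
by have [->|->] := gram_schmidt_unit i; rewrite ?mulr1// !ip0l mul0r.
Qed.

Lemma gram_schmidt_complete :
  (forall x, (forall n, ip (d n) x = 0) -> x = 0) -> complete_sys ip e.
Proof.
move=> hd x ex; apply: hd => n.
have vx : ip (v n) x = 0.
  have [->|v0] := eqVneq (v n) 0; first by rewrite ip0l.
  have := ex n; rewrite gram_schmidtE /normalize ipZl => /eqP.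
  by rewrite mulf_eq0 invr_eq0 normr_eq0 (negbTE v0)/= => /eqP.
have -> : d n = v n + \sum_(0 <= i < n) ip (e i) (d n) *: e i by rewrite subrK.
rewrite ipDl vx add0r ip_suml big1// => i _.
by rewrite ipZl ex mulr0.
Qed.

End GramSchmidt.

Lemma exists_basis (R : realType) (H : completeNormedModType R) (ip : {dot H for idfun}) :
  induces_norm ip -> separable_space H ->
  exists e : nat -> H, orthosys ip e /\ complete_sys ip e.
Proof.
move=> ip_norm /(separable_sequence ip_norm)[d hd].
exists (gram_schmidt ip d); split; first exact: gram_schmidt_orthosys.
exact: gram_schmidt_complete.
Qed.

Lemma fmap_ultra (T U : Type) (f : T -> U) (F : set_system T) :
  UltraFilter F -> UltraFilter (f @ F).
Proof.
move=> UF; split; first exact: fmap_proper_filter.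
move=> G FG sub; apply/seteqP; split => A; last exact: sub.
move=> GA; have [//|h] := in_ultra_setVsetC (f @^-1` A) UF.
have GC : G (~` A) by exact: (sub _ h).
have : G (A `&` ~` A) by exact: filterI.
by rewrite setICr => /(@filter_ex _ _ FG)[].
Qed.

(** Along one ultrafilter all coordinates of a bounded sequence converge at once, which takes the
    place of a diagonal extraction. *)
Lemma ultra_bounded_cvg (R : realType) (T : Type) (F : set_system T) (u : T -> R) (K : R) :
  UltraFilter F -> (forall n, `|u n| <= K) -> exists p : R, u n @[n --> F] --> p.
Proof.
move=> UF uK; have := @segment_compact R (- K) K; rewrite compact_ultra.
move=> /(_ (u @ F) (fmap_ultra u UF)) [].
  apply: (@filterE _ F) => n; rewrite /= in_itv/=; have := uK n; rewrite ler_norml.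
  by move=> /andP[? ?]; apply/andP; split.
by move=> p [_ h]; exists p.
Qed.

Lemma sum_CS (R : realType) (a b : nat -> R) m n :
  (\sum_(m <= i < n) a i * b i) ^+ 2 <= (\sum_(m <= i < n) a i ^+ 2) * \sum_(m <= i < n) b i ^+ 2.
Proof.
have [nm|mn] := leqP n m; first by rewrite !big_geq// expr0n/= mul0r.
set A := \sum_(m <= i < n) a i ^+ 2; set B := \sum_(m <= i < n) b i ^+ 2.
set C := \sum_(m <= i < n) a i * b i.
have h (x y : R) : 0 <= x ^+ 2 * A + 2 * x * y * C + y ^+ 2 * B.
  have -> : x ^+ 2 * A + 2 * x * y * C + y ^+ 2 * B = \sum_(m <= i < n) (x * a i + y * b i) ^+ 2.
    rewrite /A /B /C !mulr_sumr -!big_split/=; apply: eq_bigr => i _; ring.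
  by apply: sumr_ge0 => i _; exact: sqr_ge0.
have A0 : 0 <= A by apply: sumr_ge0 => i _; exact: sqr_ge0.
have B0 : 0 <= B by apply: sumr_ge0 => i _; exact: sqr_ge0.
have [v0|vn] := eqVneq B 0.
  have [->|un] := eqVneq C 0; first by rewrite expr0n/= mulr_ge0.
  have := h 1 (- (A + 1) / (2 * C)); rewrite v0 mulr0 addr0.
  have -> : 1 ^+ 2 * A + 2 * 1 * (- (A + 1) / (2 * C)) * C = -1 by field.
  by rewrite oppr_ge0 ler10.
have vp : 0 < B by rewrite lt0r vn.
have := h B (- C).
have -> : B ^+ 2 * A + 2 * B * - C * C + (- C) ^+ 2 * B = B * (A * B - C ^+ 2) by ring.
by rewrite pmulr_rge0// subr_ge0.
Qed.

(** * Existence of a top eigenvector *)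

Section Spectral.
Variables (R : realType) (H : completeNormedModType R) (ip : {dot H for idfun}).
Hypothesis ip_norm : induces_norm ip.
Variable e : nat -> H.
Hypothesis oe : orthosys ip e.
Hypothesis ce : complete_sys ip e.
Implicit Types (x y z : H) (V : H -> H).

Lemma cvg_ip2 (T : Type) (F : set_system T) {FF : Filter F} (f g : T -> H) (l m : H) :
  f @ F --> l -> g @ F --> m -> (fun t => ip (f t) (g t)) @ F --> ip l m.
Proof.
have pol x y : ip x y = (`|x + y| * `|x + y| - `|x - y| * `|x - y|) / 4.
  by rewrite -!expr2 -!ip_norm !ipDl !ipDr !ipNl !ipNr [ip y x]ipC; field.
move=> fl gm; rewrite pol.
have -> : (fun t => ip (f t) (g t)) = (fun t => (`|f t + g t| * `|f t + g t| - `|f t - g t| * `|f t - g t|) / 4).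
  by apply/funext => t; rewrite pol.
apply: cvgM; last exact: cvg_cst.
have h1 : `|f t + g t| @[t --> F] --> `|l + m| by apply: cvg_norm; exact: cvgD.
have h2 : `|f t - g t| @[t --> F] --> `|l - m| by apply: cvg_norm; exact: cvgB.
by apply: cvgB; apply: cvgM.
Qed.

Section PositiveOp.
Variable V : H -> H.
Hypothesis pV : positive_op ip V.

Lemma pop_lin a x y : V (a *: x + y) = a *: V x + V y. Proof. by have [h _ _ _] := pV; exact: h. Qed.
Lemma popD x y : V (x + y) = V x + V y.
Proof. by rewrite -[x]scale1r pop_lin !scale1r. Qed.
Lemma pop0 : V 0 = 0.
Proof. by apply: (addrI (V 0)); rewrite -popD !addr0. Qed.
Lemma popZ a x : V (a *: x) = a *: V x.
Proof. by rewrite -[a *: x]addr0 pop_lin pop0 addr0. Qed.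
Lemma pop_sym x y : ip (V x) y = ip x (V y). Proof. by have [_ _ h _] := pV. Qed.
Lemma pop_ge0 x : 0 <= ip x (V x). Proof. by have [_ _ _ h] := pV. Qed.
Lemma pop_sum (I : Type) (s : seq I) (Q : pred I) (f : I -> H) :
  V (\sum_(i <- s | Q i) f i) = \sum_(i <- s | Q i) V (f i).
Proof. by apply: (big_morph V popD pop0). Qed.

Lemma pop_cvg (T : Type) (F : set_system T) {FF : Filter F} (f : T -> H) l :
  f @ F --> l -> (fun t => V (f t)) @ F --> V l.
Proof.
have [_ cV _ _] := pV => fl.
exact: (@cvg_comp _ _ _ f V F (nbhs l) (nbhs (V l)) fl (cV l)).
Qed.

Lemma pop_CS x y : ip x (V y) ^+ 2 <= ip x (V x) * ip y (V y).
Proof.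
apply: (bilinear_CS (q := fun x y => ip x (V y))).
- by move=> *; rewrite ipDl.
- by move=> *; rewrite ipZl.
- by move=> u v; rewrite ipC pop_sym.
- exact: pop_ge0.
Qed.

(** Expand [<eta x - y, V (eta x - y)> >= 0]. It isolates a small part [y] at the price of a factor
    [1 + eta]. *)
Lemma pop_quadD (eta : R) x y : 0 < eta ->
  ip (x + y) (V (x + y)) <= (1 + eta) * ip x (V x) + (1 + eta^-1) * ip y (V y).
Proof.
move=> eta0; rewrite popD !ipDl !ipDr [ip y (V x)]ipC pop_sym.
have := pop_ge0 (eta *: x - y); rewrite -scaleN1r popD !popZ.
rewrite !ipDl !ipDr !ipZl !ipZr [ip y (V x)]ipC pop_sym => h.
have : 0 <= eta^-1 * (eta * (eta * ip x (V x)) + -1 * (eta * ip x (V y)) +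
      (eta * (-1 * ip x (V y)) + -1 * (-1 * ip y (V y)))).
  by apply: mulr_ge0; [rewrite invr_ge0 ltW | move: h; lra].
have -> : eta^-1 * (eta * (eta * ip x (V x)) + -1 * (eta * ip x (V y)) +
   (eta * (-1 * ip x (V y)) + -1 * (-1 * ip y (V y)))) =
   eta * ip x (V x) - 2 * ip x (V y) + eta^-1 * ip y (V y) by field; rewrite gt_eqF.
lra.
Qed.

(** For [q = <s, V s>], Cauchy-Schwarz first for the sum and then for the form of [V] gives
    [q^2 <= A q B]. *)
Lemma pop_orthosum (a : nat -> R) m n :
  ip (\sum_(m <= i < n) a i *: e i) (V (\sum_(m <= i < n) a i *: e i)) <=
  (\sum_(m <= i < n) a i ^+ 2) * \sum_(m <= i < n) ip (e i) (V (e i)).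
Proof.
set s := \sum_(m <= i < n) a i *: e i; set q := ip s (V s).
have qE : q = \sum_(m <= i < n) a i * ip s (V (e i)).
  rewrite /q {2}/s pop_sum ip_sumr; apply: eq_bigr => i _.
  by rewrite popZ ipZr.
have q0 : 0 <= q by exact: pop_ge0.
set A := \sum_(m <= i < n) a i ^+ 2; set B := \sum_(m <= i < n) ip (e i) (V (e i)).
have A0 : 0 <= A by apply: sumr_ge0 => i _; exact: sqr_ge0.
have h : q ^+ 2 <= A * (q * B).
  rewrite {1}qE; apply: le_trans (sum_CS _ _ _ _) _.
  apply: ler_wpM2l => //; rewrite /B mulr_sumr; apply: ler_sum => i _.
  exact: pop_CS.
have [->|qn] := eqVneq q 0.
  by apply: mulr_ge0 => //; apply: sumr_ge0 => i _; exact: pop_ge0.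
have qp : 0 < q by rewrite lt0r qn.
by rewrite -(ler_pM2r qp) -expr2; apply: le_trans h _; rewrite mulrCA mulrC.
Qed.

Section TraceClass.
Variable K : R.
Hypothesis trK : forall n, \sum_(0 <= i < n) ip (e i) (V (e i)) <= K.

Let tr_cvg : cvgn (fun n => \sum_(0 <= i < n) ip (e i) (V (e i))).
Proof.
apply: nondecreasing_is_cvgn.
  by apply/nondecreasing_seqP => n; rewrite big_nat_recr//= lerDl pop_ge0.
by exists K => _ [n _ <-].
Qed.

Let tail N := limn (fun n => \sum_(0 <= i < n) ip (e i) (V (e i))) -
  \sum_(0 <= i < N) ip (e i) (V (e i)).

Let tail_ge N n : \sum_(N <= i < n) ip (e i) (V (e i)) <= tail N.
Proof.
have [nN|Nn] := leqP n N.
  rewrite big_geq// /tail subr_ge0; apply: nondecreasing_cvgn_le => //.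
  by apply/nondecreasing_seqP => k; rewrite big_nat_recr//= lerDl pop_ge0.
rewrite /tail lerBrDr addrC -big_cat_nat//=; last exact: ltnW.
apply: nondecreasing_cvgn_le => //.
by apply/nondecreasing_seqP => k; rewrite big_nat_recr//= lerDl pop_ge0.
Qed.

Let tail_cvg0 : tail N @[N --> \oo] --> (0 : R).
Proof.
rewrite -(subrr (limn (fun n => \sum_(0 <= i < n) ip (e i) (V (e i))))).
by apply: cvgB; [exact: cvg_cst | exact: tr_cvg].
Qed.

Let proj N x := \sum_(0 <= i < N) ip (e i) x *: e i.

Let proj_cvg x : proj N x @[N --> \oo] --> x.
Proof. exact: basis_expansion. Qed.

(** The bound is uniform on balls. It is the compactness that a finite trace provides: only finitely
    many coordinates matter for the quadratic form. *)
Let quad_tail N x : ip (x - proj N x) (V (x - proj N x)) <= ip x x * tail N.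
Proof.
have h : (fun n => proj n x - proj N x) @ \oo --> x - proj N x.
  by apply: cvgB; [exact: proj_cvg | exact: cvg_cst].
have hq : ip (proj n x - proj N x) (V (proj n x - proj N x)) @[n --> \oo] -->
   ip (x - proj N x) (V (x - proj N x)) by apply: cvg_ip2 => //; exact: pop_cvg.
rewrite -(cvg_lim _ hq)//; apply: limr_le; first exact: cvgP hq.
exists N => // n /= Nn.
have -> : proj n x - proj N x = \sum_(N <= i < n) ip (e i) x *: e i.
  by apply/eqP; rewrite /proj subr_eq addrC -big_cat_nat.
apply: le_trans (pop_orthosum _ _ _) _.
apply: ler_pM.
- by apply: sumr_ge0 => i _; exact: sqr_ge0.
- by apply: sumr_ge0 => i _; exact: pop_ge0.
- apply: le_trans (bessel ip_norm oe x n).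
  rewrite (@big_cat_nat _ _ _ N 0 n)//= lerDr.
  by apply: sumr_ge0 => i _; exact: sqr_ge0.
exact: tail_ge.
Qed.

Let quad_bound x : ip x (V x) <= ip x x * tail 0.
Proof. by have := quad_tail 0 x; rewrite /proj big_geq// subr0. Qed.

Let ball1 := [set x : H | ip x x <= 1].
Let mu := sup [set ip x (V x) | x in ball1].

Let hs : has_sup [set ip x (V x) | x in ball1].
Proof.
split; first by exists (ip 0 (V 0)), 0 => //; rewrite /ball1/= ip0l.
exists (tail 0) => _ [x /= x1 <-]; apply: le_trans (quad_bound x) _.
rewrite -[leRHS]mul1r; apply: ler_wpM2r => //.
by apply: le_trans (tail_ge 0 0); rewrite big_geq.
Qed.

Let mu_ball x : ip x x <= 1 -> ip x (V x) <= mu.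
Proof. by move=> x1; apply: sup_upper_bound => //; exists x. Qed.

Let mu_ge0 : 0 <= mu.
Proof. by rewrite -(ip0l ip (V 0)); apply: mu_ball; rewrite ip0l. Qed.

Let mu_quad x : ip x (V x) <= mu * ip x x.
Proof.
have [->|x0] := eqVneq x 0; first by rewrite !ip0l mulr0.
have nx : 0 < `|x| by rewrite normr_gt0.
have := @mu_ball (`|x|^-1 *: x); rewrite popZ !ipZl !ipZr => h.
rewrite -ler_pdivrMr; last by rewrite ip_norm exprn_gt0.
move: h; rewrite !mulrA -invfM -expr2 ip_norm mulVf ?lexx; last by rewrite expf_neq0// gt_eqF.
by move=> /(_ isT); rewrite mulrC.
Qed.

(** The maximizer [xs] is the weak limit of a maximizing sequence along an ultrafilter. The first
    [N] coordinates converge in norm and the others are controlled by [tail N]; then [N] tends to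
    infinity and [eta] to 0. *)
Let mu_attained : exists2 x, ip x x <= 1 & mu <= ip x (V x).
Proof.
have /choice[x hx] : forall n : nat, exists x, ip x x <= 1 /\ mu - n.+1%:R^-1 < ip x (V x).
  move=> n; have n0 : 0 < n.+1%:R^-1 :> R by rewrite invr_gt0.
  by have [_ [x x1 <-] h] := sup_adherent n0 hs; exists x.
have [U [UU sub]] := ultraFilterLemma (F := \oo).
have x1 n : ip (x n) (x n) <= 1 by have [] := hx n.
have /choice[a ha] : forall j, exists p : R, ip (e j) (x n) @[n --> U] --> p.
  move=> j; apply: (@ultra_bounded_cvg _ _ _ _ 1) => n.
  rewrite -(@ler_pXn2r _ 2) ?nnegrE// expr1n real_normK ?num_real//.
  apply: le_trans (x1 n); apply: le_trans (bessel ip_norm oe (x n) j.+1).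
  rewrite big_nat_recr//= lerDr.
  by apply: sumr_ge0 => i _; exact: sqr_ge0.
have a1 N : \sum_(0 <= i < N) a i ^+ 2 <= 1.
  have h : \sum_(0 <= i < N) ip (e i) (x n) ^+ 2 @[n --> U] --> \sum_(0 <= i < N) a i ^+ 2.
    elim: N => [|N IH].
      rewrite big_geq//; under eq_fun do rewrite big_geq//; exact: cvg_cst.
    rewrite big_nat_recr//=; under eq_fun do rewrite big_nat_recr//=.
    by apply: cvgD => //; rewrite expr2; under eq_fun do rewrite expr2; apply: cvgM.
  rewrite -(cvg_lim _ h)//; apply: limr_le; first exact: cvgP h.
  by apply: nearW => n; apply: le_trans (x1 n); exact: bessel.
pose s N := \sum_(0 <= i < N) a i *: e i.
have sU N : proj N (x n) @[n --> U] --> s N.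
  rewrite /proj /s; elim: N => [|N IH].
    rewrite big_geq//; under eq_fun do rewrite big_geq//; exact: cvg_cst.
  rewrite big_nat_recr//=; under eq_fun do rewrite big_nat_recr//=.
  by apply: cvgD => //; apply: cvgZl.
pose xs := osum e a.
have sxs : s N @[N --> \oo] --> xs by exact: (osum_cvg ip_norm oe a1).
exists xs; first exact: (osum_norm ip_norm oe a1).
have t0 N : 0 <= tail N by apply: le_trans (tail_ge N N); rewrite big_geq.
have key (eta : R) : 0 < eta -> mu <= (1 + eta) * ip xs (V xs).
  move=> eta0; have eV : 0 < eta^-1 by rewrite invr_gt0.
  have kN N : mu <= (1 + eta) * ip (s N) (V (s N)) + (1 + eta^-1) * tail N.
    have l1 : mu - n.+1%:R^-1 @[n --> U] --> mu - 0.
      apply: cvgB; first exact: cvg_cst.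
      by move=> A /(@cvg_harmonic R) hA; exact: (sub _ hA).
    have l2 : (1 + eta) * ip (proj N (x n)) (V (proj N (x n))) + (1 + eta^-1) * tail N @[n --> U]
        --> (1 + eta) * ip (s N) (V (s N)) + (1 + eta^-1) * tail N.
      apply: cvgD; last exact: cvg_cst.
      apply: cvgM; first exact: cvg_cst.
      by apply: cvg_ip2 => //; exact: pop_cvg.
    rewrite subr0 in l1; rewrite -(cvg_lim _ l1)// -(cvg_lim _ l2)//.
    apply: ler_lim; [exact: cvgP l1 | exact: cvgP l2 |].
    apply: nearW => n; have [_ /ltW h] := hx n; apply: le_trans h _.
    have {1 2}-> : x n = proj N (x n) + (x n - proj N (x n)) by rewrite addrC subrK.
    apply: le_trans (pop_quadD _ _ eta0) _; rewrite lerD2l.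
    apply: ler_wpM2l; first by lra.
    apply: le_trans (quad_tail N (x n)) _.
    by rewrite -[leRHS]mul1r; apply: ler_wpM2r.
  have l : (1 + eta) * ip (s N) (V (s N)) + (1 + eta^-1) * tail N @[N --> \oo] -->
      (1 + eta) * ip xs (V xs) + (1 + eta^-1) * 0.
    apply: cvgD.
      apply: cvgM; first exact: cvg_cst.
      by apply: cvg_ip2 => //; exact: pop_cvg.
    by apply: cvgM => //; exact: cvg_cst.
  rewrite mulr0 addr0 in l; rewrite -(cvg_lim _ l)//; apply: limr_ge; first exact: cvgP l.
  exact: nearW.
apply/ler_addgt0Pr => eps eps0.
have q0 := pop_ge0 xs.
have d0 : 0 < ip xs (V xs) + 1 by lra.
apply: le_trans (key (eps / (ip xs (V xs) + 1)) _) _; first exact: divr_gt0.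
rewrite mulrDl mul1r lerD2l mulrAC ler_pdivrMr//.
by apply: ler_wpM2l; [exact: ltW | lra].
Qed.

(** The form of [mu - V] is positive and vanishes at the maximizer, which by Cauchy-Schwarz lies in
    its kernel. When [mu = 0] the pair [0, 0] is returned as padding. *)
Lemma top_eigen : exists (m : R) (f : H),
  [/\ 0 <= m, V f = m *: f, forall x, ip x (V x) <= m * ip x x
   & (0 < m /\ ip f f = 1) \/ (f = 0 /\ m = 0)].
Proof.
have [mu0|mun] := eqVneq mu 0.
  exists 0, 0; rewrite pop0 scaler0; split => //; last by right.
  by move=> x; rewrite mul0r -[leRHS](mul0r (ip x x)) -mu0; exact: mu_quad.
have mup : 0 < mu by rewrite lt0r mun.
have [x x1 hx] := mu_attained.
have xx1 : ip x x = 1.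
  apply/eqP; rewrite eq_le x1/= -(ler_pM2l mup) mulr1; apply: le_trans hx _.
  exact: mu_quad.
exists mu, x; split => //; last by left; split.
apply: (ip_inj ip_norm) => z; apply/eqP; rewrite -subr_eq0 -sqrf_eq0 eq_le sqr_ge0 andbT.
have CS : (mu * ip z x - ip z (V x)) ^+ 2 <=
    (mu * ip z z - ip z (V z)) * (mu * ip x x - ip x (V x)).
  apply: (bilinear_CS (q := fun x y => mu * ip x y - ip x (V y))).
  - by move=> *; rewrite !ipDl; ring.
  - by move=> *; rewrite !ipZl; ring.
  - by move=> u v; rewrite ipC -pop_sym [ip (V u) v]ipC.
  - by move=> u; rewrite subr_ge0.
have e0 : mu * ip x x - ip x (V x) = 0.
  by apply/eqP; rewrite xx1 mulr1 subr_eq0 eq_le hx/=; apply: mu_ball.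
by rewrite e0 mulr0 in CS; rewrite ipZr -sqrrN opprB.
Qed.

End TraceClass.
End PositiveOp.

End Spectral.

(** * The spectral decomposition by deflation *)

Section Deflation.
Variables (R : realType) (H : completeNormedModType R) (ip : {dot H for idfun}).
Hypothesis ip_norm : induces_norm ip.
Variable e : nat -> H.
Hypothesis oe : orthosys ip e.
Hypothesis ce : complete_sys ip e.
Implicit Types (x y z : H) (V : H -> H).

Definition trace_bounded V := positive_op ip V /\
  exists K, forall n, \sum_(0 <= i < n) ip (e i) (V (e i)) <= K.

(** Positivity of the remainders is recorded because it makes determinants of truncations lower
    bounds for the full ones. The vectors [f k] may leave part of the kernel of [V] uncovered. *)
Definition spectral_data V (lam : nat -> R) (f : nat -> H) :=
  [/\ orthosys ip f, forall k, 0 <= lam k, forall k, V (f k) = lam k *: f k,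
      forall k, f k = 0 -> lam k = 0 & exists K, forall n, \sum_(0 <= k < n) lam k <= K] /\
  (forall n, positive_op ip (fun x => V x - \sum_(0 <= k < n) (lam k * ip (f k) x) *: f k)) /\
  (forall x, \sum_(0 <= k < n) (lam k * ip (f k) x) *: f k @[n --> \oo] --> V x).

Definition top_pair V (p : R * H) :=
  [/\ 0 <= p.1, V p.2 = p.1 *: p.2, forall x, ip x (V x) <= p.1 * ip x x
   & (0 < p.1 /\ ip p.2 p.2 = 1) \/ (p.2 = 0 /\ p.1 = 0)].

Definition top_eigenpair V : R * H := xget (0, 0) [set p | top_pair V p].

Lemma top_eigenpairP V : trace_bounded V -> top_pair V (top_eigenpair V).
Proof.
move=> [pV [K hK]]; have [m [f hf]] := top_eigen ip_norm oe ce pV hK.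
by rewrite /top_eigenpair; case: xgetP => [p -> //|/(_ (m, f))]; case.
Qed.

Definition deflate V : H -> H :=
  fun x => V x - ((top_eigenpair V).1 * ip (top_eigenpair V).2 x) *: (top_eigenpair V).2.

Lemma deflate_quad V x : positive_op ip V ->
  ip x (deflate V x) = ip x (V x) - (top_eigenpair V).1 * ip (top_eigenpair V).2 x ^+ 2.
Proof. by move=> pV; rewrite /deflate ipBr ipZr [ip x (top_eigenpair V).2]ipC; ring. Qed.

Lemma deflate_trace_bounded V : trace_bounded V -> trace_bounded (deflate V).
Proof.
move=> tV; have [m0 Vf hm f1] := top_eigenpairP tV; have [pV [K hK]] := tV.
split.
  split.
  - move=> a x y; rewrite /deflate (pop_lin pV) ipDr ipZr scalerBr !scalerA.
    rewrite mulrDr scalerDl opprD addrACA; congr (_ + _ + (_ - _)).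
    by congr (- (_ *: _)); ring.
  - move=> x; apply: cvgB; first by have [_ cV _ _] := pV; exact: cV.
    apply: cvgZl; apply: cvgM; first exact: cvg_cst.
    by apply: (@cvg_ip _ _ _ ip_norm) => //; exact: cvg_id.
  - by move=> x y; rewrite /deflate ipBl ipBr ipZl ipZr (pop_sym pV) [ip x (top_eigenpair V).2]ipC; ring.
  move=> x; rewrite deflate_quad//.
  case: f1 => [[_ f1]|[_ ->]]; last by rewrite mul0r subr0 pop_ge0.
  set f := (top_eigenpair V).2 in f1 Vf *; set m := (top_eigenpair V).1 in Vf *.
  (* The deflated form at [x] is the form of [V] at the component of [x] orthogonal to [f]. *)
  have := pop_ge0 pV (x - ip f x *: f).
  rewrite -scaleN1r scalerA (popD pV) (popZ pV) Vf !ipDl !ipDr !ipZl !ipZr f1.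
  rewrite -[ip f (V x)](pop_sym pV) Vf ipZl [ip x f]ipC.
  by congr (_ <= _); ring.
exists K => n; apply: le_trans (hK n); apply: ler_sum => i _.
by rewrite deflate_quad// gerBl mulr_ge0// sqr_ge0.
Qed.

Variable V : H -> H.
Hypothesis tV : trace_bounded V.

Let Vn n := iter n deflate V.
Let lam n := (top_eigenpair (Vn n)).1.
Let f n := (top_eigenpair (Vn n)).2.

Let tVn n : trace_bounded (Vn n).
Proof. by elim: n => // n IH; exact: deflate_trace_bounded. Qed.

Let pVn n : positive_op ip (Vn n). Proof. by have [] := tVn n. Qed.

Let lam0 n : 0 <= lam n. Proof. by have [] := top_eigenpairP (tVn n). Qed.

Let VnE n x : Vn n x = V x - \sum_(0 <= k < n) (lam k * ip (f k) x) *: f k.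
Proof.
elim: n x => [|n IH] x; first by rewrite big_geq// subr0.
by rewrite big_nat_recr//= opprD addrA -IH.
Qed.

Let Vnf n : Vn n (f n) = lam n *: f n. Proof. by have [] := top_eigenpairP (tVn n). Qed.

Let f1 n : (0 < lam n /\ ip (f n) (f n) = 1) \/ (f n = 0 /\ lam n = 0).
Proof. by have [] := top_eigenpairP (tVn n). Qed.

Let orth_of_kill n k : Vn n (f k) = 0 -> ip (f k) (f n) = 0.
Proof.
move=> h; case: (f1 n) => [[ln _]|[-> _]]; last by rewrite ip0r.
apply: (mulfI (lt0r_neq0 ln)).
by rewrite mulr0 -ipZr -Vnf -(pop_sym (pVn n)) h ip0l.
Qed.

(** Once split off, an eigenvector stays in the kernel; since [Vn n] is symmetric, it is then
    orthogonal to every later eigenvector with positive eigenvalue. *)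
Let Vn_kill n k : (k < n)%N -> Vn n (f k) = 0.
Proof.
elim: n k => // n IH k; rewrite ltnS leq_eqVlt => /orP[/eqP ->|kn].
  rewrite [LHS]/(deflate (Vn n) (f n)) /deflate -/(lam n) -/(f n) Vnf.
  case: (f1 n) => [[_ ->]|[-> _]]; last by rewrite !scaler0 subrr.
  by rewrite mulr1 subrr.
rewrite [LHS]/(deflate (Vn n) (f k)) /deflate -/(lam n) -/(f n) (IH _ kn).
by rewrite ipC (orth_of_kill (IH _ kn)) mulr0 scale0r subrr.
Qed.

Let f_orth : orthosys ip f.
Proof.
split; last by move=> i; case: (f1 i) => [[_ ->]|[-> _]]; [left | right].
move=> i j; rewrite neq_ltn => /orP[ij|ij].
  exact: orth_of_kill (Vn_kill ij).
by rewrite ipC; exact: orth_of_kill (Vn_kill ij).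
Qed.

Let V_f k : V (f k) = lam k *: f k.
Proof.
rewrite -Vnf VnE big_nat_cond big1 ?subr0// => i /andP[/andP[_ ik] _].
have [h _] := f_orth; rewrite h ?mulr0 ?scale0r//.
by rewrite neq_ltn ik.
Qed.

Let lam_quad n x : \sum_(0 <= k < n) lam k * ip (f k) x ^+ 2 <= ip x (V x).
Proof.
have := pop_ge0 (pVn n) x; rewrite VnE ipBr ip_sumr subr_ge0.
congr (_ <= _); apply: eq_bigr => k _; rewrite ipZr [ip x (f k)]ipC; ring.
Qed.

(** Write [|f k|^2] by Parseval in the basis [e] and exchange the sums; [lam_quad] at each [e i]
    bounds the result by the trace. *)
Let lam_sum : exists K, forall n, \sum_(0 <= k < n) lam k <= K.
Proof.
have [pV [K hK]] := tV; exists K => n.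
have h N : \sum_(0 <= k < n) lam k * (\sum_(0 <= i < N) ip (e i) (f k) ^+ 2) <= K.
  apply: le_trans (hK N).
  have -> : \sum_(0 <= k < n) lam k * (\sum_(0 <= i < N) ip (e i) (f k) ^+ 2) =
     \sum_(0 <= i < N) \sum_(0 <= k < n) lam k * ip (f k) (e i) ^+ 2.
    rewrite exchange_big/=; apply: eq_bigr => k _; rewrite mulr_sumr.
    by apply: eq_bigr => i _; rewrite ipC.
  by apply: ler_sum => i _; exact: lam_quad.
have cv k : \sum_(0 <= i < N) ip (e i) (f k) ^+ 2 @[N --> \oo] --> ip (f k) (f k).
  have h2 := cvg_ip_norm ip_norm (basis_expansion ip_norm oe (x := f k) ce).
  suff -> : (fun N => \sum_(0 <= i < N) ip (e i) (f k) ^+ 2) =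
    (fun N => ip (\sum_(0 <= i < N) ip (e i) (f k) *: e i) (\sum_(0 <= i < N) ip (e i) (f k) *: e i)) by [].
  apply/funext => N; rewrite norm_orthosum//; apply: eq_bigr => i _.
  by rewrite expr2 -mulrA [_ * ip (e i) (e i)]mulrC (orthosys_coef oe).
have -> : \sum_(0 <= k < n) lam k = \sum_(0 <= k < n) lam k * ip (f k) (f k).
  by apply: eq_bigr => k _; case: (f1 k) => [[_ ->]|[_ ->]]; rewrite ?mulr1 ?mul0r.
have l : \sum_(0 <= k < n) lam k * (\sum_(0 <= i < N) ip (e i) (f k) ^+ 2) @[N --> \oo] -->
    \sum_(0 <= k < n) lam k * ip (f k) (f k).
  elim: n {h} => [|n IH].
    by rewrite big_geq//; under eq_fun do rewrite big_geq//; exact: cvg_cst.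
  rewrite big_nat_recr//=; under eq_fun do rewrite big_nat_recr//=.
  by apply: cvgD => //; apply: cvgM => //; exact: cvg_cst.
rewrite -(cvg_lim _ l)//; apply: limr_le; first exact: cvgP l.
exact: nearW.
Qed.

Let lam_cvg0 : lam n @[n --> \oo] --> (0 : R).
Proof.
apply: cvg_series_cvg_0; have [K hK] := lam_sum.
apply: nondecreasing_is_cvgn.
  by apply/nondecreasing_seqP => n; rewrite /series/= big_nat_recr//= lerDl.
by exists K => _ [n _ <-]; exact: hK.
Qed.

(** For a positive operator the largest Rayleigh quotient bounds the norm. As [lam n] tends to 0,
    the expansion of [V] converges. *)
Let Vn_norm n x : `|Vn n x| <= lam n * `|x|.
Proof.
have [_ _ hm _] := top_eigenpairP (tVn n); rewrite -/(lam n) in hm.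
have l0 := lam0 n.
set y := Vn n x.
have h : ip y y ^+ 2 <= (lam n * ip x x) * (lam n * ip y y).
  have -> : ip y y = ip x (Vn n y) by rewrite -(pop_sym (pVn n)).
  apply: le_trans (pop_CS (pVn n) x y) _.
  have -> : ip x (Vn n y) = ip y y by rewrite -(pop_sym (pVn n)).
  apply: ler_pM; [exact: pop_ge0 | exact: pop_ge0 | exact: hm | exact: hm].
rewrite -(@ler_pXn2r _ 2) ?nnegrE ?mulr_ge0// exprMn -!ip_norm.
have [->|yn] := eqVneq (ip y y) 0.
  by apply: mulr_ge0; [exact: sqr_ge0 | exact: ip_ge0].
have yp : 0 < ip y y by rewrite lt0r yn ip_ge0.
rewrite -(ler_pM2r yp) -expr2; apply: le_trans h _.
by rewrite le_eqVlt; apply/orP; left; apply/eqP; ring.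
Qed.

Lemma spectral : exists (lam : nat -> R) (f : nat -> H),
  spectral_data V lam f.
Proof.
exists lam, f; split; [|split].
- split => // k fk; case: (f1 k) => [[_]|[]//].
  by rewrite fk ip0l => /eqP; rewrite eq_sym oner_eq0.
- move=> n; have := pVn n; congr positive_op; apply/funext => x; exact: VnE.
move=> x; apply/cvgrPdist_le => eps eps0.
have x1 : 0 < `|x| + 1 by rewrite ltr_wpDl.
have k0 : 0 < eps / (`|x| + 1) by exact: divr_gt0.
move/cvgrPdist_le : lam_cvg0 => /(_ _ k0); apply: filterS => n.
rewrite sub0r normrN ger0_norm// => h; rewrite -VnE.
apply: le_trans (Vn_norm n x) _.
apply: (@le_trans _ _ (eps / (`|x| + 1) * `|x|)); first exact: ler_wpM2r.
by rewrite mulrAC ler_pdivrMr// ler_wpM2l ?lerDl// ltW.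
Qed.

End Deflation.

(** * Infinite products and the order of their factors *)

Section Rearrangement.
Variable R : realType.
Implicit Types lam : nat -> R.

Definition has_mult lam (mu : R) (k : nat) :=
  exists2 j : 'I_k -> nat, injective j & forall i, lam (j i) = mu.

Definition indices lam (mu : R) n := [seq l <- iota 0 n | lam l == mu].

Lemma indicesP lam mu n l : (l \in indices lam mu n) = (lam l == mu) && (l < n)%N.
Proof. by rewrite mem_filter mem_iota. Qed.

Lemma indices_uniq lam mu n : uniq (indices lam mu n).
Proof. by rewrite filter_uniq// iota_uniq. Qed.

Lemma size_indices lam mu n : size (indices lam mu n) = count_mem mu [seq lam i | i <- iota 0 n].
Proof. by rewrite size_filter count_map; apply: eq_count. Qed.

Lemma has_mult_indices lam mu n k : (k <= size (indices lam mu n))%N -> has_mult lam mu k.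
Proof.
move=> kn; exists (fun i : 'I_k => nth 0%N (indices lam mu n) i).
  move=> i j /eqP; rewrite nth_uniq ?indices_uniq ?(leq_trans (ltn_ord _))//.
  by move=> /eqP h; exact: val_inj.
move=> i; have := mem_nth 0%N (leq_trans (ltn_ord i) kn).
by rewrite indicesP => /andP[/eqP].
Qed.

Lemma has_mult_count lam mu k : has_mult lam mu k ->
  exists m, forall m', (m <= m')%N -> (k <= size (indices lam mu m'))%N.
Proof.
move=> [j ji jmu]; exists (\max_i (j i).+1) => m' hm.
have -> : k = size [seq j i | i <- enum 'I_k] by rewrite size_map size_enum_ord.
apply: uniq_leq_size; first by rewrite map_inj_uniq// enum_uniq.
move=> l /mapP[i _ ->]; rewrite indicesP jmu eqxx/=; apply: leq_trans hm.
exact: (leq_bigmax_cond (F := fun i => (j i).+1) i).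
Qed.

Lemma prod_subseq (s s' : seq R) : (forall x, x \in s -> 0 <= x) -> subseq s' s ->
  \prod_(x <- s') (1 + x) <= \prod_(x <- s) (1 + x).
Proof.
elim: s s' => [|y s IH] s' hs; first by rewrite subseq0 => /eqP ->.
have y0 : 0 <= y by apply: hs; rewrite inE eqxx.
have hs' x : x \in s -> 0 <= x by move=> xs; apply: hs; rewrite inE xs orbT.
have p0 (t : seq R) : subseq t s -> 0 <= \prod_(x <- t) (1 + x).
  move=> ts; rewrite big_seq prodr_ge0// => x /(mem_subseq ts)/hs' x0.
  by rewrite addr_ge0.
case: s' => [|z s'] /=.
  move=> _; rewrite big_nil big_cons; apply: (@le_trans _ _ (1 * \prod_(x <- s) (1 + x))).
    rewrite mul1r; have := IH [::] hs' (sub0seq _); by rewrite big_nil.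
  by apply: ler_wpM2r; [exact: p0 | rewrite lerDl].
case: eqP => [->|_] h; rewrite !big_cons.
  by apply: ler_wpM2l; [rewrite addr_ge0 | exact: IH].
apply: (@le_trans _ _ (1 * \prod_(x <- s) (1 + x))).
  by rewrite mul1r; have := IH _ hs' h; rewrite big_cons.
by apply: ler_wpM2r; [exact: p0 | rewrite lerDl].
Qed.

Lemma uniform_bound (s : seq R) (Q : R -> nat -> Prop) :
  (forall x, x \in s -> exists m, forall m', (m <= m')%N -> Q x m') ->
  exists m, forall x, x \in s -> Q x m.
Proof.
move=> h; suff [m hm] : exists m, forall x, x \in s -> forall m', (m <= m')%N -> Q x m'.
  by exists m => x xs; exact: hm.
elim: s h => [|y s IH] h; first by exists 0%N.
have [|m1 h1] := IH; first by move=> x xs; apply: h; rewrite inE xs orbT.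
have [|m2 h2] := h y; first by rewrite inE eqxx.
exists (maxn m1 m2) => x; rewrite inE => /orP[/eqP -> m'|xs m'].
  by rewrite geq_max => /andP[_]; exact: h2.
by rewrite geq_max => /andP[h3 _]; exact: h1 h3.
Qed.

(** The nonzero values among the first [n] terms of [lam'] reappear, with multiplicity, in some
    initial segment of [lam]; the extra factors there are at least 1. *)
Lemma prod_dominated lam lam' n : (forall k, 0 <= lam k) ->
  (forall mu k, mu != 0 -> has_mult lam' mu k -> has_mult lam mu k) ->
  exists m, \prod_(j < n) (1 + lam' j) <= \prod_(j < m) (1 + lam j).
Proof.
move=> l0 h; pose s' := [seq x <- [seq lam' i | i <- iota 0 n] | x != 0].
have e' : \prod_(j < n) (1 + lam' j) = \prod_(x <- s') (1 + x).
  rewrite /s' big_filter big_map -(big_mkord xpredT (fun j => 1 + lam' j)).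
  rewrite /index_iota subn0 [LHS](bigID (fun j => lam' j != 0))/=.
  rewrite [X in _ * X]big1 ?mulr1// => i /negPn/eqP ->.
  by rewrite addr0.
have [m hm] : exists m, forall x, x \in s' ->
    (count_mem x s' <= count_mem x [seq lam i | i <- iota 0 m])%N.
  apply: uniform_bound => x; rewrite mem_filter => /andP[x0 xs].
  have cx : count_mem x s' = size (indices lam' x n).
    rewrite size_indices count_filter; apply: eq_in_count => y _ /=.
    by case: eqP => // ->; rewrite x0.
  have := has_mult_count (h x (count_mem x s') x0 _); rewrite cx.
  move=> [|m hm]; first exact: has_mult_indices (leqnn _).
  by exists m => m1 /hm h2; rewrite -(size_indices lam).
exists m; rewrite e'.
have -> : \prod_(j < m) (1 + lam j) = \prod_(x <- [seq lam i | i <- iota 0 m]) (1 + x).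
  by rewrite big_map -(big_mkord xpredT (fun j => 1 + lam j)) /index_iota subn0.
have /count_subseqP[t ts pt] : forall x, (count_mem x s' <= count_mem x [seq lam i | i <- iota 0 m])%N.
  move=> x; have [/hm//|xs] := boolP (x \in s').
  by rewrite (count_memPn xs).
rewrite (perm_big _ pt); apply: prod_subseq => // x /mapP[i _ ->]; exact: l0.
Qed.

(** Meant for [fredholm_det], which is computed from an arbitrarily chosen enumeration. The two
    increasing sequences of partial products dominate each other. *)
Lemma lim_prod_rearranged lam lam' K : (forall k, 0 <= lam k) ->
  (forall n, \sum_(0 <= k < n) lam k <= K) ->
  (forall mu k, mu != 0 -> has_mult lam' mu k <-> has_mult lam mu k) ->
  limn (fun n => \prod_(j < n) (1 + lam' j)) = limn (fun n => \prod_(j < n) (1 + lam j)) /\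
  cvgn (fun n => \prod_(j < n) (1 + lam j)).
Proof.
move=> l0 lK h.
have l0' k : 0 <= lam' k.
  have [->//|ln] := eqVneq (lam' k) 0.
  have [|j _ /(_ ord0) <-] := (h (lam' k) 1%N ln).1; last exact: l0.
  by exists (fun=> k) => // i j _; rewrite !ord1.
have mono (l : nat -> R) : (forall k, 0 <= l k) ->
    nondecreasing_seq (fun n => \prod_(j < n) (1 + l j)).
  move=> hl; apply/nondecreasing_seqP => n; rewrite big_ord_recr/=.
  rewrite -[leLHS]mulr1; apply: ler_wpM2l; last by rewrite lerDl.
  by apply: prodr_ge0 => i _; rewrite addr_ge0.
have cv : cvgn (fun n => \prod_(j < n) (1 + lam j)).
  apply: nondecreasing_is_cvgn; first exact: mono.
  exists (expR K) => _ [n _ <-].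
  apply: (@le_trans _ _ (expR (\sum_(j < n) lam j))).
    rewrite expR_sum; apply: ler_prod => i _; rewrite addr_ge0//=.
    exact: expR_ge1Dx.
  by rewrite ler_expR -(big_mkord xpredT lam).
split=> //.
have dom1 n : exists m, \prod_(j < n) (1 + lam' j) <= \prod_(j < m) (1 + lam j).
  by apply: prod_dominated => // mu k mu0 /(h mu k mu0).
have dom2 n : exists m, \prod_(j < n) (1 + lam j) <= \prod_(j < m) (1 + lam' j).
  by apply: prod_dominated => // mu k mu0 hh; apply/(h mu k mu0).
have ub n : \prod_(j < n) (1 + lam' j) <= limn (fun n => \prod_(j < n) (1 + lam j)).
  by have [m hm] := dom1 n; apply: le_trans hm _; apply: nondecreasing_cvgn_le => //; exact: mono.
have cv' : cvgn (fun n => \prod_(j < n) (1 + lam' j)).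
  apply: nondecreasing_is_cvgn; first exact: mono.
  by exists (limn (fun n => \prod_(j < n) (1 + lam j))) => _ [n _ <-].
apply/eqP; rewrite eq_le; apply/andP; split.
  by apply: limr_le => //; exact: nearW.
apply: limr_le => //; apply: nearW => n; have [m hm] := dom2 n.
by apply: le_trans hm _; apply: nondecreasing_cvgn_le => //; exact: mono.
Qed.

End Rearrangement.

Section Fredholm.
Variables (R : realType) (H : completeNormedModType R) (ip : {dot H for idfun}).
Hypothesis ip_norm : induces_norm ip.
Implicit Types (x y z : H) (A : H -> H).

Lemma enumeration_spectral A lam f : positive_op ip A -> spectral_data ip A lam f ->
  eigenvalue_enumeration A lam.
Proof.
move=> pA [[of_ l0 Af f0 [K lK]] [_ Acv]] mu k mu0.
have f1 l : lam l != 0 -> ip (f l) (f l) = 1.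
  move=> ln; have [_ /(_ l)[//|fl]] := of_.
  by move: ln; rewrite (f0 _ fl) eqxx.
split; last first.
  move=> [j ji jmu]; exists (fun i => f (j i)); last by move=> i; rewrite Af jmu.
  move=> c hc i; have := congr1 (ip (f (j i))) hc.
  rewrite ip0r ip_sumr (bigD1 i)//= ipZr f1 ?jmu// mulr1 big1 ?addr0// => l li.
  by rewrite ipZr; have [h _] := of_; rewrite h ?mulr0// (inj_eq ji) eq_sym.
move=> [g gi Ag].
have lam_cvg0 : lam n @[n --> \oo] --> (0 : R).
  apply: cvg_series_cvg_0; apply: nondecreasing_is_cvgn.
    by apply/nondecreasing_seqP => n; rewrite /series/= big_nat_recr//= lerDl.
  by exists K => _ [n _ <-]; exact: lK.
have [N _ hN] : \forall n \near \oo, `|lam n| < `|mu|.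
  have mp : 0 < `|mu| by rewrite normr_gt0.
  move/cvgrPdist_lt : lam_cvg0 => /(_ _ mp); apply: filterS => n.
  by rewrite sub0r normrN.
have lamN l : (N <= l)%N -> lam l != mu.
  by move=> Nl; apply/eqP => e; have := hN l Nl; rewrite /= e ltxx.
(* An eigenvector for [mu] is orthogonal to every [f l] with [lam l != mu], and since [lam] tends to
   0 only indices below [N] remain. *)
have gE i : g i = \sum_(l <- indices lam mu N) ip (f l) (g i) *: f l.
  have c0 l : lam l != mu -> ip (f l) (g i) = 0.
    move=> lm; apply/eqP; have : (lam l - mu) * ip (f l) (g i) = 0.
      by rewrite mulrBl -ipZl -Af (pop_sym pA) Ag ipZr subrr.
    by move/eqP; rewrite mulf_eq0 subr_eq0 (negbTE lm).
  apply: (scalerI mu0); rewrite -Ag.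
  suff h2 : \sum_(0 <= k < n) (lam k * ip (f k) (g i)) *: f k @[n --> \oo] -->
     mu *: (\sum_(l <- indices lam mu N) ip (f l) (g i) *: f l).
    exact: (cvg_unique _ (Acv (g i)) h2).
  apply: cvg_near_cst; exists N => // n /= Nn.
  rewrite (@big_cat_nat _ _ _ N)//= [X in _ + X]big_nat_cond [X in _ + X]big1 ?addr0; last first.
    by move=> l /andP[/andP[Nl _] _]; rewrite c0 ?lamN// mulr0 scale0r.
  rewrite /indices big_filter scaler_sumr /index_iota subn0.
  rewrite [LHS](bigID (fun l => lam l == mu))/= [X in _ + X]big1 ?addr0.
    by apply: eq_bigr => l /eqP ->; rewrite scalerA.
  by move=> l lm; rewrite c0// mulr0 scale0r.
set s := indices lam mu N in gE.
have [ks|sk] := leqP k (size s); first exact: has_mult_indices ks.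
exfalso.
(* With more vectors than indices, the coefficient matrix has a nonzero left kernel, which is a
   linear relation between the [g i]. *)
pose C : 'M[R]_(k, size s) := \matrix_(i, j) ip (f (nth 0%N s j)) (g i).
have : kermx C != 0.
  rewrite kermx_eq0 -row_leq_rank -ltnNge.
  exact: leq_ltn_trans (rank_leq_col _) sk.
move=> /rowV0Pn[v /sub_kermxP vC vn].
have h0 : \sum_(i < k) v 0 i *: g i = 0.
  have -> : \sum_(i < k) v 0 i *: g i =
     \sum_(j < size s) (\sum_(i < k) v 0 i * ip (f (nth 0%N s j)) (g i)) *: f (nth 0%N s j).
    under [RHS]eq_bigr do rewrite scaler_suml.
    rewrite exchange_big/=; apply: eq_bigr => i _.
    rewrite {1}gE (big_nth 0%N) big_mkord scaler_sumr.
    by apply: eq_bigr => j _; rewrite scalerA.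
  rewrite big1// => j _.
  have -> : \sum_(i < k) v 0 i * ip (f (nth 0%N s j)) (g i) = (v *m C) 0 j.
    by rewrite mxE; apply: eq_bigr => i _; rewrite mxE.
  by rewrite vC mxE scale0r.
move/eqP: vn; apply; apply/rowP => i; rewrite mxE.
exact: (gi (fun i => v 0 i) h0 i).
Qed.

Lemma fredholm_spectral A lam f : positive_op ip A -> spectral_data ip A lam f ->
  (fun n => \prod_(j < n) (1 + lam j)) @ \oo --> fredholm_det A.
Proof.
move=> pA sA; have eA := enumeration_spectral pA sA.
have eA' : eigenvalue_enumeration A (eigenvalues A).
  by rewrite /eigenvalues; apply: (getPex (P := [set l | eigenvalue_enumeration A l])); exists lam.
have [[_ l0 _ _ [K lK]] _] := sA.
have [e c] := lim_prod_rearranged l0 lK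
  (fun mu k mu0 => iff_trans (iff_sym (eA' mu k mu0)) (eA mu k mu0)).
by rewrite /fredholm_det e.
Qed.

End Fredholm.

(** * Functions of a diagonal operator *)

Section Calculus.
Variables (R : realType) (H : completeNormedModType R) (ip : {dot H for idfun}).
Hypothesis ip_norm : induces_norm ip.
Variable f : nat -> H.
Hypothesis of_ : orthosys ip f.
Implicit Types (x y z : H) (d : nat -> R).

Definition bounded_by d D := forall l, `|d l| <= D.

Lemma coef_bound d D x n : bounded_by d D ->
  \sum_(0 <= l < n) (d l * ip (f l) x) ^+ 2 <= D ^+ 2 * ip x x.
Proof.
move=> dD; apply: (@le_trans _ _ (D ^+ 2 * \sum_(0 <= l < n) ip (f l) x ^+ 2)).
  rewrite mulr_sumr; apply: ler_sum => l _; rewrite exprMn; apply: ler_wpM2r; first exact: sqr_ge0.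
  rewrite -[d l ^+ 2]real_normK ?num_real// ler_pXn2r// nnegrE//.
  exact: le_trans (dD l).
by apply: ler_wpM2l; [exact: sqr_ge0 | exact: bessel].
Qed.

Definition diag_op d x := osum f (fun l => d l * ip (f l) x).

Section Bounded.
Variables (d : nat -> R) (D : R).
Hypothesis dD : bounded_by d D.

Lemma diag_op_cvg x : \sum_(0 <= l < n) (d l * ip (f l) x) *: f l @[n --> \oo] --> diag_op d x.
Proof. exact: (osum_cvg ip_norm of_ (coef_bound x ^~ dD)). Qed.

Lemma diag_op_eq x y :
  \sum_(0 <= l < n) (d l * ip (f l) x) *: f l @[n --> \oo] --> y -> diag_op d x = y.
Proof. by move=> h; have h2 := @diag_op_cvg x; exact: (cvg_unique _ h2 h). Qed.

Lemma ip_diag_op j x : ip (f j) (diag_op d x) = d j * ip (f j) x.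
Proof.
rewrite (ip_osum ip_norm of_ _ (coef_bound x ^~ dD)) -mulrA [ip (f j) x * _]mulrC.
by rewrite (orthosys_coef of_).
Qed.

Lemma diag_op_form x z :
  \sum_(0 <= l < n) d l * (ip (f l) x * ip (f l) z) @[n --> \oo] --> ip z (diag_op d x).
Proof.
have h := cvg_ip_lim ip_norm (z := z) (@diag_op_cvg x).
suff -> : (fun n => \sum_(0 <= l < n) d l * (ip (f l) x * ip (f l) z)) =
  (fun n => ip z (\sum_(0 <= l < n) (d l * ip (f l) x) *: f l)) by [].
apply/funext => n; rewrite ip_sumr; apply: eq_bigr => l _.
by rewrite ipZr mulrA [ip z (f l)]ipC.
Qed.

Lemma diag_op_sym x z : ip z (diag_op d x) = ip x (diag_op d z).
Proof.
have h1 := @diag_op_form x z; have h2 := @diag_op_form z x.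
suff e : (fun n => \sum_(0 <= l < n) d l * (ip (f l) x * ip (f l) z)) =
  (fun n => \sum_(0 <= l < n) d l * (ip (f l) z * ip (f l) x)).
  by rewrite e in h1; exact: (cvg_unique _ h1 h2).
by apply/funext => n; apply: eq_bigr => l _; rewrite [ip (f l) x * _]mulrC.
Qed.

Lemma diag_op_norm x : ip (diag_op d x) (diag_op d x) <= D ^+ 2 * ip x x.
Proof. exact: (osum_norm ip_norm of_ (coef_bound x ^~ dD)). Qed.

Lemma diag_op_lin a x y : diag_op d (a *: x + y) = a *: diag_op d x + diag_op d y.
Proof.
apply: diag_op_eq.
have -> : (fun n => \sum_(0 <= l < n) (d l * ip (f l) (a *: x + y)) *: f l) =
  (fun n => a *: (\sum_(0 <= l < n) (d l * ip (f l) x) *: f l) +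
     \sum_(0 <= l < n) (d l * ip (f l) y) *: f l).
  apply/funext => n; rewrite scaler_sumr -big_split/=; apply: eq_bigr => l _.
  by rewrite ipDr ipZr scalerA -scalerDl; congr (_ *: _); ring.
by apply: cvgD; [apply: cvgZr; exact: diag_op_cvg | exact: diag_op_cvg].
Qed.

End Bounded.

Lemma diag_op_comp d1 d2 D1 D2 x : bounded_by d1 D1 -> bounded_by d2 D2 ->
  diag_op d1 (diag_op d2 x) = diag_op (fun l => d1 l * d2 l) x.
Proof.
move=> b1 b2; apply: (diag_op_eq b1).
have b12 : bounded_by (fun l => d1 l * d2 l) (D1 * D2).
  by move=> l; rewrite normrM ler_pM.
have -> : (fun n => \sum_(0 <= l < n) (d1 l * ip (f l) (diag_op d2 x)) *: f l) =
  (fun n => \sum_(0 <= l < n) (d1 l * d2 l * ip (f l) x) *: f l).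
  by apply/funext => n; apply: eq_bigr => l _; rewrite (ip_diag_op b2) mulrA.
exact: (diag_op_cvg b12).
Qed.

(* [kap + d l] is the eigenvalue on [f l] and [kap] the value on the orthogonal complement. *)
Definition func_op (kap : R) d x := kap *: x + diag_op d x.

Lemma func_op_comp k1 d1 k2 d2 D1 D2 x : bounded_by d1 D1 -> bounded_by d2 D2 ->
  func_op k1 d1 (func_op k2 d2 x) =
  func_op (k1 * k2) (fun l => k1 * d2 l + k2 * d1 l + d1 l * d2 l) x.
Proof.
move=> b1 b2; rewrite /func_op (diag_op_lin b1) (diag_op_comp _ b1 b2).
rewrite scalerDr scalerA -!addrA; congr (_ + _).
have b12 : bounded_by (fun l => d1 l * d2 l) (D1 * D2).
  by move=> l; rewrite normrM ler_pM.
have b : bounded_by (fun l => k1 * d2 l + k2 * d1 l + d1 l * d2 l)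
    (`|k1| * D2 + `|k2| * D1 + D1 * D2).
  move=> l; apply: le_trans (ler_normD _ _) _; apply: lerD; last exact: b12.
  apply: le_trans (ler_normD _ _) _; rewrite !normrM.
  by apply: lerD; apply: ler_wpM2l.
symmetry; apply: (diag_op_eq b).
have -> : (fun n => \sum_(0 <= l < n) ((k1 * d2 l + k2 * d1 l + d1 l * d2 l) * ip (f l) x) *: f l) =
  (fun n => k1 *: (\sum_(0 <= l < n) (d2 l * ip (f l) x) *: f l) +
    (k2 *: (\sum_(0 <= l < n) (d1 l * ip (f l) x) *: f l) +
    \sum_(0 <= l < n) (d1 l * d2 l * ip (f l) x) *: f l)).
  apply/funext => n; rewrite !scaler_sumr -!big_split/=; apply: eq_bigr => l _.
  by rewrite !scalerA -!scalerDl; congr (_ *: _); ring.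
apply: cvgD; first by apply: cvgZr; exact: (diag_op_cvg b2).
apply: cvgD; first by apply: cvgZr; exact: (diag_op_cvg b1).
exact: (diag_op_cvg b12).
Qed.

Lemma func_op_id k d x : (forall l, d l = 0) -> func_op k d x = k *: x.
Proof.
move=> d0; rewrite /func_op (@diag_op_eq d 0 _ x 0) ?addr0//.
  by move=> l; rewrite d0 normr0.
have -> : (fun n => \sum_(0 <= l < n) (d l * ip (f l) x) *: f l) = (fun=> 0).
  by apply/funext => n; rewrite big1// => l _; rewrite d0 mul0r scale0r.
exact: cvg_cst.
Qed.

Lemma func_op_positive k d D : bounded_by d D -> 0 <= k -> (forall l, 0 <= k + d l) ->
  positive_op ip (func_op k d).
Proof.
move=> b k0 kd; split.
- move=> a x y; rewrite /func_op (diag_op_lin b) scalerDr scalerDr !scalerA.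
  by rewrite [k * a]mulrC addrACA.
- move=> x; apply: cvgD; first by apply: cvgZr; exact: cvg_id.
  apply/cvgrPdist_le => eps eps0.
  have D0 : 0 <= D by apply: le_trans (b 0%N).
  have D1 : 0 < D + 1 by lra.
  have h : \forall y \near x, `|x - y| <= eps / (D + 1).
    by move: (eps / (D + 1)) (divr_gt0 eps0 D1); apply/cvgrPdist_le; exact: cvg_id.
  apply: filterS h => y h.
  have -> : diag_op d x - diag_op d y = diag_op d (x - y).
    by rewrite [x - y]addrC -[- y]scaleN1r (diag_op_lin b) scaleN1r addrC.
  apply: (@le_trans _ _ (D * `|x - y|)).
    rewrite -(@ler_pXn2r _ 2) ?nnegrE ?mulr_ge0// exprMn -!ip_norm.
    exact: diag_op_norm.
  apply: (@le_trans _ _ (D * (eps / (D + 1)))); first exact: ler_wpM2l.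
  by rewrite mulrA ler_pdivrMr// mulrC ler_wpM2l ?lerDl// ltW.
- move=> x y; rewrite /func_op ipDl ipDr ipZl ipZr; congr (_ + _).
  by rewrite ipC; exact: (diag_op_sym b).
move=> x; rewrite /func_op ipDr ipZr.
have h := diag_op_form b (x := x) (z := x).
rewrite -(cvg_lim _ h)// addrC -lerBlDr sub0r; apply: limr_ge; first exact: cvgP h.
apply: nearW => n; rewrite lerNl.
apply: (@le_trans _ _ (k * \sum_(0 <= l < n) ip (f l) x ^+ 2)); last first.
  by apply: ler_wpM2l => //; exact: bessel.
rewrite -sumrN mulr_sumr; apply: ler_sum => l _.
rewrite -subr_ge0 opprK.
have -> : k * ip (f l) x ^+ 2 + d l * (ip (f l) x * ip (f l) x) = (k + d l) * ip (f l) x ^+ 2 by ring.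
by apply: mulr_ge0 => //; exact: sqr_ge0.
Qed.

End Calculus.

Section Resolvent.
Variables (R : realType) (H : completeNormedModType R) (ip : {dot H for idfun}).
Hypothesis ip_norm : induces_norm ip.
Variables (V : H -> H) (lam : nat -> R) (f : nat -> H).
Hypothesis sV : spectral_data ip V lam f.
Variables (rho : R) (rho0 : 0 < rho).

(** Both operators are chosen ones. A two-sided inverse is unique, so [op_inv] returns [S]. Whatever
    positive [B'] with [B' B' = S] is chosen as square root, [|B' m|^2 = <m, S m>]; the explicit [B]
    shows that the choice is not the default. *)
Lemma resolvent_norm m : exists2 b, V b + rho *: b = m &
  `|op_inv_sqrt ip (fun x => V x + rho *: x) m| ^+ 2 = ip m b.
Proof.
have [[of_ l0 Vf f0 [K lK]] [_ Vcv]] := sV.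
have lamK : bounded_by lam K.
  move=> l; rewrite ger0_norm//; apply: le_trans (lK l.+1).
  rewrite big_nat_recr//= lerDr; exact: sumr_ge0.
have VE x : V x + rho *: x = func_op ip f rho lam x.
  by rewrite /func_op addrC (diag_op_eq ip_norm of_ lamK (Vcv x)).
pose g l := (lam l + rho)^-1.
have lr l : 0 < lam l + rho by rewrite ltr_wpDl.
have g0 l : 0 < g l by rewrite invr_gt0.
have gr l : g l <= rho^-1 by rewrite lef_pV2 ?posrE// lerDr.
have r0 : 0 < rho^-1 by rewrite invr_gt0.
pose d l := g l - rho^-1.
have dB : bounded_by d rho^-1.
  by move=> l; rewrite /d ler0_norm ?subr_le0// opprB gerBl ltW.
pose S := func_op ip f rho^-1 d.
have rhon : rho != 0 by rewrite gt_eqF.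
have AS x : func_op ip f rho lam (S x) = x.
  rewrite (func_op_comp ip_norm of_ _ _ _ lamK dB) func_op_id ?mulfV ?scale1r//.
  by move=> l; rewrite /d /g; field; rewrite rhon gt_eqF.
have SA x : S (func_op ip f rho lam x) = x.
  rewrite /S (func_op_comp ip_norm of_ _ _ _ dB lamK) func_op_id ?mulVf ?scale1r//.
  by move=> l; rewrite /d /g; field; rewrite rhon gt_eqF.
have invP : op_inv (fun x => V x + rho *: x) = S.
  rewrite /op_inv; case: xgetP => [S' _ hS'|/(_ S)]; last first.
    by case=> x; rewrite !VE AS SA.
  apply/funext => x; have [_ h] := hS' x.
  by rewrite -[LHS]SA -VE h.
pose dd l := Num.sqrt (g l) - Num.sqrt rho^-1.
have ddB : bounded_by dd (Num.sqrt rho^-1).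
  move=> l; have h : Num.sqrt (g l) <= Num.sqrt rho^-1 by rewrite ler_wsqrtr.
  by rewrite /dd ler0_norm ?subr_le0// opprB gerBl sqrtr_ge0.
pose B := func_op ip f (Num.sqrt rho^-1) dd.
have pB : positive_op ip B.
  apply: (func_op_positive ip_norm of_ ddB); first exact: sqrtr_ge0.
  by move=> l; rewrite /dd addrC subrK sqrtr_ge0.
have BB x : B (B x) = S x.
  rewrite /B (func_op_comp ip_norm of_ _ _ _ ddB ddB) /S.
  have -> : Num.sqrt rho^-1 * Num.sqrt rho^-1 = rho^-1 by rewrite -expr2 sqr_sqrtr// ltW.
  congr (func_op ip f _ _ x); apply/funext => l.
  have e1 : Num.sqrt (g l) ^+ 2 = g l by rewrite sqr_sqrtr// ltW.
  have e2 : Num.sqrt rho^-1 ^+ 2 = rho^-1 by rewrite sqr_sqrtr// ltW.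
  transitivity (Num.sqrt (g l) ^+ 2 - Num.sqrt rho^-1 ^+ 2); last by rewrite e1 e2.
  by rewrite /dd; ring.
exists (S m); first by rewrite VE AS.
rewrite /op_inv_sqrt invP /op_sqrt; case: xgetP => [B' _ [pB' BB']|/(_ B)]; last by case.
by rewrite -ip_norm (pop_sym pB') BB'.
Qed.

End Resolvent.

(** * Passage to the limit *)

Section DetLemmas.
Variable R : realType.

Lemma cvg_sum_seq (T I : Type) (F : set_system T) (FF : Filter F) (s : seq I)
    (u : I -> T -> R) (l : I -> R) : (forall i, u i t @[t --> F] --> l i) ->
  \sum_(i <- s) u i t @[t --> F] --> \sum_(i <- s) l i.
Proof.
move=> h; elim: s => [|i s IH].
  have -> : (fun t => \sum_(i <- [::]) u i t) = (fun=> 0) by apply/funext => t; rewrite big_nil.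
  by rewrite big_nil; exact: cvg_cst.
have -> : (fun t => \sum_(j <- i :: s) u j t) = (fun t => u i t + \sum_(j <- s) u j t).
  by apply/funext => t; rewrite big_cons.
by rewrite big_cons; apply: cvgD.
Qed.

Lemma cvg_prod_seq (T I : Type) (F : set_system T) (FF : Filter F) (s : seq I)
    (u : I -> T -> R) (l : I -> R) : (forall i, u i t @[t --> F] --> l i) ->
  \prod_(i <- s) u i t @[t --> F] --> \prod_(i <- s) l i.
Proof.
move=> h; elim: s => [|i s IH].
  have -> : (fun t => \prod_(i <- [::]) u i t) = (fun=> 1) by apply/funext => t; rewrite big_nil.
  by rewrite big_nil; exact: cvg_cst.
have -> : (fun t => \prod_(j <- i :: s) u j t) = (fun t => u i t * \prod_(j <- s) u j t).
  by apply/funext => t; rewrite big_cons.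
by rewrite big_cons; apply: cvgM.
Qed.

Lemma cvg_det (T : Type) (F : set_system T) (FF : Filter F) n
    (A : T -> 'M[R]_n) (B : 'M[R]_n) : (forall i j, A t i j @[t --> F] --> B i j) ->
  \det (A t) @[t --> F] --> \det B.
Proof.
move=> h; rewrite /determinant; apply: cvg_sum_seq => s.
by apply: cvgM; [exact: cvg_cst | apply: cvg_prod_seq => i].
Qed.

(** One block matrix [X] is completed to a triangular one in two ways. The identity moves a
    determinant of growing size [N] to one of fixed size. *)
Lemma det_sylvester n p (U : 'M[R]_(n, p)) (W : 'M[R]_(p, n)) :
  \det (1%:M + U *m W) = \det (1%:M + W *m U).
Proof.
pose X : 'M[R]_(n + p) := block_mx 1%:M (- U) W 1%:M.
have e1 : X *m block_mx 1%:M U 0 1%:M = block_mx 1%:M 0 W (1%:M + W *m U).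
  rewrite mulmx_block !(mulmx1, mul1mx, mulmx0, addr0, add0r); congr block_mx.
    by rewrite subrr.
  by rewrite addrC.
have e2 : X *m block_mx 1%:M 0 (- W) 1%:M = block_mx (1%:M + U *m W) (- U) 0 1%:M.
  rewrite mulmx_block !(mulmx1, mul1mx, mulmx0, addr0, add0r); congr block_mx.
    by rewrite mulNmx mulmxN opprK.
  by rewrite subrr.
have := congr1 determinant e1; rewrite det_mulmx det_ublock det_lblock !det1 !mul1r mulr1 => <-.
by have := congr1 determinant e2; rewrite det_mulmx det_ublock det_lblock !det1 !mulr1.
Qed.

Lemma det_mono n (A C : 'M[R]_n) : posdef A -> psd C -> \det A <= \det (A + C).
Proof.
move=> pA pC; have pB := posdefD pA pC.
have [dA _] := hadamard pA; have [dB _] := hadamard pB.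
rewrite -ler_ln ?posrE// -subr_ge0; apply: le_trans (ln_det_tangent pA pB).
have -> : A + C - A = C by rewrite addrC addKr.
have [L uL e] := posdef_factor (posdef_invmx pB).
have uB := posdef_unitmx pB.
have iB : invmx (A + C) = invmx L *m (invmx L)^T.
  have -> : invmx (A + C) = invmx L *m (L *m invmx (A + C) *m L^T) *m invmx L^T.
    by rewrite -(mulmxA L) mulKmx// mulmxK// unitmx_tr.
  by rewrite e mulmx1 trmx_inv.
rewrite iB -mulmxA mxtrace_mulC; set M := (invmx L)^T.
have -> : invmx L = M^T by rewrite trmxK.
rewrite /mxtrace; apply: sumr_ge0 => i _.
have -> : (M *m C *m M^T) i i = form C (M^T *m delta_mx i 0) (M^T *m delta_mx i 0).
  by rewrite -formM form_delta.
by have [_ h] := pC.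
Qed.

End DetLemmas.

Section GramMatrices.
Variables (R : realType) (H : completeNormedModType R) (ip : {dot H for idfun}).
Hypothesis ip_norm : induces_norm ip.
Variable e : nat -> H.
Hypothesis oe : orthosys ip e.
Hypothesis ce : complete_sys ip e.
Implicit Types (x y z m : H) (V A : H -> H).

Definition gram N V : 'M[R]_N := \matrix_(i, j) ip (e i) (V (e j)).
Definition coords N x : 'cV[R]_N := \col_i ip (e i) x.

Lemma gram_form N V (u v : 'cV[R]_N) : positive_op ip V ->
  form (gram N V) u v = ip (\sum_(i < N) u i 0 *: e i) (V (\sum_(j < N) v j 0 *: e j)).
Proof.
move=> pV; rewrite formE ip_suml; apply: eq_bigr => i _.
rewrite (pop_sum pV) ip_sumr; apply: eq_bigr => j _.
by rewrite ipZl (popZ pV) ipZr mxE; ring.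
Qed.

Lemma gram_psd N V : positive_op ip V -> psd (gram N V).
Proof.
move=> pV; split; last by move=> u; rewrite gram_form//; exact: pop_ge0.
by apply/matrixP => i j; rewrite !mxE ipC (pop_sym pV).
Qed.

Lemma regmx_gram N V rho : regmx rho (gram N V) = 1%:M + gram N (fun x => rho^-1 *: V x).
Proof. by apply/matrixP => i j; rewrite !mxE ipZr. Qed.

(** [<m, (V + rho)^-1 m>] is the maximum over [x] of [2 <m, x> - <x, (V + rho) x>], and [reg_quad]
    is the same maximum over the span of the first [N] vectors. It is squeezed between the value at
    the projection [p N] of [b] and the full maximum. *)
Lemma reg_quad_cvg V rho m b : positive_op ip V -> 0 < rho -> V b + rho *: b = m ->
  reg_quad rho (gram N V) (coords N m) @[N --> \oo] --> ip m b.
Proof.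
move=> pV rho0 Vb.
have rhon : rho != 0 by rewrite gt_eqF.
pose p N := \sum_(0 <= i < N) ip (e i) b *: e i.
have pb : p N @[N --> \oo] --> b by exact: basis_expansion.
have l1 : 2 * ip m (p N) - rho * ip (p N) (p N) - ip (p N) (V (p N)) @[N --> \oo] --> ip m b.
  have -> : ip m b = 2 * ip m b - rho * ip b b - ip b (V b).
    by rewrite -Vb ipDl ipZl (pop_sym pV); ring.
  apply: cvgB; last first.
    have Vp : V (p N) @[N --> \oo] --> V b by exact: (@pop_cvg _ _ ip V pV).
    exact: (cvg_ip2 ip_norm).
  have c1 := cvg_ip_lim ip_norm (z := m) pb.
  have c2 : ip (p N) (p N) @[N --> \oo] --> ip b b by exact: (cvg_ip2 ip_norm).
  by apply: cvgB; [apply: cvgM c1 | apply: cvgM c2]; exact: cvg_cst.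
apply: (squeeze_cvgr _ l1 (cvg_cst (ip m b))).
apply: nearW => N.
have pG := gram_psd N pV; have pB := regmx_posdef rho0 pG.
have [_ B0] := posdef_psd pB.
set G := gram N V in pG pB B0 *; set mv := coords N m; set Bi := invmx (regmx rho G).
apply/andP; split.
  pose u := coords N b.
  have := B0 (rho^-1 *: (Bi *m mv) - u).
  rewrite -scaleN1r !formDl !formDr !formZl !formZr.
  have [sB _] := pB.
  rewrite (formC u (Bi *m mv) sB) form_inv_inv // !form_inv_self // => h.
  have e1 : form 1%:M mv u = ip m (p N).
    rewrite form1 /p ip_sumr big_mkord; apply: eq_bigr => i _.
    by rewrite !mxE ipZr [ip m _]ipC mulrC.
  have e2 : form (regmx rho G) u u = ip (p N) (p N) + rho^-1 * ip (p N) (V (p N)).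
    rewrite /regmx form_mxD form_mxZ gram_form// form1_ge.
    have -> : \sum_(i < N) u i 0 *: e i = p N.
      by rewrite /p big_mkord; apply: eq_bigr => i _; rewrite mxE.
    congr (_ + _); rewrite /p norm_orthosum// big_mkord; apply: eq_bigr => i _.
    by rewrite mxE expr2 -mulrA [_ * ip (e i) (e i)]mulrC (orthosys_coef oe).
  rewrite e1 e2 -/Bi in h.
  have : 0 <= rho * (rho^-1 * (rho^-1 * form Bi mv mv) + -1 * (rho^-1 * ip m (p N)) +
     (rho^-1 * (-1 * ip m (p N)) + -1 * (-1 * (ip (p N) (p N) + rho^-1 * ip (p N) (V (p N)))))).
    by apply: mulr_ge0; [exact: ltW | move: h; congr (_ <= _); ring].
  have -> : rho * (rho^-1 * (rho^-1 * form Bi mv mv) + -1 * (rho^-1 * ip m (p N)) +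
     (rho^-1 * (-1 * ip m (p N)) + -1 * (-1 * (ip (p N) (p N) + rho^-1 * ip (p N) (V (p N)))))) =
     reg_quad rho G mv - (2 * ip m (p N) - rho * ip (p N) (p N) - ip (p N) (V (p N))).
    by rewrite /reg_quad -/Bi; field.
  by rewrite subr_ge0.
pose be := resolvent_vec rho G mv; pose s := \sum_(i < N) be i 0 *: e i.
have q1 : ip m s = reg_quad rho G mv.
  rewrite /s ip_sumr.
  have -> : reg_quad rho G mv = form 1%:M mv be.
    by rewrite /be /resolvent_vec formZr /reg_quad /form mulmx1 mulmxA.
  by rewrite form1; apply: eq_bigr => i _; rewrite ipZr [in RHS]mulrC [mv i 0]mxE [ip m _]ipC.
have q2 : form (regmx rho G) be be = rho^-1 * reg_quad rho G mv.
  by rewrite /be /resolvent_vec formZl formZr form_inv_inv.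
(* Only an inequality, since some [e i] may be 0 while [be i 0] is counted in full. *)
have q3 : rho * ip s s + ip s (V s) <= reg_quad rho G mv.
  have -> : reg_quad rho G mv = rho * form (regmx rho G) be be by rewrite q2 mulrA mulfV// mul1r.
  rewrite /regmx form_mxD form_mxZ gram_form// -/s mulrDr mulrA mulfV// mul1r lerD2r.
  apply: ler_wpM2l; first exact: ltW.
  rewrite form1_ge {1}/s ip_suml; apply: ler_sum => i _.
  have -> : ip (be i 0 *: e i) s = be i 0 ^+ 2 * ip (e i) (e i).
    rewrite ipZl /s ip_sumr (bigD1 i)//= ipZr big1 ?addr0; first by ring.
    by move=> j ji; rewrite ipZr; have [h _] := oe; rewrite h ?mulr0// eq_sym.
  rewrite -[leRHS]mulr1; apply: ler_wpM2l; first exact: sqr_ge0.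
  by have /andP[] := orthosys_ip01 oe i.
have h1 := pop_ge0 pV (b - s); have h2 := ip_ge0 ip_norm (b - s).
have h3 : 0 <= ip (b - s) (V (b - s)) + rho * ip (b - s) (b - s).
  by apply: addr_ge0 => //; apply: mulr_ge0 => //; exact: ltW.
have hb : ip b m = ip b (V b) + rho * ip b b by rewrite -Vb ipDr ipZr.
have hs : ip s m = ip s (V b) + rho * ip s b by rewrite -Vb ipDr ipZr.
move: h3; rewrite -scaleN1r (popD pV) (popZ pV) !ipDl !ipDr !ipZl !ipZr.
rewrite -(pop_sym pV b s) [ip (V b) s]ipC [ip b s]ipC.
move: q1 q3 hb hs; rewrite [ip m s]ipC [ip m b]ipC => q1 q3 hb hs h3.
move: (ip b m) (ip s m) (reg_quad rho G mv) (ip b (V b)) (ip s (V b)) (ip s (V s)) hb hs q1 q3 h3.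
move=> bm sm q bVb sVb sVs hb hs q1 q3 h3.
have : 0 <= bm - 2 * sm + (rho * ip s s + sVs) by rewrite hb hs; move: h3; congr (_ <= _); ring.
lra.
Qed.

Lemma gramD N V A : gram N (fun x => V x + A x) = gram N V + gram N A.
Proof. by apply/matrixP => i j; rewrite !mxE ipDr. Qed.

Section Fredholm.
Variables (A : H -> H) (lam : nat -> R) (f : nat -> H).
Hypothesis pA : positive_op ip A.
Hypothesis sA : spectral_data ip A lam f.

Let An n x := \sum_(0 <= l < n) (lam l * ip (f l) x) *: f l.
Let U N n : 'M[R]_(N, n) := \matrix_(i, l) (Num.sqrt (lam l) * ip (e i) (f l)).

Let l0 k : 0 <= lam k. Proof. by have [[_ h _ _ _] _] := sA. Qed.
Let of_ : orthosys ip f. Proof. by have [[h _ _ _ _] _] := sA. Qed.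

Let gram_An N n : gram N (An n) = U N n *m (U N n)^T.
Proof.
apply/matrixP => i j; rewrite !mxE /An ip_sumr big_mkord; apply: eq_bigr => l _.
rewrite !mxE ipZr [ip (f l) (e j)]ipC -[in LHS](sqr_sqrtr (l0 l)); ring.
Qed.

Let UU N n l k : ((U N n)^T *m U N n) l k =
  Num.sqrt (lam l) * Num.sqrt (lam k) * \sum_(0 <= i < N) ip (e i) (f l) * ip (e i) (f k).
Proof.
rewrite mxE big_mkord mulr_sumr; apply: eq_bigr => i _; rewrite !mxE; ring.
Qed.

Let parseval x y : \sum_(0 <= i < N) ip (e i) x * ip (e i) y @[N --> \oo] --> ip x y.
Proof.
have h := cvg_ip_lim ip_norm (z := x) (basis_expansion ip_norm oe (x := y) ce).
suff -> : (fun N => \sum_(0 <= i < N) ip (e i) x * ip (e i) y) =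
  (fun N => ip x (\sum_(0 <= i < N) ip (e i) y *: e i)) by [].
by apply/funext => N; rewrite ip_sumr; apply: eq_bigr => i _; rewrite ipZr [ip x _]ipC mulrC.
Qed.

(** After [det_sylvester] the size is fixed and, by Parseval, the entries converge to those of a
    diagonal matrix. *)
Let det_An_cvg n : \det (1%:M + gram N (An n)) @[N --> \oo] --> \prod_(l < n) (1 + lam l).
Proof.
have -> : (fun N => \det (1%:M + gram N (An n))) = (fun N => \det (1%:M + (U N n)^T *m U N n)).
  by apply/funext => N; rewrite gram_An det_sylvester.
pose D : 'M[R]_n := \matrix_(l, k) ((l == k)%:R * (1 + lam l)).
have -> : \prod_(l < n) (1 + lam l) = \det D.
  have -> : D = diag_mx (\row_l (1 + lam l)).
    by apply/matrixP => l k; rewrite !mxE; case: eqP => _; rewrite ?mul1r ?mulr1n ?mul0r ?mulr0n.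
  by rewrite det_diag; apply: eq_bigr => l _; rewrite mxE.
apply: cvg_det => l k.
have -> : (fun N => (1%:M + (U N n)^T *m U N n) l k) = (fun N => (l == k)%:R +
   Num.sqrt (lam l) * Num.sqrt (lam k) * \sum_(0 <= i < N) ip (e i) (f l) * ip (e i) (f k)).
  by apply/funext => N; rewrite mxE UU mxE.
have -> : D l k = (l == k)%:R + Num.sqrt (lam l) * Num.sqrt (lam k) * ip (f l) (f k).
  rewrite mxE; have [<-|lk] := eqVneq l k.
    rewrite mul1r -expr2 sqr_sqrtr//; congr (_ + _).
    have [_ /(_ l)[->|fl]] := of_; first by rewrite mulr1.
    by have [[_ _ _ h _] _] := sA; rewrite (h _ fl) mul0r.
  by have [h _] := of_; rewrite h// mulr0 addr0 mul0r.
by apply: cvgD; [exact: cvg_cst | apply: cvgM; [exact: cvg_cst | exact: parseval]].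
Qed.

Let psd_UU N n : psd ((U N n)^T *m U N n).
Proof.
split; first by rewrite trmx_mul trmxK.
move=> u; rewrite /form mulmxA -trmx_mul -mulmxA mxE; apply: sumr_ge0 => i _.
by rewrite mxE -expr2 sqr_ge0.
Qed.

Let det_An_le N n : \det (1%:M + gram N (An n)) <= \prod_(l < n) (1 + lam l).
Proof.
rewrite gram_An det_sylvester.
have pB : posdef (1%:M + (U N n)^T *m U N n) by apply: posdefD; [exact: posdef1 | exact: psd_UU].
have [_ h] := hadamard pB; apply: le_trans h _; apply: ler_prod => l _.
rewrite (ltW (posdef_diag_gt0 l pB))/= mxE UU mxE eqxx lerD2l -expr2 sqr_sqrtr//.
rewrite -[leRHS]mulr1; apply: ler_wpM2l => //.
have -> : \sum_(0 <= i < N) ip (e i) (f l) * ip (e i) (f l) = \sum_(0 <= i < N) ip (e i) (f l) ^+ 2.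
  by apply: eq_bigr => i _; rewrite expr2.
apply: le_trans (bessel ip_norm oe (f l) N) _.
by have /andP[] := orthosys_ip01 of_ l.
Qed.

Let det_An_mono N n : \det (1%:M + gram N (An n)) <= \det (1%:M + gram N A).
Proof.
have [_ [/(_ n) pD _]] := sA.
have e1 : gram N A = gram N (An n) + gram N (fun x => A x - An n x).
  rewrite -gramD; congr gram; apply/funext => x.
  by rewrite addrC subrK.
rewrite e1 addrA; apply: det_mono; last exact: gram_psd.
apply: posdefD; first exact: posdef1.
rewrite gram_An -[X in X *m _]trmxK; split; first by rewrite !trmx_mul !trmxK.
move=> u; rewrite /form mulmxA -trmx_mul -mulmxA mxE; apply: sumr_ge0 => i _.
by rewrite mxE -expr2 sqr_ge0.
Qed.

(** The products over the first [n] eigenvalues bound the truncated determinants, so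
    [fredholm_det A] is an upper bound for every [N]. Below, a truncation with nearly full product
    is fixed; its determinants converge in [N] and stay under those of [A] by [det_An_mono]. *)
Lemma det_gram_cvg : \det (1%:M + gram N A) @[N --> \oo] --> fredholm_det A.
Proof.
have fc := fredholm_spectral pA sA.
have le_fd n : \prod_(l < n) (1 + lam l) <= fredholm_det A.
  rewrite -(cvg_lim _ fc)//; apply: nondecreasing_cvgn_le; last exact: cvgP fc.
  apply/nondecreasing_seqP => k; rewrite big_ord_recr/= -[leLHS]mulr1.
  by apply: ler_wpM2l; [apply: prodr_ge0 => i _; rewrite addr_ge0 | rewrite lerDl].
have ub N : \det (1%:M + gram N A) <= fredholm_det A.
  have c : \det (1%:M + gram N (An n)) @[n --> \oo] --> \det (1%:M + gram N A).
    apply: cvg_det => i j.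
    have -> : (fun n => (1%:M + gram N (An n)) i j) = (fun n => (i == j)%:R + ip (e i) (An n (e j))).
      by apply/funext => n; rewrite !mxE.
    have -> : (1%:M + gram N A) i j = (i == j)%:R + ip (e i) (A (e j)) by rewrite !mxE.
    apply: cvgD; first exact: cvg_cst.
    by apply: (cvg_ip_lim ip_norm); have [_ [_ h]] := sA; exact: h.
  rewrite -(cvg_lim _ c)//; apply: limr_le; first exact: cvgP c.
  by apply: nearW => n; apply: le_trans (det_An_le N n) (le_fd n).
apply/cvgrPdist_le => eps eps0.
have eps2 : 0 < eps / 2 by rewrite divr_gt0.
move/cvgrPdist_le : fc => /(_ _ eps2)[n0 _ /(_ n0 (leqnn _))/= h1].
move/cvgrPdist_le : (@det_An_cvg n0) => /(_ _ eps2); apply: filterS => N h2.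
have h3 := det_An_mono N n0; have h4 := ub N.
rewrite ger0_norm ?subr_ge0//.
move: h1 h2; rewrite !ler_norml => /andP[h5 h6] /andP[h7 h8].
lra.
Qed.

End Fredholm.
End GramMatrices.

Section Limit.
Variables (R : realType) (H : completeNormedModType R) (ip : {dot H for idfun}).
Hypothesis ip_norm : induces_norm ip.
Variable e : nat -> H.
Hypothesis oe : orthosys ip e.
Hypothesis ce : complete_sys ip e.
Implicit Types (x y z m : H) (V A : H -> H).

Lemma nonzero_orthonormal_basis : orthonormal_basis ip (e @` [set i | e i != 0]).
Proof.
have [eo en] := oe; split.
- by move=> _ [i /= ei <-]; case: (en i) => // /eqP; rewrite (negbTE ei).
- by move=> _ _ [i /= _ <-] [j /= _ <-] ij; apply: eo; apply/eqP => h; apply: ij; rewrite h.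
- move=> x h; apply: ce => i; have [->|ei] := eqVneq (e i) 0; first by rewrite ip0l.
  by apply: h; exists i.
Qed.

(** The trace is a sum over a subset of [H]; the nonzero vectors [e i] are distinct, so it can be
    reindexed by [nat], where the zero vectors add nothing. *)
Lemma trace_class_bounded V : positive_trace_class ip V -> trace_bounded ip e V.
Proof.
move=> [pV /(_ _ nonzero_orthonormal_basis)]; rewrite /op_trace => h; split=> //.
have [eo en] := oe.
have e0 i : e i != 0 -> ip (e i) (e i) = 1 by case: (en i) => // -> /eqP.
have inj : set_inj [set i | e i != 0] e.
  move=> i j /set_mem/= ei _ eij; apply/eqP/negPn/negP => ij.
  by have := e0 _ ei; rewrite {2}eij eo// => /esym/eqP; rewrite oner_eq0.
rewrite esum_image// -(@nneseries_esum _ _ (fun i => e i != 0)) in h; last first.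
  by move=> i _; rewrite lee_fin; exact: pop_ge0.
have nn i : (e i != 0) -> (0 <= (ip (e i) (V (e i)))%:E)%E.
  by move=> _; rewrite lee_fin; exact: pop_ge0.
set S := (\sum_(_ <= i <oo | _) _)%E in h.
have S0 : (0 <= S)%E by apply: nneseries_ge0 => i _; exact: nn.
exists (fine S) => n.
rewrite -lee_fin fineK; last by rewrite ge0_fin_numE.
have := @nneseries_lim_ge R (fun i => (ip (e i) (V (e i)))%:E) (fun i => e i != 0) 0 n
  (fun i _ => nn i).
rewrite -/S; apply: le_trans.
rewrite sumEFin lee_fin [leRHS]big_mkcond/=; apply: ler_sum => i _.
by case: eqVneq => // ->; rewrite ip0l.
Qed.

Lemma trace_bounded0 : trace_bounded ip e (fun=> 0).
Proof.
split; last by exists 0 => n; rewrite big1// => i _; rewrite ip0r.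
split.
- by move=> a x y; rewrite scaler0 addr0.
- by move=> x; exact: cvg_cst.
- by move=> x y; rewrite ip0l ip0r.
- by move=> x; rewrite ip0r.
Qed.

Lemma trace_boundedD V A : trace_bounded ip e V -> trace_bounded ip e A ->
  trace_bounded ip e (fun x => V x + A x).
Proof.
move=> [pV [K hK]] [pA [L hL]]; split.
  split.
  - by move=> a x y; rewrite (pop_lin pV) (pop_lin pA) scalerDr addrACA.
  - by move=> x; have [_ cV _ _] := pV; have [_ cA _ _] := pA; apply: cvgD; [exact: cV|exact: cA].
  - by move=> x y; rewrite ipDl ipDr (pop_sym pV) (pop_sym pA).
  - by move=> x; rewrite ipDr addr_ge0// pop_ge0.
exists (K + L) => n; under eq_bigr do rewrite ipDr.
by rewrite big_split/= lerD.
Qed.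

Lemma trace_boundedZ V a : 0 <= a -> trace_bounded ip e V ->
  trace_bounded ip e (fun x => a *: V x).
Proof.
move=> a0 [pV [K hK]]; split.
  split.
  - by move=> b x y; rewrite (pop_lin pV) scalerDr !scalerA [b * a]mulrC.
  - by move=> x; have [_ cV _ _] := pV; apply: cvgZr; exact: cV.
  - by move=> x y; rewrite ipZl ipZr (pop_sym pV).
  - by move=> x; rewrite ipZr; apply: mulr_ge0 => //; exact: pop_ge0.
exists (a * K) => n; under eq_bigr do rewrite ipZr.
by rewrite -mulr_sumr; apply: ler_wpM2l.
Qed.

Lemma trace_bounded_sum (C : nat -> H -> H) n :
  (forall k, trace_bounded ip e (C k)) ->
  trace_bounded ip e (fun x => \sum_(k < n) C k x).
Proof.
move=> tC; elim: n => [|n IH].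
  have -> : (fun x => \sum_(k < 0) C k x) = (fun=> 0) by apply/funext => x; rewrite big_ord0.
  exact: trace_bounded0.
have -> : (fun x => \sum_(k < n.+1) C k x) = (fun x => \sum_(k < n) C k x + C n x).
  by apply/funext => x; rewrite big_ord_recr.
exact: trace_boundedD.
Qed.

Lemma gram_sum (C : nat -> H -> H) n N :
  gram ip e N (fun x => \sum_(k < n) C k x) = \sum_(k < n) gram ip e N (C k).
Proof.
by apply/matrixP => i j; rewrite summxE mxE ip_sumr; apply: eq_bigr => k _; rewrite mxE.
Qed.

Lemma potential_cvg V rho m : trace_bounded ip e V -> 0 < rho ->
  potential rho (gram ip e N V) (coords ip e N m) @[N --> \oo] -->
  expR (rho * hfun (`|op_inv_sqrt ip (fun x => V x + rho *: x) m| / Num.sqrt rho) - ell rho V).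
Proof.
move=> tV rho0; have [pV _] := tV.
have [lam [f sV]] := spectral ip_norm oe ce tV.
have tA : trace_bounded ip e (fun x => rho^-1 *: V x).
  by apply: trace_boundedZ => //; rewrite invr_ge0 ltW.
have [pA _] := tA.
have [mu [g sA]] := spectral ip_norm oe ce tA.
have [b Vb nb] := resolvent_norm ip_norm sV rho0 m.
have cq := reg_quad_cvg ip_norm oe ce pV rho0 Vb.
have cd := det_gram_cvg ip_norm oe ce pA sA.
(* Keeps the limit of the determinants away from 0, where [ln] is not continuous. *)
have d1 : 1 <= fredholm_det (fun x => rho^-1 *: V x).
  rewrite -(cvg_lim _ cd)//; apply: limr_ge; first exact: cvgP cd.
  apply: nearW => N; rewrite -[leLHS](det1 R N).
  by apply: det_mono; [exact: posdef1 | exact: gram_psd].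
have d0 : 0 < fredholm_det (fun x => rho^-1 *: V x) by apply: lt_le_trans d1.
set a := `|_|.
have -> : a / Num.sqrt rho = Num.sqrt (ip m b / rho).
  by rewrite -nb sqrtrM ?sqr_ge0// sqrtr_sqr normr_id sqrtrV// ltW.
have cs : Num.sqrt (reg_quad rho (gram ip e N V) (coords ip e N m) / rho) @[N --> \oo] -->
    Num.sqrt (ip m b / rho).
  apply: (continuous_cvg _ (h := Num.sqrt)); first exact: sqrt_continuous.
  by apply: cvgM; [exact: cq | exact: cvg_cst].
apply: (continuous_cvg _ (h := @expR R)); first exact: continuous_expR.
apply: cvgB.
  apply: cvgM; first exact: cvg_cst.
  have c1 : 1 + Num.sqrt (reg_quad rho (gram ip e N V) (coords ip e N m) / rho) @[N --> \oo] -->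
     1 + Num.sqrt (ip m b / rho) by apply: cvgD; [exact: cvg_cst | exact: cs].
  apply: cvgB => //; apply: cvgM => //.
  apply: (continuous_cvg _ (h := @ln R)) => //; apply: continuous_ln.
  by rewrite ltr_wpDr ?sqrtr_ge0.
apply: cvgM; first exact: cvg_cst.
apply: (continuous_cvg _ (h := @ln R)); first exact: continuous_ln.
have -> : (fun N => \det (regmx rho (gram ip e N V))) =
   (fun N => \det (1%:M + gram ip e N (fun x => rho^-1 *: V x))).
  by apply/funext => N; rewrite regmx_gram.
exact: cd.
Qed.

End Limit.

(** [A] lies in the lower limit over [N] of the crossing events, so its probability is at most [b].
    The slack [1 / (k + 1)] is needed because a strict inequality survives a limit only with a
    margin. *)
Lemma prob_limit_event d (T : measurableType d) (R : realType) (P : probability T R)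
    (s : nat -> nat -> T -> R) (S : nat -> T -> R) (a b : R) :
  (forall N n, measurable_fun setT (s N n)) ->
  (forall N, (P (\bigcup_n [set w | (a < s N n w)%R]) <= b%:E)%E) ->
  {ae P, forall w, forall n, s N n w @[N --> \oo] --> S n w} ->
  exists A : set T, [/\ measurable A,
    {ae P, forall w, A w <-> exists n : nat, (1 <= n)%N /\ S n w > a} & (P A <= b%:E)%E].
Proof.
move=> ms hb hS.
have mB c N n : measurable [set w | c < s N n w].
  rewrite -[X in measurable X]setTI.
  have -> : [set w | c < s N n w] = s N n @^-1` `]c, +oo[.
    by apply/seteqP; split=> w /=; rewrite in_itv/= andbT.
  exact: ms.
pose D K := \bigcap_(N in [set N | (K <= N)%N]) \bigcup_n [set w | a < s N n w].
have mD K : measurable (D K).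
  by apply: bigcap_measurableType => N _; exact: bigcupT_measurable.
pose A := \bigcup_n \bigcup_k \bigcup_K \bigcap_(N in [set N | (K <= N)%N])
   [set w | a + k.+1%:R^-1 < s N n.+1 w].
have mA : measurable A.
  do 3! (apply: bigcupT_measurable => ?).
  exact: bigcap_measurableType.
exists A; split=> //.
  apply: filterS hS => w hS; split.
    move=> [n _ [k _ [K _ h]]]; exists n.+1; split=> //.
    have k0 : 0 < k.+1%:R^-1 :> R by rewrite invr_gt0.
    apply: (@lt_le_trans _ _ (a + k.+1%:R^-1)); first by rewrite ltrDl.
    rewrite -(cvg_lim _ (hS n.+1))//; apply: limr_ge; first exact: cvgP (hS n.+1).
    by exists K => // N /= KN; apply/ltW/h.
  move=> [[|n] [n1 aS]] //; exists n => //.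
  have e0 : 0 < (S n.+1 w - a) / 2 by rewrite divr_gt0// subr_gt0.
  have [k _ hk] := near_infty_natSinv_lt (PosNum e0).
  have {}hk : k.+1%:R^-1 < (S n.+1 w - a) / 2 := hk k (leqnn k).
  exists k => //.
  move/cvgrPdist_lt : (hS n.+1) => /(_ _ e0)[K _ hK]; exists K => // N /= KN.
  have := hK N KN; rewrite /= ltr_norml => /andP[_ h]; move: hk h; move: (_^-1) => q; lra.
have AD : A `<=` \bigcup_K D K.
  move=> w [n _ [k _ [K _ h]]]; exists K => // N /= KN; exists n.+1 => //=.
  by apply: lt_trans (h _ KN); rewrite ltrDl invr_gt0.
have mU : measurable (\bigcup_K D K) by exact: bigcupT_measurable.
have PD K : (P (D K) <= b%:E)%E.
  apply: le_trans (hb K); apply: le_measure; rewrite ?inE//; first exact: bigcupT_measurable.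
  by move=> w; apply => /=.
have cD := nondecreasing_cvg_mu (mu := P) mD mU.
apply: (@le_trans _ _ (P (\bigcup_K D K))); first by apply: le_measure; rewrite ?inE.
have ndD : nondecreasing_seq D.
  move=> K L KL; apply/subsetPset => w h N /= LN; apply: h => /=; exact: leq_trans LN.
rewrite -(cvg_lim _ (cD ndD))//; apply: lime_le; first exact: cvgP (cD ndD).
exact: nearW.
Qed.

Theorem mainTheorem2 (R : realType) (H : completeNormedModType R)
  (ip : {dot H for idfun}) (ip_norm : induces_norm ip)
  (H_sep : separable_space H)
  (d : measure_display) (T : measurableType d) (P : probability T R)
  (F : nat -> set (set T)) (F_filt : filtration F)
  (M : nat -> T -> H) (M_mart : martingale P ip F M)
  (M0 : {ae P, forall w, M 0%N w = 0})
  (X_centered : forall n : nat, (1 <= n)%N ->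
    hilbert_cexp P ip (F n.-1) (increment M n) (fun=> 0))
  (X_bounded : forall n : nat, (1 <= n)%N ->
    {ae P, forall w, `|increment M n w| <= 1})
  (* C i is any version of the conditional expectation of X_i (x) X_i *)
  (C : nat -> T -> H -> H)
  (C_cexp : forall i : nat, (1 <= i)%N ->
    operator_cexp P ip (F i.-1)
      (fun w => rank_one ip (increment M i w) (increment M i w)) (C i))
  (V : nat -> T -> H -> H)
  (V_def : forall n w x, V n w x = \sum_(1 <= i < n.+1) C i w x)
  (rho y : R) (rho_gt0 : 0 < rho) (y_ge0 : 0 <= y) :
  (* the event is measurable up to a P-null set, as C is only determined and
     positive almost surely *)
  exists A : set T,
    [/\ measurable A,
        {ae P, forall w, A w <->
          exists n : nat, (1 <= n)%N /\
            rho * hfun (`|op_inv_sqrt ip (fun x => V n w x + rho *: x) (M n w)|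
                        / Num.sqrt rho)
            > y + ell rho (V n w)}
      & (P A <= (expR (- y))%:E)%E].
Proof.
have [e [oe ce]] := exists_basis ip_norm H_sep.
have [sF FT _] := F_filt; have [_ _ M_cexp] := M_mart.
pose m N n w := coords ip e N (M n w); pose c N n w := gram ip e N (C n w).
have C_ptc n : {ae P, forall w, positive_trace_class ip (C n.+1 w)}.
  by have [] := C_cexp n.+1 isT.
have Me n u : gmeas (F n) (fun w => ip u (M n w)).
  have [_ _ _ /(_ u)[_ _ h _]] := M_cexp n.
  by apply/(gmeasP (sF n)).
have mm N n i : gmeas (F n) (fun w => m N n w i 0).
  have -> : (fun w => m N n w i 0) = fun w => ip (e i) (M n w).
    by apply/funext => w; rewrite mxE.
  exact: Me.
have m0 N : {ae P, forall w, m N 0%N w = 0}.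
  apply: filterS M0 => w Mw; apply/matrixP => i j; rewrite !mxE Mw.
  exact: ip0r.
have mc N n i j : gmeas (F n) (fun w => c N n.+1 w i j).
  have -> : (fun w => c N n.+1 w i j) = fun w => ip (e i) (C n.+1 w (e j)).
    by apply/funext => w; rewrite mxE.
  have [_ /(_ (e i) (e j))[_ _ h _]] := C_cexp n.+1 isT.
  by apply/(gmeasP (sF n)).
have dm N n w i : (m N n.+1 w - m N n w) i 0 = ip (e i) (increment M n.+1 w).
  by rewrite !mxE /increment ipBr.
have x_cent N n i : centered P (F n) (fun w => (m N n.+1 w - m N n w) i 0).
  have [_ _ _ /(_ (e i))/(centered_cexp (FT n))] := X_centered n.+1 isT.
  congr centered; apply/funext => w; rewrite dm ip0r subr0 //.
have xx_cent N n i j : centered P (F n) (fun w =>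
    (m N n.+1 w - m N n w) i 0 * (m N n.+1 w - m N n w) j 0 - c N n.+1 w i j).
  have [_ /(_ (e i) (e j))/(centered_cexp (FT n))] := C_cexp n.+1 isT.
  congr centered; apply/funext => w; rewrite !dm [c _ _ _ _ _]mxE /rank_one ipZr.
  by rewrite [ip _ (e j)]ipC mulrC.
have x_le1 N n : {ae P, forall w, \sum_i (m N n.+1 w - m N n w) i 0 ^+ 2 <= 1}.
  apply: filterS (X_bounded n.+1 isT) => w Xw.
  (* Bessel's inequality: the first [N] coordinates of the increment keep its norm bound. *)
  apply: (@le_trans _ _ (ip (increment M n.+1 w) (increment M n.+1 w))).
    apply: le_trans (bessel ip_norm oe _ N); rewrite big_mkord le_eqVlt; apply/orP; left.
    by apply/eqP/eq_bigr => i _; rewrite dm.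
  by rewrite ip_norm expr_le1.
have c_psd N n : {ae P, forall w, psd (c N n.+1 w)}.
  by apply: filterS (C_ptc n) => w [pC _]; exact: gram_psd.
have VE n w : V n w = fun x => \sum_(k < n) C k.+1 w x.
  by apply/funext => x; rewrite V_def big_add1 big_mkord.
pose s N n w := potential rho (qvar (c N) n w) (m N n w).
pose S n w := expR (rho * hfun (`|op_inv_sqrt ip (fun x => V n w x + rho *: x) (M n w)|
   / Num.sqrt rho) - ell rho (V n w)).
have ms N n : measurable_fun setT (s N n).
  have h := @gmeas_potential _ _ _ _ F_filt rho _ _ _ (mm N) (mc N) n.
  exact: (@gmeas_measurable _ _ _ _ (sF n) (FT n) _ h).
have hb N : (P (\bigcup_n [set w | (expR y < s N n w)%R]) <= ((expR y)^-1)%:E)%E.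
  exact: (finite_dim_ineq F_filt rho_gt0 (mm N) (m0 N) (mc N) (x_cent N) (xx_cent N)
    (x_le1 N) (c_psd N) (expR_gt0 y)).
(* One null set serves all times: outside it every [C k.+1 w] is positive and trace class, hence so
   is each finite sum [V n w]. *)
have hS : {ae P, forall w, forall n, s N n w @[N --> \oo] --> S n w}.
  apply: filterS (ae_foralln C_ptc) => w Cw n.
  have tC k : trace_bounded ip e (C k.+1 w) by exact: trace_class_bounded.
  have tV : trace_bounded ip e (V n w) by rewrite VE; exact: (trace_bounded_sum (C := fun k => C k.+1 w)).
  have -> : (fun N => s N n w) = (fun N => potential rho (gram ip e N (V n w)) (coords ip e N (M n w))).
    by apply/funext => N; rewrite /s /qvar VE (gram_sum ip e (fun k => C k.+1 w)).
  exact: potential_cvg.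
have [A [mA Aw PA]] := prob_limit_event ms hb hS.
exists A; split=> //; last by rewrite expRN.
apply: filterS Aw => w Aw; split=> [/Aw|] [n [n1 h]]; last apply/Aw.
all: exists n; split=> //; move: h; rewrite /S ltr_expR ltrBrDr //.
Qed.
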